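(* Let $k$ be an $F$-finite field of prime characteristic. If $R$ is the $\ell$-th Veronese subring of $k[x,y]$, for some integer $\ell\ge 1$, then $F_*R$ is a strong generator for $\mathsf{D}^{\mathsf b}(\operatorname{mod} R)$.
   Context: $k$ of characteristic $p$ is $F$-finite if $[k:k^p]<\infty$. In $k[x,y]$ the variables have degree one, and the $\ell$-th Veronese subring is the $k$-span of all monomials of total degree divisible by $\ell$. $F\colon R\to R$, $r\mapsto r^p$, is the Frobenius and $F_*$ is restriction of scalars along $F$. $\mathsf{D}^{\mathsf b}(\operatorname{mod} R)$ is the bounded derived category of finitely generated $R$-modules. For an object $G$ of a triangulated category $\mathsf K$ with suspension $\Sigma$: $\operatorname{thick}^1_{\mathsf K}(G)$ is the smallest full subcategory containing $G$ and closed under suspensions (all integer powers of $\Sigma$), finite sums and retracts; for $n>1$, $\operatorname{thick}^n_{\mathsf K}(G)$ is the smallest full subcategory closed under suspensions, finite sums and retracts and containing every $A$ that fits in an exact triangle $A\to B\to C\to \Sigma A$ with $B\in \operatorname{thick}^{n-1}_{\mathsf K}(G)$ and $C\in \operatorname{thick}^1_{\mathsf K}(G)$. $G$ is a strong generator for $\mathsf K$ if $\operatorname{thick}^d_{\mathsf K}(G)=\mathsf K$ for some integer $d$. *)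

(* Defs.v *)
From HB Require Import structures.
From mathcomp Require Import all_boot all_algebra.
From mathcomp Require Import mpoly zify.

Set Implicit Arguments.
Unset Strict Implicit.
Unset Printing Implicit Defensive.

Import GRing.Theory.
Local Open Scope ring_scope.

Definition fingen (R : comNzRingType) (M : lmodType R) : Prop :=
  exists (n : nat) (e : 'I_n -> M),
    forall x : M, exists c : 'I_n -> R, x = \sum_(i < n) c i *: e i.

Lemma fingen_fin (R : comNzRingType) (M : lmodType R) (I : finType)
    (e : I -> M) :
  (forall x : M, exists c : I -> R, x = \sum_(i : I) c i *: e i) -> fingen M.
Proof.
move=> eP; exists #|I|, (e \o enum_val) => x.
have [c ->] := eP x; exists (c \o enum_val).
by rewrite big_enum_val.
Qed.

Lemma fingen0 (R : comNzRingType) (M : lmodType R) :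
  (forall x : M, x = 0) -> fingen M.
Proof.
by move=> M0; exists 0%N, (fun=> 0) => x; exists (fun=> 0); rewrite big_ord0.
Qed.

Lemma fingen_prod (R : comNzRingType) (M N : lmodType R) :
  fingen M -> fingen N -> fingen (M * N)%type.
Proof.
move=> [m [e eP]] [n [f fP]].
apply: (@fingen_fin _ _ ('I_m + 'I_n)%type
  (fun s => match s with inl i => (e i, 0) | inr j => (0, f j) end)).
move=> [x y]; have [c cE] := eP x; have [d dE] := fP y.
exists (fun s => match s with inl i => c i | inr j => d j end).
rewrite big_sumType /=; have El (z : 'I_m) : c z *: (e z, 0) = (c z *: e z, 0) :> (M * N)%type.
  by apply: injective_projections; rewrite //= scaler0.
have Er (z : 'I_n) : d z *: (0, f z) = (0, d z *: f z) :> (M * N)%type.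
  by apply: injective_projections; rewrite //= scaler0.
rewrite (eq_bigr _ (fun z _ => El z)) (eq_bigr _ (fun z _ => Er z)).
have -> : \sum_(i < m) (c i *: e i, 0) = (x, 0) :> (M * N)%type.
  by rewrite cE; elim/big_rec2: _ => // i u v _ ->; rewrite -[LHS]/(_, _) addr0.
have -> : \sum_(i < n) (0, d i *: f i) = (0, y) :> (M * N)%type.
  by rewrite dE; elim/big_rec2: _ => // i u v _ ->; rewrite -[LHS]/(_, _) addr0.
by apply: injective_projections; rewrite /= ?addr0 ?add0r.
Qed.

Record bcomplex (R : comNzRingType) := BComplex {
  cob :> int -> lmodType R;
  cd : forall i : int, {linear cob i -> cob (i + 1)};
  cdd : forall (i : int) (x : cob i), cd (i + 1) (cd i x) = 0;
  cob_fingen : forall i : int, fingen (cob i);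
  cob_bounded : exists N : nat,
    forall i : int, (N < `|i|)%N -> forall x : cob i, x = 0
}.
Arguments cd {R} X i : rename.

Record cmap (R : comNzRingType) (X Y : bcomplex R) := CMap {
  cfun :> forall i : int, {linear X i -> Y i};
  cfun_cd : forall (i : int) (x : X i),
    cfun (i + 1) (cd X i x) = cd Y i (cfun i x)
}.

Definition cid (R : comNzRingType) (X : bcomplex R) : cmap X X :=
  @CMap R X X (fun i => idfun) (fun i x => erefl).

Section Comp.
Variables (R : comNzRingType) (X Y Z : bcomplex R).
Variables (g : cmap Y Z) (f : cmap X Y).
Lemma ccomp_cd (i : int) (x : X i) :
  (g (i + 1) \o f (i + 1)) (cd X i x) = cd Z i ((g i \o f i) x).
Proof. by rewrite /= !cfun_cd. Qed.
Definition ccomp : cmap X Z := @CMap R X Z (fun i => g i \o f i) ccomp_cd.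
End Comp.

(* [f] induces an isomorphism on H^(i + 1) for every i (injectivity, then
   surjectivity), hence on cohomology in all degrees. *)
Definition quasi_iso (R : comNzRingType) (X Y : bcomplex R) (f : cmap X Y) :
    Prop :=
  forall i : int,
    (forall x : X (i + 1), cd X (i + 1) x = 0 ->
       (exists y : Y i, f (i + 1) x = cd Y i y) ->
       exists x' : X i, x = cd X i x') /\
    (forall y : Y (i + 1), cd Y (i + 1) y = 0 ->
       exists x : X (i + 1), cd X (i + 1) x = 0 /\
         exists y' : Y i, y = f (i + 1) x + cd Y i y').

Section Stalk.
Variables (R : comNzRingType) (M : lmodType R) (fgM : fingen M).
Definition stalk_ob (i : int) : lmodType R :=
  match i with Posz 0 => M | _ => 'rV[R]_0 end.
Definition stalk_d (i : int) : {linear stalk_ob i -> stalk_ob (i + 1)} := \0.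
Lemma stalk_dd i (x : stalk_ob i) : stalk_d (i + 1) (stalk_d i x) = 0.
Proof. by []. Qed.
Lemma stalk_fingen i : fingen (stalk_ob i).
Proof.
by case: i => [[|n]|n] //=; apply: fingen0 => x; apply/matrixP => ? [].
Qed.
Lemma stalk_bounded : exists N : nat,
  forall i : int, (N < `|i|)%N -> forall x : stalk_ob i, x = 0.
Proof. by exists 0%N => -[[|n]|n] //= _ x; apply/matrixP => ? []. Qed.
Definition stalk : bcomplex R :=
  BComplex stalk_dd stalk_fingen stalk_bounded.
End Stalk.

Section Zero.
Variable R : comNzRingType.
Lemma rV0_fingen : fingen ('rV[R]_0).
Proof. by apply: fingen0 => x; apply/matrixP => ? []. Qed.
Definition czero : bcomplex R := stalk rV0_fingen.
End Zero.

Section Sum.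
Variables (R : comNzRingType) (X Y : bcomplex R).
Definition csum_ob (i : int) : lmodType R := (X i * Y i)%type.
Definition csum_fun (i : int) (z : csum_ob i) : csum_ob (i + 1) :=
  (cd X i z.1, cd Y i z.2).
Lemma csum_fun_linear i : linear (@csum_fun i).
Proof. by move=> a x y; rewrite /csum_fun /= !linearP. Qed.
HB.instance Definition _ (i : int) :=
  GRing.isLinear.Build R (csum_ob i) (csum_ob (i + 1)) _ (@csum_fun i)
    (@csum_fun_linear i).
Definition csum_d (i : int) : {linear csum_ob i -> csum_ob (i + 1)} :=
  @csum_fun i.
Lemma csum_dd i (z : csum_ob i) : csum_d (i + 1) (csum_d i z) = 0.
Proof. by rewrite /= /csum_fun /= !cdd. Qed.
Lemma csum_fingen i : fingen (csum_ob i).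
Proof. by apply: fingen_prod; apply: cob_fingen. Qed.
Lemma csum_bounded : exists N : nat,
  forall i : int, (N < `|i|)%N -> forall x : csum_ob i, x = 0.
Proof.
have [m mP] := cob_bounded X; have [n nP] := cob_bounded Y.
exists (maxn m n) => i; rewrite gtn_max => /andP[mi ni] [x y].
by rewrite (mP i mi x) (nP i ni y).
Qed.
Definition csum : bcomplex R := BComplex csum_dd csum_fingen csum_bounded.
End Sum.

Lemma absz_addr1 (N : nat) (i : int) : (N.+1 < `|i|)%N -> (N < `|(i + 1)%R|)%N.
Proof. lia. Qed.

(* The suspension Sigma X, with the sign convention d_(Sigma X) = - d_X. *)
Section Shift.
Variables (R : comNzRingType) (X : bcomplex R).
Definition cshift_ob (i : int) : lmodType R := X (i + 1).
Definition cshift_d (i : int) : {linear cshift_ob i -> cshift_ob (i + 1)} :=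
  \- cd X (i + 1).
Lemma cshift_dd i (x : cshift_ob i) : cshift_d (i + 1) (cshift_d i x) = 0.
Proof. by rewrite /= linearN cdd !oppr0. Qed.
Lemma cshift_fingen i : fingen (cshift_ob i).
Proof. exact: cob_fingen. Qed.
Lemma cshift_bounded : exists N : nat,
  forall i : int, (N < `|i|)%N -> forall x : cshift_ob i, x = 0.
Proof.
have [N NP] := cob_bounded X; exists N.+1 => i Ni.
exact/NP/absz_addr1.
Qed.
Definition cshift : bcomplex R :=
  BComplex cshift_dd cshift_fingen cshift_bounded.
End Shift.


Section ShiftMap.
Variables (R : comNzRingType) (X Y : bcomplex R) (f : cmap X Y).
Lemma cshift_map_cd (i : int) (x : cshift X i) :
  f (i + 1 + 1) (cd (cshift X) i x) = cd (cshift Y) i (f (i + 1) x).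
Proof. by rewrite /= linearN cfun_cd. Qed.
Definition cshift_map : cmap (cshift X) (cshift Y) :=
  @CMap R (cshift X) (cshift Y) (fun i => f (i + 1)) cshift_map_cd.
Lemma cshift_quasi_iso : quasi_iso f -> quasi_iso cshift_map.
Proof.
move=> qf i; have [inj surj] := qf (i + 1); split=> [x|y] /= /eqP.
  rewrite oppr_eq0 => /eqP dx [y fx].
  have [|x' xE] := inj x dx; first by exists (- y); rewrite linearN.
  by exists (- x'); rewrite linearN opprK.
rewrite oppr_eq0 => /eqP dy; have [x [dx [y' yE]]] := surj y dy.
exists x; split; first by rewrite dx oppr0.
by exists (- y'); rewrite linearN opprK.
Qed.
End ShiftMap.

Section Cone.
Variables (R : comNzRingType) (X Y : bcomplex R) (f : cmap X Y).
Definition cone_ob (i : int) : lmodType R := (X (i + 1)%R * Y i)%type.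
Definition cone_fun (i : int) (z : cone_ob i) : cone_ob (i + 1) :=
  (- cd X (i + 1) z.1, f (i + 1) z.1 + cd Y i z.2).
Lemma cone_fun_linear i : linear (@cone_fun i).
Proof.
move=> a x y; rewrite /cone_fun /= !linearP.
by congr pair; rewrite /= ?opprD ?scalerN // scalerDr addrACA.
Qed.
HB.instance Definition _ (i : int) :=
  GRing.isLinear.Build R (cone_ob i) (cone_ob (i + 1)) _ (@cone_fun i)
    (@cone_fun_linear i).
Definition cone_d (i : int) : {linear cone_ob i -> cone_ob (i + 1)} :=
  @cone_fun i.
Lemma cone_dd i (z : cone_ob i) : cone_d (i + 1) (cone_d i z) = 0.
Proof.
rewrite /= /cone_fun /= linearN cdd !oppr0 linearN linearD cdd addr0 cfun_cd.
by rewrite addNr.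
Qed.
Lemma cone_fingen i : fingen (cone_ob i).
Proof. by apply: fingen_prod; apply: cob_fingen. Qed.
Lemma cone_bounded : exists N : nat,
  forall i : int, (N < `|i|)%N -> forall x : cone_ob i, x = 0.
Proof.
have [m mP] := cob_bounded X; have [n nP] := cob_bounded Y.
exists (maxn m.+1 n) => i; rewrite gtn_max => /andP[mi ni] [x y].
by rewrite (mP (i + 1) (absz_addr1 mi) x) (nP i ni y).
Qed.
Definition cone : bcomplex R := BComplex cone_dd cone_fingen cone_bounded.

Definition cone_in_fun (i : int) (y : Y i) : cone i := (0, y).
Lemma cone_in_linear i : linear (@cone_in_fun i).
Proof.
by move=> a x y; apply: injective_projections; rewrite //= scaler0 addr0.
Qed.
HB.instance Definition _ (i : int) :=
  GRing.isLinear.Build R (Y i) (cone i) _ (@cone_in_fun i) (@cone_in_linear i).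
Lemma cone_in_cd (i : int) (y : Y i) :
  cone_in_fun (cd Y i y) = cd cone i (cone_in_fun y).
Proof.
by apply: injective_projections; rewrite /= !linear0 ?oppr0 ?add0r.
Qed.
Definition cone_in : cmap Y cone :=
  @CMap R Y cone (fun i => @cone_in_fun i) cone_in_cd.

Definition cone_out_fun (i : int) (z : cone i) : cshift X i := z.1.
Lemma cone_out_linear i : linear (@cone_out_fun i).
Proof. by []. Qed.
HB.instance Definition _ (i : int) :=
  GRing.isLinear.Build R (cone i) (cshift X i) _ (@cone_out_fun i)
    (@cone_out_linear i).
Lemma cone_out_cd (i : int) (z : cone i) :
  cone_out_fun (cd cone i z) = cd (cshift X) i (cone_out_fun z).
Proof. by []. Qed.
Definition cone_out : cmap cone (cshift X) :=
  @CMap R cone (cshift X) (fun i => @cone_out_fun i) cone_out_cd.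
End Cone.

(* D^b(mod R) is the localization, in the sense of Gabriel and Zisman, of the
   category of bounded complexes of finitely generated modules at the
   quasi-isomorphisms.  Its objects are the complexes; [dhom X Y] is the type
   of words in chain maps and formal inverses of quasi-isomorphisms, and the
   morphisms X -> Y are these words up to [deq].  Homotopic chain maps become
   equal, as for every localization at the quasi-isomorphisms. *)
Inductive dhom (R : comNzRingType) : bcomplex R -> bcomplex R -> Type :=
| DMap X Y (f : cmap X Y) : dhom X Y
| DInv X Y (s : cmap X Y) (qs : quasi_iso s) : dhom Y X
| DComp X Y Z (g : dhom Y Z) (f : dhom X Y) : dhom X Z.

Definition did (R : comNzRingType) (X : bcomplex R) : dhom X X :=
  DMap (cid X).

Inductive deq (R : comNzRingType) :
    forall X Y : bcomplex R, dhom X Y -> dhom X Y -> Prop :=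
| deq_refl X Y (a : dhom X Y) : deq a a
| deq_sym X Y (a b : dhom X Y) : deq a b -> deq b a
| deq_trans X Y (a b c : dhom X Y) : deq a b -> deq b c -> deq a c
| deq_comp X Y Z (b b' : dhom Y Z) (a a' : dhom X Y) :
    deq b b' -> deq a a' -> deq (DComp b a) (DComp b' a')
| deq_assoc X Y Z W (c : dhom Z W) (b : dhom Y Z) (a : dhom X Y) :
    deq (DComp c (DComp b a)) (DComp (DComp c b) a)
| deq_idl X Y (a : dhom X Y) : deq (DComp (did Y) a) a
| deq_idr X Y (a : dhom X Y) : deq (DComp a (did X)) a
| deq_ext X Y (f g : cmap X Y) :
    (forall i, f i =1 g i) -> deq (DMap f) (DMap g)
| deq_map X Y Z (g : cmap Y Z) (f : cmap X Y) :
    deq (DMap (ccomp g f)) (DComp (DMap g) (DMap f))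
| deq_invl X Y (s : cmap X Y) (qs : quasi_iso s) :
    deq (DComp (DInv qs) (DMap s)) (did X)
| deq_invr X Y (s : cmap X Y) (qs : quasi_iso s) :
    deq (DComp (DMap s) (DInv qs)) (did Y).

Definition diso (R : comNzRingType) (X Y : bcomplex R) (a : dhom X Y) : Prop :=
  exists b : dhom Y X, deq (DComp b a) (did X) /\ deq (DComp a b) (did Y).

Fixpoint dshift (R : comNzRingType) (X Y : bcomplex R) (a : dhom X Y) :
    dhom (cshift X) (cshift Y) :=
  match a with
  | DMap _ _ f => DMap (cshift_map f)
  | DInv _ _ _ qs => DInv (cshift_quasi_iso qs)
  | DComp _ _ _ g f => DComp (dshift g) (dshift f)
  end.

(* A -> B -> C -> Sigma A is exact when it is isomorphic in D^b(mod R) to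
   X -> Y -> cone f -> Sigma X for some chain map f : X -> Y. *)
Definition exact_triangle (R : comNzRingType) (A B C : bcomplex R)
    (u : dhom A B) (v : dhom B C) (w : dhom C (cshift A)) : Prop :=
  exists (X Y : bcomplex R) (f : cmap X Y)
         (a : dhom A X) (b : dhom B Y) (c : dhom C (cone f)),
    [/\ diso a, diso b & diso c] /\
    [/\ deq (DComp b u) (DComp (DMap f) a),
        deq (DComp c v) (DComp (DMap (cone_in f)) b) &
        deq (DComp (dshift a) w) (DComp (DMap (cone_out f)) c)].

Definition dretract (R : comNzRingType) (A B : bcomplex R) : Prop :=
  exists (i : dhom A B) (r : dhom B A), deq (DComp r i) (did A).

(* Retracts include isomorphic objects, so [tc_shift] and [tc_unshift]
   together are closure under all integer powers of the suspension. *)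
Record thick_closed (R : comNzRingType) (P : bcomplex R -> Prop) : Prop := {
  tc_shift : forall A, P A -> P (cshift A);
  tc_unshift : forall A, P (cshift A) -> P A;
  tc_zero : P (czero R);
  tc_sum : forall A B, P A -> P B -> P (csum A B);
  tc_retract : forall A B, dretract A B -> P B -> P A
}.

Definition thick1 (R : comNzRingType) (G A : bcomplex R) : Prop :=
  forall P, thick_closed P -> P G -> P A.

(* Only the values at n >= 1 are meaningful; the value at 0 is a dummy. *)
Fixpoint thick (R : comNzRingType) (n : nat) (G A : bcomplex R) : Prop :=
  match n with
  | 0 | 1 => thick1 G A
  | m.+1 => forall P, thick_closed P ->
      (forall A' B C (u : dhom A' B) (v : dhom B C) (w : dhom C (cshift A')),
         exact_triangle u v w -> thick m G B -> thick1 G C -> P A') ->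
      P A
  end.

Definition strong_generator (R : comNzRingType) (G : bcomplex R) : Prop :=
  exists d : nat, (0 < d)%N /\ forall A : bcomplex R, thick d G A.

Definition veronese_pred (k : fieldType) (l : nat) : {pred {mpoly k[2]}} :=
  [pred f : {mpoly k[2]} | all (fun m : 'X_{1..2} => (l %| mdeg m)%N) (msupp f)].

Lemma veronese_span (k : fieldType) (l : nat) (f : {mpoly k[2]}) :
  f \in @veronese_pred k l <->
  exists s : seq (k * 'X_{1..2}),
    all (fun cm => (l %| mdeg cm.2)%N) s /\
    f = \sum_(cm <- s) cm.1 *: 'X_[cm.2].
Proof.
split=> [fP | [s [/allP sP ->]]].
  exists [seq (f@_m, m) | m <- msupp f]; split; first by rewrite all_map.
  by rewrite big_map -mpolyE.
apply/allP => m; move/msupp_sum_le/flattenP=> [ms /mapP[cm]].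
rewrite filter_predT => cms -> /msuppZ_le.
by rewrite msuppX inE => /eqP ->; apply: sP.
Qed.

Lemma veronese_subring (k : fieldType) (l : nat) :
  subring_closed (@veronese_pred k l).
Proof.
split=> [|f g /allP fP /allP gP|f g /allP fP /allP gP]; apply/allP => m.
- by rewrite msupp1 inE => /eqP ->; rewrite mdeg0 dvdn0.
- by move/msuppB_le; rewrite mem_cat => /orP[/fP|/gP].
- move/msuppM_le/allpairsP => [[m1 m2] /= [/fP m1P /gP m2P ->]].
  by rewrite mdegD dvdn_add.
Qed.
HB.instance Definition _ (k : fieldType) (l : nat) :=
  GRing.isSubringClosed.Build {mpoly k[2]} (@veronese_pred k l)
    (@veronese_subring k l).

Record veronese (k : fieldType) (l : nat) := Veronese {
  veronese_val :> {mpoly k[2]};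
  _ : veronese_val \in @veronese_pred k l
}.
HB.instance Definition _ (k : fieldType) (l : nat) :=
  [isSub for @veronese_val k l].
HB.instance Definition _ (k : fieldType) (l : nat) :=
  [Choice of veronese k l by <:].
HB.instance Definition _ (k : fieldType) (l : nat) :=
  [SubChoice_isSubComNzRing of veronese k l by <:].

Lemma veronese_pchar (k : fieldType) (l p : nat) :
  p \in [pchar k] -> p \in [pchar veronese k l].
Proof.
rewrite -(pchar_lalg {mpoly k[2]}) => /andP[p_pr /eqP p0].
apply/andP; split=> //; apply/eqP/val_inj.
by rewrite rmorph_nat p0 rmorph0.
Qed.

(* [k : k^p] is finite. *)
Definition F_finite (k : fieldType) (p : nat) : Prop :=
  exists (n : nat) (b : 'I_n -> k),
    forall a : k, exists c : 'I_n -> k, a = \sum_(i < n) c i ^+ p * b i.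

(* F_* R: the additive group of R with a acting as multiplication by F a. *)
Definition frob (R : comNzRingType) (p : nat) (chR : p \in [pchar R]) : Type :=
  R.

Section Frob.
Variables (R : comNzRingType) (p : nat) (chR : p \in [pchar R]).
HB.instance Definition _ := GRing.Zmodule.on (frob chR).
Definition frob_scale (a : R) (x : frob chR) : frob chR :=
  pFrobenius_aut chR a * (x : R).
Lemma frob_scaleA a b x :
  frob_scale a (frob_scale b x) = frob_scale (a * b) x.
Proof. by rewrite /frob_scale pFrobenius_autM_comm ?mulrA //; apply: mulrC. Qed.
Lemma frob_scale1 : left_id 1 frob_scale.
Proof. by move=> x; rewrite /frob_scale pFrobenius_aut1 mul1r. Qed.
Lemma frob_scaleDr : right_distributive frob_scale +%R.
Proof. by move=> a x y; rewrite /frob_scale mulrDr. Qed.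
Lemma frob_scaleDl x : {morph frob_scale^~ x : a b / a + b}.
Proof.
move=> a b; rewrite /frob_scale pFrobenius_autD_comm ?mulrDl //.
exact: mulrC.
Qed.
HB.instance Definition _ :=
  GRing.Zmodule_isLmodule.Build R (frob chR)
    frob_scaleA frob_scale1 frob_scaleDr frob_scaleDl.
End Frob.

Lemma veroneseZX (k : fieldType) (l : nat) (c : k) (m : 'X_{1..2}) :
  (l %| mdeg m)%N -> c *: 'X_[m] \in @veronese_pred k l.
Proof.
move=> lm; apply/allP => m' /msuppZ_le.
by rewrite msuppX inE => /eqP ->.
Qed.

(* F_* R is finitely generated over the Veronese ring R, that is, R is
   F-finite: it is generated by the b_j x^r y^s with r, s < p * l and
   l | r + s, where the b_j span k over k^p. *)
Lemma frob_veronese_fingen (k : fieldType) (l p : nat)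
    (chk : p \in [pchar k]) :
  (0 < l)%N -> F_finite k p -> fingen (frob (veronese_pchar l chk)).
Proof.
move=> l0 [n [b bP]]; have p0 : (0 < p)%N by case/andP: chk => /prime_gt0.
have pl0 : (0 < p * l)%N by rewrite muln_gt0 p0.
pose I := ('I_n * {ffun 'I_2 -> 'I_(p * l)})%type.
pose mon (i : I) : 'X_{1..2} := [multinom (i.2 j : nat) | j < 2].
pose e (i : I) : veronese k l :=
  insubd (0 : veronese k l) (b i.1 *: 'X_[mon i] : {mpoly k[2]}).
have v0 : val (0 : veronese k l) = 0 by exact: rmorph0.
have vD (u v : veronese k l) : val (u + v) = val u + val v by exact: rmorphD.
have main (f : {mpoly k[2]}) : f \in @veronese_pred k l ->
    exists c : I -> veronese k l,
      f = \sum_(i : I) val (c i) ^+ p * val (e i).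
  move=> /allP fP; rewrite (mpolyE f) big_seq.
  have chP : p \in [pchar {mpoly k[2]}] by rewrite pchar_lalg.
  elim/big_ind: _ => [|f1 f2 [c1 ->] [c2 ->]|m mf].
  - exists (fun=> 0); rewrite big1 // => i _.
    by rewrite v0 expr0n gtn_eqF // mul0r.
  - exists (fun i => c1 i + c2 i); rewrite -big_split; apply: eq_bigr => i _.
    rewrite vD -!(pFrobenius_autE chP) pFrobenius_autD_comm ?mulrDl //.
    exact: mulrC.
  have [a aE] := bP f@_m.
  pose q : 'X_{1..2} := [multinom (l * (m j %/ (p * l)))%N | j < 2].
  pose r : {ffun 'I_2 -> 'I_(p * l)} :=
    [ffun j : 'I_2 => Ordinal (ltn_pmod (m j) pl0)].
  have lq : (l %| mdeg q)%N.
    by rewrite mdegE dvdn_sum // => j _; rewrite mnmE dvdn_mulr.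
  have mE i : m = (q *+ p + mon (i, r))%MM.
    apply/mnmP => j; rewrite mnmDE mulmnE !mnmE ffunE /= {1}(divn_eq (m j) (p * l)).
    by congr addn; lia.
  have lr i : (l %| mdeg (mon (i, r)))%N.
    by have := fP m mf; rewrite (mE i) mdegD mdegMn dvdn_addr // dvdn_mulr.
  exists (fun i => if i.2 == r then
    insubd (0 : veronese k l) (a i.1 *: 'X_[q] : {mpoly k[2]}) else 0).
  transitivity (\sum_(i < n) ((a i *: 'X_[q]) ^+ p * (b i *: 'X_[mon (i, r)])
                  : {mpoly k[2]})).
    rewrite aE scaler_suml; apply: eq_bigr => i _.
    rewrite exprZn -scalerAl -scalerAr scalerA mpolyXn -mpolyXD.
    by rewrite {1}(mE i).
  rewrite -(pair_bigA _ (fun i s => val (if s == r then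
    insubd (0 : veronese k l) (a i *: 'X_[q] : {mpoly k[2]}) else 0) ^+ p
      * val (e (i, s)))) /=.
  apply: eq_bigr => i _; rewrite (bigD1 r) //= eqxx big1 ?addr0; last first.
    by move=> s /negPf ->; rewrite v0 expr0n gtn_eqF // mul0r.
  by rewrite /e !insubdK //; apply: veroneseZX.
apply: (@fingen_fin _ (frob (veronese_pchar l chk)) I e) => x.
have [c cE] := main (val (x : veronese k l)) (valP (x : veronese k l)).
exists c; apply/val_inj; rewrite cE.
have -> : \sum_(i : I) c i *: (e i : frob (veronese_pchar l chk)) =
          (\sum_(i : I) c i ^+ p * e i : veronese k l) by [].
have vM (u v : veronese k l) : val (u * v) = val u * val v by exact: rmorphM.
have vX (u : veronese k l) i : val (u ^+ i) = val u ^+ i by exact: rmorphXn.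
rewrite (big_morph (val : veronese k l -> _) vD v0).
by apply: eq_bigr => i _; rewrite vM vX.
Qed.

(* Main.v *)
Require Import Defs.
From HB Require Import structures.
From mathcomp Require Import all_boot all_algebra.
From mathcomp Require Import mpoly zify ring.
From mathcomp Require Import boolp.

(** Write [S = k[x,y]], let [R] be its [l]-th Veronese subring and [G] the push-forward
    of [R] along the Frobenius. As an R-module [S] is the direct sum of the modules
    [M_j], [0 <= j < l], spanned by the monomials of degree congruent to [j] modulo
    [l], and [M_0 = R]. The theorem holds with the uniform bound 7, for the following
    reasons.

    The inclusion of [R] in [S] is split over [R], so a bounded complex [A] of finitely
    generated R-modules is a retract of [A (x)_R S] ([thick_bcomplex]). This is a
    complex of finitely generated modules over the regular ring [S], which makes
    resolutions of length two available. They are needed for complexes rather than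
    modules, and with a control on all terms. Let [V] be a finite set of generators of
    a complex [X] of S-modules, stable under the differential up to 0, and let
    [W_(n,m)] be the complex of finite-dimensional k-vector spaces spanned by the
    [x^a y^b v] with [a <= m], [b <= n] and [v] in [V]. For [n] and [m] large the Koszul
    sequence
      [S (x) W_(n,m) -> S (x) W_(n,m+1) + S (x) W_(n+1,m) -> S (x) W_(n+1,m+1) -> X]
    with tensor products over [k] is exact, injective on the left and surjective on
    the right. The proof divides first by [t - y] and then by [s - x]
    ([one_variable_division], [exact_middle], [exact_left]); the bounds come from
    ascending chains of submodules of finitely generated modules over k[x] and over k
    ([eventually_stable]). A complex [T (x) W], with [W] a complex of vector spaces, is a
    retract of a finite sum of shifts of the module [T], as [W] splits
    ([thick_closed_cell]).

    It remains to pass from [S] to [G]. The monomials of degree [j] give an exact sequence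
      [0 -> M_(l-1)^j -> M_0^(j+1) -> M_j -> 0]
    ([mses_Mod]), so [S] is a quotient [T0 / T1] with [T0] and [T1] sums of copies of [M_0]
    and [M_(l-1)]. These two modules are direct summands of [G]
    ([Mod_retract_frob]): [f |-> f^p] embeds [M_0] and [f |-> f^p x y^(p-1)] embeds
    [M_(l-1)], and the retractions come from a k^p-linear functional on [k] that maps
    1 to 1, which exists as [k] is F-finite. The other [M_j] need not be summands of
    [G], for instance when [l] is large compared to [p].

    By definition a level of [thick] is gained by one triangle with a vertex in
    [thick1]. The resolution above is therefore taken apart into short exact sequences
    of complexes with a term in [thick1]: each of its three terms [S (x) W] contributes
    the two sequences that involve [T1 (x) W] and [T0 (x) W]
    ([thick_resolved_quot]). Starting from the zero complex at level 1, this gives the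
    level [1 + 2 + 2 + 2 = 7] ([thick_length2]). *)

Set Implicit Arguments.
Unset Strict Implicit.
Unset Printing Implicit Defensive.

Import GRing.Theory.
Local Open Scope ring_scope.

(** * Thick subcategories and short exact sequences of complexes *)

(** A chain-level substitute for homotopy: in the derived category the
    quasi-isomorphism [r \o i] can be inverted, so it need not be the identity
    for [A] to be a retract of [B]. *)
Lemma dretract_quasi_iso (R : comNzRingType) (A B : bcomplex R)
    (i : cmap A B) (r : cmap B A) :
  quasi_iso (ccomp r i) -> dretract A B.
Proof.
move=> qs; exists (DMap i), (DComp (DInv qs) (DMap r)).
apply: deq_trans (deq_sym (deq_assoc _ _ _)) _.
by apply: deq_trans (deq_comp (deq_refl _) (deq_sym (deq_map _ _))) (deq_invl _).
Qed.

Lemma quasi_iso_id (R : comNzRingType) (A : bcomplex R) (f : cmap A A) :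
  (forall i, f i =1 id) -> quasi_iso f.
Proof.
move=> fE i; split=> [x _ [y]|y dy]; first by rewrite fE => ->; exists y.
by exists y; split=> //; exists 0; rewrite fE linear0 addr0.
Qed.

Lemma dretract_id (R : comNzRingType) (A B : bcomplex R)
    (i : cmap A B) (r : cmap B A) :
  (forall j x, r j (i j x) = x) -> dretract A B.
Proof. by move=> ri; apply/dretract_quasi_iso/quasi_iso_id => j x; apply: ri. Qed.

Lemma thick_closed_qi (R : comNzRingType) (P : bcomplex R -> Prop)
    (A B : bcomplex R) (s : cmap A B) :
  thick_closed P -> quasi_iso s -> P B <-> P A.
Proof.
move=> cP qs; split; apply: (tc_retract cP).
  by exists (DMap s), (DInv qs); apply: deq_invl.
by exists (DInv qs), (DMap s); apply: deq_invr.
Qed.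

Lemma thick1_closed (R : comNzRingType) (G : bcomplex R) :
  thick_closed (thick1 G).
Proof.
split=> [A PA|A PA||A B PA PB|A B rAB PB] P cP PG.
- exact: tc_shift (PA P cP PG).
- exact: tc_unshift (PA P cP PG).
- exact: tc_zero.
- by apply: tc_sum; [|exact: PA|exact: PB].
- exact: tc_retract rAB (PB P cP PG).
Qed.

Lemma thick_closed_thick (R : comNzRingType) m (G : bcomplex R) :
  thick_closed (thick m G).
Proof.
case: m => [|[|m]]; [exact: thick1_closed..|].
split=> [A PA|A PA||A B PA PB|A B rAB PB] P cP PG.
- exact: tc_shift (PA P cP PG).
- exact: tc_unshift (PA P cP PG).
- exact: tc_zero.
- by apply: tc_sum; [|exact: PA|exact: PB].
- exact: tc_retract rAB (PB P cP PG).
Qed.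

Lemma diso_did (R : comNzRingType) (X : bcomplex R) : diso (did X).
Proof. by exists (did X); split; apply: deq_idl. Qed.

Lemma exact_triangle_cone (R : comNzRingType) (X Y : bcomplex R) (f : cmap X Y) :
  exact_triangle (DMap f) (DMap (cone_in f)) (DMap (cone_out f)).
Proof.
exists X, Y, f, (did X), (did Y), (did (cone f)).
have E Z W (g : dhom Z W) : deq (DComp (did W) g) (DComp g (did Z)).
  exact: deq_trans (deq_idl _) (deq_sym (deq_idr _)).
split; first by split; apply: diso_did.
split; [exact: E|exact: E|].
apply: deq_trans _ (E _ _ _ (DMap (cone_out f))).
by apply: deq_comp (deq_refl _); apply: deq_ext.
Qed.

(** Only triangles that come from an honest chain map are ever used, with
    identities as the three comparison isomorphisms; everything else reduces to
    them by invariance under quasi-isomorphisms. *)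
Lemma thick_fiber (R : comNzRingType) (G X Y : bcomplex R) (f : cmap X Y) m :
  thick m.+1 G Y -> thick1 G (cone f) -> thick m.+2 G X.
Proof.
by move=> tY tC P cP PH; apply: (PH _ _ _ _ _ _ (exact_triangle_cone f)).
Qed.

Record ses (R : comNzRingType) (A B C : bcomplex R)
    (f : cmap A B) (g : cmap B C) : Prop := Ses {
  ses_inj : forall i x, f i x = 0 -> x = 0;
  ses_ex : forall i x, g i x = 0 -> exists y, x = f i y;
  ses_zero : forall i x, g i (f i x) = 0;
  ses_surj : forall i x, exists y, x = g i y
}.

Section SesCone.
Variables (R : comNzRingType) (A B C : bcomplex R).
Variables (f : cmap A B) (g : cmap B C) (E : ses f g).

Definition kcone_fun (i : int) (a : cshift A i) : cone g i := (f (i + 1) a, 0).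
Lemma kcone_linear i : linear (@kcone_fun i).
Proof.
move=> c x y; apply: injective_projections; rewrite /= ?linearP //.
by rewrite scaler0 addr0.
Qed.
HB.instance Definition _ (i : int) :=
  GRing.isLinear.Build R (cshift A i) (cone g i) _ (@kcone_fun i) (@kcone_linear i).
Lemma kcone_cd (i : int) (a : cshift A i) :
  kcone_fun (cd (cshift A) i a) = cd (cone g) i (kcone_fun a).
Proof.
apply: injective_projections; rewrite /= ?linearN ?cfun_cd //.
by rewrite (ses_zero E) linear0 addr0.
Qed.
Definition kcone : cmap (cshift A) (cone g) :=
  @CMap R (cshift A) (cone g) (fun i => @kcone_fun i) kcone_cd.

Lemma kcone_qi : quasi_iso kcone.
Proof.
move=> i; split=> [a /= da [[b c] /= [fa gb]]|[b c] /= [db gbc]].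
  have [b' b'E] := ses_surj E c.
  have [a' a'E] : exists a', b + cd B _ b' = f _ a'.
    by apply: (ses_ex E); rewrite linearD cfun_cd -b'E.
  exists a'; apply/eqP; rewrite -subr_eq0; apply/eqP; apply: (ses_inj E).
  rewrite linearB fa /= linearN cfun_cd -a'E linearD cdd addr0; exact: subrr.
have [b' b'E] := ses_surj E c.
have [a aE] : exists a, b + cd B _ b' = f _ a.
  by apply: (ses_ex E); rewrite linearD cfun_cd -b'E.
exists a; split.
  apply/eqP; rewrite oppr_eq0; apply/eqP; apply: (ses_inj E).
  rewrite cfun_cd -aE linearD cdd addr0; apply/eqP.
  by rewrite -oppr_eq0; apply/eqP.
exists (b', 0); apply: injective_projections => /=.
  by rewrite -aE addrK.
by rewrite add0r linear0 addr0.
Qed.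

(** The rotation of the triangle of [f]: the inclusion of [B] below makes
    [cshift B] quasi-isomorphic to the cone of [cone f -> cshift A]. *)
Definition rcone_fun (i : int) (b : cshift B i) : cone (cone_out f) i :=
  ((0, b), 0).
Lemma rcone_linear i : linear (@rcone_fun i).
Proof.
move=> c x y; apply: injective_projections; last by rewrite /= scaler0 addr0.
by apply: injective_projections; rewrite //= scaler0 addr0.
Qed.
HB.instance Definition _ (i : int) :=
  GRing.isLinear.Build R (cshift B i) (cone (cone_out f) i) _
     (@rcone_fun i) (@rcone_linear i).
Lemma rcone_cd (i : int) (b : cshift B i) :
  rcone_fun (cd (cshift B) i b) = cd (cone (cone_out f)) i (rcone_fun b).
Proof.
apply: injective_projections; last by rewrite /= linear0 oppr0 addr0.
by apply: injective_projections; rewrite //= ?linear0 ?add0r ?oppr0.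
Qed.
Definition rcone : cmap (cshift B) (cone (cone_out f)) :=
  @CMap R (cshift B) (cone (cone_out f)) (fun i => @rcone_fun i) rcone_cd.

Lemma rcone_qi : quasi_iso rcone.
Proof.
move=> i; split=> [b /= db [[[a2 b1] a1] /= [_ bE /esym/eqP]]|].
  rewrite subr_eq0 => /eqP a2E; exists (f _ a1 + b1).
  by rewrite bE a2E cfun_cd /= (linearD (cd B _)).
move=> [[a2 b] a1] /= [_ fab /eqP]; rewrite subr_eq0 => /eqP a2E.
exists (b + f _ a1); split.
  by rewrite /= (linearD (cd B _)) -cfun_cd -a2E (addrC (cd B _ b)).
exists ((a1, 0), 0); apply: injective_projections; last first.
  by rewrite /= linear0 subr0 add0r.
apply: injective_projections => /=.
  by rewrite sub0r opprK.
by rewrite linear0 addr0 addrK.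
Qed.

Definition coneq_fun (i : int) (z : cone f i) : C i := g i z.2.
Lemma coneq_linear i : linear (@coneq_fun i).
Proof. by move=> c x y; rewrite /coneq_fun linearP. Qed.
HB.instance Definition _ (i : int) :=
  GRing.isLinear.Build R (cone f i) (C i) _ (@coneq_fun i) (@coneq_linear i).
Lemma coneq_cd (i : int) (z : cone f i) :
  coneq_fun (cd (cone f) i z) = cd C i (coneq_fun z).
Proof. by rewrite /coneq_fun /= linearD (ses_zero E) add0r cfun_cd. Qed.
Definition coneq : cmap (cone f) C :=
  @CMap R (cone f) C (fun i => @coneq_fun i) coneq_cd.

Lemma coneq_qi : quasi_iso coneq.
Proof.
move=> i; split=> [[a b] /= [da fab] [c]|c dc].
  have [b0 ->] := ses_surj E c; rewrite /coneq_fun /= -cfun_cd => gb.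
  have [a0 a0E] : exists a0, b - cd B _ b0 = f _ a0.
    by apply: (ses_ex E); rewrite linearB gb subrr.
  exists (a0, b0); apply: injective_projections => /=.
    apply/eqP; rewrite -addr_eq0; apply/eqP/(ses_inj E).
    by rewrite linearD (cfun_cd f a0) -a0E linearB cdd subr0.
  by rewrite -a0E subrK.
have [b bE] := ses_surj E c.
have [a aE] : exists a, cd B _ b = f _ a.
  by apply: (ses_ex E); rewrite cfun_cd -bE.
exists (- a, b); split; last by exists 0; rewrite linear0 addr0.
apply: injective_projections => /=; last by rewrite linearN aE addNr.
rewrite linearN opprK; apply: (ses_inj E).
by rewrite cfun_cd -aE cdd.
Qed.

(** The map [kcone] identifies the cone of [B -> C] with [cshift A], so [B] is
    one [thick1] step away from [C]. *)
Lemma thick_ses_mid (G : bcomplex R) m :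
  thick1 G A -> thick m.+1 G C -> thick m.+2 G B.
Proof.
move=> tA tC; apply: (thick_fiber (f := g)) => //.
apply/(thick_closed_qi (thick1_closed G) kcone_qi).
exact: (tc_shift (thick1_closed G)).
Qed.

(** The cone of [f] is quasi-isomorphic to [C] by [coneq], and it is one step
    away from [cshift A], the third vertex being [cshift B] by [rcone]. *)
Lemma thick_ses_quot (G : bcomplex R) m :
  thick m.+1 G A -> thick1 G B -> thick m.+2 G C.
Proof.
move=> tA tB; apply/(thick_closed_qi (thick_closed_thick _ G) coneq_qi).
apply: (thick_fiber (f := cone_out f)).
  exact: (tc_shift (thick_closed_thick _ G)).
apply/(thick_closed_qi (thick1_closed G) rcone_qi).
exact: (tc_shift (thick1_closed G)).
Qed.

End SesCone.

(** * Kernels, and objects resolved in two steps *)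

Lemma quasi_iso_bij (R : comNzRingType) (A B : bcomplex R) (f : cmap A B) :
  (forall i x, f i x = 0 -> x = 0) -> (forall i y, exists x, y = f i x) ->
  quasi_iso f.
Proof.
move=> inj surj i; split=> [x dx [y]|y dy].
  have [x' ->] := surj _ y; rewrite -cfun_cd => /eqP.
  rewrite -subr_eq0 -linearB => /eqP /inj /eqP; rewrite subr_eq0 => /eqP ->.
  by exists x'.
have [x xE] := surj _ y; exists x; split; last by exists 0; rewrite linear0 addr0.
by apply: inj; rewrite cfun_cd -xE.
Qed.

Lemma fingen_surj (R : comNzRingType) (M N : lmodType R) (f : {linear M -> N}) :
  (forall y, exists x, y = f x) -> fingen M -> fingen N.
Proof.
move=> fS [n [e eP]]; exists n, (f \o e) => y; have [x ->] := fS y.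
have [c ->] := eP x; exists c; rewrite linear_sum.
by apply: eq_bigr => i _; rewrite linearZ.
Qed.

Lemma fingen_ext (R : comNzRingType) (A B C : lmodType R)
    (f : {linear A -> B}) (g : {linear B -> C}) :
  (forall x, g x = 0 -> exists y, x = f y) -> (forall y, exists x, y = g x) ->
  fingen A -> fingen C -> fingen B.
Proof.
move=> ex gS [m [e eP]] [n [h hP]].
have [s sP] := choice gS.
apply: (@fingen_fin _ _ ('I_m + 'I_n)%type
  (fun z => match z with inl i => f (e i) | inr j => s (h j) end)) => x.
have [d dE] := hP (g x).
have [|y yE] := ex (x - \sum_(j < n) d j *: s (h j)).
  rewrite linearB linear_sum dE; apply/eqP; rewrite subr_eq0; apply/eqP.
  by apply: eq_bigr => i _; rewrite linearZ -sP.
have [c cE] := eP y.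
exists (fun z => match z with inl i => c i | inr j => d j end).
rewrite big_sumType /= -[LHS](subrK (\sum_(j < n) d j *: s (h j))) yE cE.
rewrite linear_sum; congr (_ + _).
by apply: eq_bigr => i _; rewrite linearZ.
Qed.

Section Kernel.
Variables (R : comNzRingType) (M N : lmodType R) (f : {linear M -> N}).
Definition kerp : {pred M} := [pred x | f x == 0].
Lemma kerp_submod : submod_closed kerp.
Proof.
split=> [|a x y /eqP fx /eqP fy]; rewrite inE ?linear0 //.
by rewrite linearP fx fy scaler0 addr0.
Qed.
HB.instance Definition _ := GRing.isSubmodClosed.Build R M kerp kerp_submod.
Record ker := Ker { ker_val :> M; _ : ker_val \in kerp }.
HB.instance Definition _ := [isSub for ker_val].
HB.instance Definition _ := [Choice of ker by <:].
HB.instance Definition _ := [SubChoice_isSubLmodule of ker by <:].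
Lemma kerE (x : ker) : f (ker_val x) = 0.
Proof. exact/eqP/(valP x). Qed.
Lemma kerI (x : M) : f x = 0 -> x \in kerp.
Proof. by move=> fx; apply/eqP. Qed.
Lemma ker_val_linear : linear ker_val.
Proof. by move=> a x y; rewrite -[LHS]/(val _) linearP. Qed.
HB.instance Definition _ :=
  GRing.isLinear.Build R ker M _ ker_val ker_val_linear.
End Kernel.

Section KernelMap.
Variables (R : comNzRingType) (M N L : lmodType R) (f : {linear M -> N}).
Variables (g : {linear L -> M}) (fg0 : forall x, f (g x) = 0).
Definition to_ker (x : L) : ker f := Ker (kerI (fg0 x)).
Lemma to_ker_linear : linear to_ker.
Proof. by move=> a x y; apply: val_inj; rewrite /= !linearP. Qed.
HB.instance Definition _ := GRing.isLinear.Build R L (ker f) _ to_ker to_ker_linear.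
End KernelMap.

Section KComplex.
Variables (R : comNzRingType) (P Y : bcomplex R) (h : cmap P Y).
Hypothesis fgK : forall i, fingen (ker (h i)).
Lemma ker_complex_h i (x : ker (h i)) : h (i + 1) ((cd P i \o @ker_val _ _ _ (h i)) x) = 0.
Proof. by rewrite /= cfun_cd kerE linear0. Qed.
Definition ker_complex_d i : {linear ker (h i) -> ker (h (i + 1))} :=
  to_ker (@ker_complex_h i).
Lemma ker_complex_dd i (x : ker (h i)) : ker_complex_d (i + 1) (ker_complex_d i x) = 0.
Proof. by apply: val_inj; rewrite /= cdd. Qed.
Lemma ker_complex_bounded : exists N : nat,
  forall i : int, (N < `|i|)%N -> forall x : ker (h i), x = 0.
Proof.
have [N NP] := cob_bounded P; exists N => i Ni x; apply: val_inj.
exact: NP.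
Qed.
(** Finite generation of the kernels is a hypothesis: each time it is derived from a
    surjection onto the kernel, or from an extension. *)
Definition ker_complex : bcomplex R := BComplex ker_complex_dd fgK ker_complex_bounded.
Definition ker_incl : cmap ker_complex P :=
  @CMap R ker_complex P (fun i => @ker_val _ _ _ (h i)) (fun i x => erefl).
Lemma ker_complex_ses : (forall i y, exists x, y = h i x) -> ses ker_incl h.
Proof.
move=> hS; split=> // [i x /= x0|i x hx|i x].
- exact: val_inj.
- by exists (Ker (kerI hx)).
- exact: kerE.
Qed.
Section Lift.
Variables (L : bcomplex R) (g : cmap L P) (hg0 : forall i x, h i (g i x) = 0).
Lemma to_ker_complex_cd i (x : L i) :
  to_ker (@hg0 (i + 1)) (cd L i x) = cd ker_complex i (to_ker (@hg0 i) x).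
Proof. by apply: val_inj; rewrite /= cfun_cd. Qed.
Definition to_ker_complex : cmap L ker_complex :=
  @CMap R L ker_complex (fun i => to_ker (@hg0 i)) to_ker_complex_cd.
End Lift.
End KComplex.

(** A complex that is the quotient of two objects of [thick1]. The modules k[x,y]
    of the final resolution are of this kind over the Veronese ring, without
    lying in [thick1] themselves. *)
Definition resolved (R : comNzRingType) (G C : bcomplex R) : Prop :=
  exists (C1 C0 : bcomplex R) (f : cmap C1 C0) (g : cmap C0 C),
    [/\ ses f g, thick1 G C1 & thick1 G C0].

(** If [C1 -> C0 -> C] resolves [C], let [Y'] be the kernel of [C0 -> C -> Y]. It is
    an extension of [K] by [C1], and [Y] is [C0 / Y']. So [Y] is reached from [K]
    by two exact sequences with a term in [thick1], the only kind of step that raises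
    the level by exactly one. *)
Lemma thick_resolved_quot (R : comNzRingType) (G K C Y : bcomplex R)
    (f : cmap K C) (g : cmap C Y) m :
  resolved G C -> ses f g -> thick m.+1 G K -> thick m.+3 G Y.
Proof.
move=> [C1 [C0 [a [b [sab t1 t0]]]]] sfg tK.
have fgK i : fingen (ker (g i)).
  apply: (@fingen_surj _ (K i) _ (to_ker (ses_zero sfg (i:=i)))) (cob_fingen K i) => y.
  have [x xE] := ses_ex sfg (kerE y); exists x; apply: val_inj; exact: xE.
pose K' := ker_complex fgK.
have tK' : thick m.+1 G K'.
  apply/(thick_closed_qi (thick_closed_thick _ G) (s := to_ker_complex fgK (@ses_zero _ _ _ _ _ _ sfg))) => //.
  apply: quasi_iso_bij => i.
    by move=> x /(congr1 val) /= /(ses_inj sfg).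
  move=> y; have [x xE] := ses_ex sfg (kerE y); exists x; apply: val_inj.
  exact: xE.
pose h := ccomp g b.
have hS i y : exists x, y = h i x.
  have [x ->] := ses_surj sfg y; have [z ->] := ses_surj sab x.
  by exists z.
have ha i x : h i (a i x) = 0 by rewrite /= (ses_zero sab) linear0.
have hbi i (x : ker (h i)) : g i ((b i \o @ker_val _ _ _ (h i)) x) = 0.
  exact: (kerE x).
pose q i : {linear ker (h i) -> ker (g i)} := to_ker (@hbi i).
have qS i y : exists x, y = q i x.
  have [x xE] := ses_surj sab (ker_val y).
  have hx : h i x = 0 by rewrite /= -xE kerE.
  by exists (Ker (kerI hx)); apply: val_inj.
have qex i x : q i x = 0 -> exists y, x = to_ker (@ha i) y.
  move=> /(congr1 val) /= /(ses_ex sab) [y yE].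
  by exists y; apply: val_inj.
have fgY i : fingen (ker (h i)).
  exact: (fingen_ext (@qex i) (@qS i) (cob_fingen C1 i) (fgK i)).
pose Y' := ker_complex fgY.
have qcd i (x : Y' i) : q (i + 1) (cd Y' i x) = cd K' i (q i x).
  by apply: val_inj; rewrite /= cfun_cd.
have s1 : ses (to_ker_complex fgY ha) (@CMap R Y' K' q qcd).
  split=> [i x /(congr1 val) /= /(ses_inj sab)|i x /qex|i x|] //.
  by apply: val_inj; rewrite /= (ses_zero sab).
have tY' : thick m.+2 G Y' by apply: (thick_ses_mid s1).
exact: (thick_ses_quot (ker_complex_ses fgY hS)).
Qed.

(** * Complexes with zero differential *)

Section CSumMap.
Variables (R : comNzRingType) (A B A' B' : bcomplex R).
Variables (f : cmap A B) (f' : cmap A' B').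
Definition csum_map_fun i (z : csum A A' i) : csum B B' i := (f i z.1, f' i z.2).
Lemma csum_map_linear i : linear (@csum_map_fun i).
Proof. by move=> a x y; rewrite /csum_map_fun /= !linearP. Qed.
HB.instance Definition _ i :=
  GRing.isLinear.Build R (csum A A' i) (csum B B' i) _ (@csum_map_fun i)
    (@csum_map_linear i).
Lemma csum_map_cd i (z : csum A A' i) :
  csum_map_fun (cd (csum A A') i z) = cd (csum B B') i (csum_map_fun z).
Proof. by rewrite /csum_map_fun /= /csum_fun /= !cfun_cd. Qed.
Definition csum_map : cmap (csum A A') (csum B B') :=
  @CMap R (csum A A') (csum B B') (fun i => @csum_map_fun i) csum_map_cd.
End CSumMap.

Lemma csum_ses (R : comNzRingType) (A B C A' B' C' : bcomplex R)
    (f : cmap A B) (g : cmap B C) (f' : cmap A' B') (g' : cmap B' C') :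
  ses f g -> ses f' g' -> ses (csum_map f f') (csum_map g g').
Proof.
move=> s s'; split=> i.
- by case=> x y [/(ses_inj s) -> /(ses_inj s') ->].
- case=> x y [/(ses_ex s) [z ->] /(ses_ex s') [z' ->]].
  by exists (z, z').
- by case=> x y /=; rewrite /csum_map_fun /= (ses_zero s) (ses_zero s').
- case=> x y; have [z ->] := ses_surj s x; have [z' ->] := ses_surj s' y.
  by exists (z, z').
Qed.

Lemma resolved_csum (R : comNzRingType) (G A B : bcomplex R) :
  resolved G A -> resolved G B -> resolved G (csum A B).
Proof.
move=> [A1 [A0 [f [g [s t1 t0]]]]] [B1 [B0 [f' [g' [s' t1' t0']]]]].
exists (csum A1 B1), (csum A0 B0), (csum_map f f'), (csum_map g g').
have tc := thick1_closed G.
by split; [exact: csum_ses|exact: (tc_sum tc)|exact: (tc_sum tc)].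
Qed.

Section ZComplex.
Variables (R : comNzRingType) (M : int -> lmodType R).
Hypothesis fgM : forall i, fingen (M i).
Hypothesis bdM : exists N : nat, forall i : int, (N < `|i|)%N -> forall x : M i, x = 0.
Definition zd i : {linear M i -> M (i + 1)} := \0.
Lemma zdd i (x : M i) : zd (i + 1) (zd i x) = 0. Proof. by []. Qed.
Definition zcomplex : bcomplex R := BComplex zdd fgM bdM.
End ZComplex.

Section Degree0.
Variables (R : comNzRingType) (Y : bcomplex R).
(** [Y] without its term in degree 0. *)
Definition pos_ob (i : int) : lmodType R :=
  match i with Posz 0 => 'rV[R]_0 | _ => Y i end.
Lemma pos_fingen i : fingen (pos_ob i).
Proof.
by case: i => [[|n]|n]; try exact: cob_fingen; exact: rV0_fingen.
Qed.
Lemma pos_bounded : exists N : nat,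
  forall i : int, (N < `|i|)%N -> forall x : pos_ob i, x = 0.
Proof.
by have [N NP] := cob_bounded Y; exists N => -[[|n]|n] // iN x; apply: (NP _ iN x).
Qed.
Definition zpos : bcomplex R := zcomplex pos_fingen pos_bounded.
Definition zstalk : bcomplex R := stalk (cob_fingen Y (Posz 0)).

Definition split_fun (i : int) : Y i -> csum zstalk zpos i :=
  match i return Y i -> csum zstalk zpos i with
  | Posz 0 => fun y => (y, 0)
  | Posz n.+1 => fun y => (0, y)
  | Negz n => fun y => (0, y)
  end.
Lemma split_linear i : linear (@split_fun i).
Proof.
by case: i => [[|n]|n] a x y; apply: injective_projections;
   rewrite /= ?scaler0 ?addr0.
Qed.
HB.instance Definition _ i :=
  GRing.isLinear.Build R (Y i) (csum zstalk zpos i) _ (@split_fun i) (@split_linear i).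
Definition join_fun (i : int) : csum zstalk zpos i -> Y i :=
  match i return csum zstalk zpos i -> Y i with
  | Posz 0 => fun y => y.1
  | Posz n.+1 => fun y => y.2
  | Negz n => fun y => y.2
  end.
Lemma join_linear i : linear (@join_fun i).
Proof. by case: i => [[|n]|n]. Qed.
HB.instance Definition _ i :=
  GRing.isLinear.Build R (csum zstalk zpos i) (Y i) _ (@join_fun i) (@join_linear i).
Hypothesis dY : forall i (x : Y i), cd Y i x = 0.
Lemma split_cd i x : @split_fun (i + 1) (cd Y i x) = cd (csum zstalk zpos) i (@split_fun i x).
Proof. by rewrite dY linear0. Qed.
Lemma join_cd i x : @join_fun (i + 1) (cd (csum zstalk zpos) i x) = cd Y i (@join_fun i x).
Proof.
rewrite dY -[RHS](linear0 (@join_fun (i + 1))); congr join_fun.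
Qed.
Lemma zsplit_retract : dretract Y (csum zstalk zpos).
Proof.
apply: (@dretract_id _ _ _ (@CMap R Y (csum zstalk zpos) (fun i => @split_fun i) split_cd)
   (@CMap R (csum zstalk zpos) Y (fun i => @join_fun i) join_cd)).
by case=> [[|n]|n] x.
Qed.
End Degree0.

Section Cast.
Variables (R : comNzRingType) (M : int -> lmodType R).
(** Degrees such as [i + 1 - 1] and [i] are equal but not convertible; this is the
    identity between the corresponding terms. *)
Definition castl (i j : int) (e : i = j) : {linear M i -> M j} :=
  match e in _ = j return {linear M i -> M j} with erefl => idfun end.
Lemma castl_inj i j (e : i = j) x : castl e x = 0 -> x = 0.
Proof. by case: j / e. Qed.
Lemma castl_surj i j (e : i = j) y : exists x, y = castl e x.
Proof. by case: j / e y => y; exists y. Qed.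
End Cast.

Section ZeroDiff.
Variables (R : comNzRingType) (P : bcomplex R -> Prop).
Hypothesis cP : thick_closed P.

(** Such a complex is the sum of its term in degree 0 and of a rest whose shift is
    supported in an interval shorter by one. *)
Lemma zdiff_nonneg n (Y : bcomplex R) :
  (forall i (x : Y i), cd Y i x = 0) ->
  (forall i fg, P (@stalk R (Y i) fg)) ->
  (forall i, ~~ (0 <= i < n%:Z)%R -> forall x : Y i, x = 0) -> P Y.
Proof.
elim: n Y => [|n IH] Y dY sY bY.
  apply: (tc_retract cP) (tc_zero cP).
  pose f i : {linear Y i -> czero R i} := \0.
  pose g i : {linear czero R i -> Y i} := \0.
  have fd i (x : Y i) : f (i + 1) (cd Y i x) = cd (czero R) i (f i x) by [].
  have gd i (x : czero R i) : g (i + 1) (cd (czero R) i x) = cd Y i (g i x).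
    by rewrite linear0.
  apply: (dretract_id (i := @CMap R Y (czero R) f fd) (r := @CMap R (czero R) Y g gd)).
  by move=> j x; apply/esym/bY; lia.
apply: (tc_retract cP) (zsplit_retract dY) _.
apply: (tc_sum cP); first exact: sY.
have sZ j fg : P (@stalk R (pos_ob Y j) fg).
  case: j fg => [[|m]|m] fg; [|exact: sY..].
  apply: (tc_retract cP) (tc_zero cP).
  pose f i : {linear stalk fg i -> czero R i} := \0.
  pose g i : {linear czero R i -> stalk fg i} := \0.
  have fd i (x : stalk fg i) : f (i + 1) (cd _ i x) = cd (czero R) i (f i x) by [].
  have gd i (x : czero R i) : g (i + 1) (cd (czero R) i x) = cd _ i (g i x).
    by rewrite linear0.
  apply: (dretract_id (i := @CMap R _ (czero R) f fd) (r := @CMap R (czero R) _ g gd)).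
  by case=> [[|j]|j] x; apply/matrixP => ? [].
have bZ j : ~~ (0 < j < n.+1%:Z)%R -> forall x : pos_ob Y j, x = 0.
  case: j => [[|m]|m] jb x; first by apply/matrixP => ? [].
    by apply: bY; lia.
  by apply: bY; lia.
apply: (tc_unshift cP); apply: IH => [i x|i fg|i ib x].
- by rewrite /= oppr0.
- exact: sZ.
- by apply: bZ; lia.
Qed.

(** Negative degrees are removed by shifting to the right, which is possible here
    because the differential is zero: the shifted terms [Y (i - 1)] need no
    comparison with a differential of [Y]. *)
Lemma zdiff_closed (Y : bcomplex R) :
  (forall i (x : Y i), cd Y i x = 0) ->
  (forall i fg, P (@stalk R (Y i) fg)) -> P Y.
Proof.
move=> dY sY; have [N NP] := cob_bounded Y.
have [m [n]] : exists m n : nat,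
    forall i, ~~ (- m%:Z <= i < n%:Z)%R -> forall x : Y i, x = 0.
  by exists N, N.+1 => i ib; apply: NP; lia.
elim: m n Y dY sY {N NP} => [|m IH] n Y dY sY bY.
  by apply: (@zdiff_nonneg n) => // i ib; apply: bY; lia.
have [N NP] := cob_bounded Y.
pose M (i : int) : lmodType R := Y (i - 1).
have bM : exists N : nat, forall i : int, (N < `|i|)%N -> forall x : M i, x = 0.
  by exists N.+1 => i iN; apply: NP; lia.
pose Z := zcomplex (fun i => cob_fingen Y (i - 1)) bM.
have e i : i + 1 - 1 = i :> int by lia.
have sd i (x : cshift Z i) : castl Y (e (i + 1)) (cd (cshift Z) i x) = cd Y i (castl Y (e i) x).
  by rewrite dY /= oppr0 linear0.
apply/(@thick_closed_qi _ _ _ _ (@CMap R (cshift Z) Y (fun i => castl Y (e i)) sd)) => //.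
  apply: quasi_iso_bij => i; first exact: (@castl_inj _ Y _ _ (e i)).
  exact: (@castl_surj _ Y _ _ (e i)).
apply: (tc_shift cP); apply: (IH n.+1) => // i; first by move=> fg; apply: sY.
by move=> ib; apply: bY; lia.
Qed.
End ZeroDiff.

(** * Complexes with constant matrices as differentials *)

Section MatrixAction.
Variables (k : fieldType) (R : comNzRingType) (iota : {rmorphism k -> R}).
Section Act.
Variables (T : lmodType R) (m n : nat) (D : 'M[k]_(m, n)).
(** The matrix [D] acts on row vectors with entries in the module [T]: this is
    [T (x) D] for the k-linear map [D]. *)
Definition mact (f : {ffun 'I_m -> T}) : {ffun 'I_n -> T} :=
  [ffun b => \sum_a iota (D a b) *: f a].
Lemma mact_linear : linear mact.
Proof.
move=> c f g; apply/ffunP => b; rewrite !ffunE scaler_sumr -big_split.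
apply: eq_bigr => a _; rewrite !ffunE scalerDr !scalerA.
by rewrite [c * _]mulrC.
Qed.
HB.instance Definition _ :=
  GRing.isLinear.Build R {ffun 'I_m -> T} {ffun 'I_n -> T} _ mact mact_linear.
End Act.

Variable T : lmodType R.
Lemma mactM m n q (D : 'M[k]_(m, n)) (E : 'M[k]_(n, q)) (f : {ffun 'I_m -> T}) :
  mact (D *m E) f = mact E (mact D f).
Proof.
apply/ffunP => b; rewrite !ffunE.
under [RHS]eq_bigr => c _ do rewrite ffunE scaler_sumr.
rewrite exchange_big; apply: eq_bigr => a _; rewrite mxE rmorph_sum scaler_suml.
by apply: eq_bigr => c _; rewrite scalerA -rmorphM mulrC.
Qed.
Lemma mact0 m n (f : {ffun 'I_m -> T}) : mact (0 : 'M_(m, n)) f = 0.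
Proof.
by apply/ffunP => b; rewrite !ffunE big1 // => a _; rewrite mxE rmorph0 scale0r.
Qed.
Lemma mact1 m (f : {ffun 'I_m -> T}) : mact 1%:M f = f.
Proof.
apply/ffunP => b; rewrite !ffunE (bigD1 b) //= big1 ?addr0 => [|a /negPf ab].
  by rewrite mxE eqxx rmorph1 scale1r.
by rewrite mxE ab rmorph0 scale0r.
Qed.
Lemma mactB m n (D E : 'M[k]_(m, n)) (f : {ffun 'I_m -> T}) :
  mact (D - E) f = mact D f - mact E f.
Proof.
apply/ffunP => b; rewrite !ffunE -sumrB.
by apply: eq_bigr => a _; rewrite !mxE rmorphB scalerBl.
Qed.
End MatrixAction.

Lemma fingen_power (R : comNzRingType) (T : lmodType R) r :
  fingen T -> fingen {ffun 'I_r -> T}.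
Proof.
move=> [n [e eP]].
apply: (@fingen_fin _ _ ('I_r * 'I_n)%type
  (fun z => [ffun b => if b == z.1 then e z.2 else 0])) => f.
have [c cP] := choice (fun b => eP (f b)).
exists (fun z => c z.1 z.2).
rewrite -(pair_bigA _ (fun a j => c a j *: [ffun b => if b == a then e j else 0])) /=.
apply/ffunP => b; rewrite sum_ffunE (bigD1 b) //= [X in _ = _ + X]big1 ?addr0 => [|a /negPf ab].
  rewrite sum_ffunE {1}(cP b); apply: eq_bigr => j _.
  by rewrite !ffunE eqxx.
rewrite sum_ffunE big1 // => j _.
by rewrite !ffunE eq_sym ab scaler0.
Qed.

Section ShiftFamily.
Variables (F : int -> Type) (q : forall j, F (j + 1)).
Lemma int_succ_pred (i : int) : i - 1 + 1 = i. Proof. lia. Qed.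
(** Families indexed by all degrees are often given in the degrees [j + 1]; every
    degree is of this form, up to a transport. *)
Definition fam_pred (i : int) : F i := eq_rect _ F (q (i - 1)) _ (int_succ_pred i).
Lemma fam_predE j : fam_pred (j + 1) = q j.
Proof.
rewrite /fam_pred; move: (int_succ_pred _).
have e : j + 1 - 1 = j by lia.
move: (j + 1 - 1) e => i ->{i} E.
by rewrite (Prop_irrelevance E erefl).
Qed.
End ShiftFamily.

Lemma int_succ_ind (P : int -> Prop) : (forall j, P (j + 1)) -> forall i, P i.
Proof. by move=> PS i; rewrite -(int_succ_pred i). Qed.

(** A bounded complex of finite-dimensional vector spaces with chosen bases; the
    matrices act on row vectors. *)
Record scalar_complex (k : fieldType) := ScalarComplex {
  sc_rank : int -> nat;
  sc_mx : forall i, 'M[k]_(sc_rank i, sc_rank (i + 1));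
  sc_mxM : forall i, sc_mx i *m sc_mx (i + 1) = 0;
  sc_bounded : exists N : nat, forall i : int, (N < `|i|)%N -> sc_rank i = 0%N
}.

Section StalkRetract.
Variables (R : comNzRingType) (M : lmodType R) (fgM : fingen M) (Y : bcomplex R).
Hypothesis dY : forall i (x : Y i), cd Y i x = 0.
Variables (f : {linear M -> Y (Posz 0)}) (g : {linear Y (Posz 0) -> M}).
Hypothesis fK : forall x, g (f x) = x.
Definition stalk_to (i : int) : {linear stalk_ob M i -> Y i} :=
  match i return {linear stalk_ob M i -> Y i} with Posz 0 => f | _ => \0 end.
Definition stalk_from (i : int) : {linear Y i -> stalk_ob M i} :=
  match i return {linear Y i -> stalk_ob M i} with Posz 0 => g | _ => \0 end.
Lemma stalk_to_cd i x : stalk_to (i + 1) (stalk_d M i x) = cd Y i (stalk_to i x).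
Proof. by rewrite dY linear0. Qed.
Lemma stalk_from_cd i x : stalk_from (i + 1) (cd Y i x) = stalk_d M i (stalk_from i x).
Proof. by rewrite dY linear0. Qed.
(** A retraction of the term in degree 0 onto [M] is compatible with the differentials
    because they vanish. *)
Lemma dretract_stalk : dretract (stalk fgM) Y.
Proof.
apply: (dretract_id (i := @CMap R (stalk fgM) Y stalk_to stalk_to_cd)
  (r := @CMap R Y (stalk fgM) stalk_from stalk_from_cd)).
by case=> [[|n]|n] x; rewrite /= ?fK //; apply/matrixP => ? [].
Qed.
End StalkRetract.

Section ThickModule.
Variables (R : comNzRingType) (P : bcomplex R -> Prop) (cP : thick_closed P).
(** The proof that [M] is finitely generated is part of a stalk; quantifying over it
    makes the property depend on [M] only. *)
Definition stalks_in (M : lmodType R) : Prop := forall fgM, P (@stalk R M fgM).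

Lemma stalks_in_retract (M N : lmodType R) (f : {linear M -> N}) (g : {linear N -> M}) :
  (forall x, g (f x) = x) -> fingen N -> stalks_in N -> stalks_in M.
Proof.
move=> fK fgN sN fgM; apply: (tc_retract cP) (sN fgN).
by apply: (@dretract_stalk _ _ _ (stalk fgN) _ f g).
Qed.

Lemma stalks_in_prod (M N : lmodType R) :
  fingen M -> fingen N -> stalks_in M -> stalks_in N -> stalks_in (M * N)%type.
Proof.
move=> fgM fgN sM sN fg.
apply: (tc_retract cP) (tc_sum cP (sM fgM) (sN fgN)).
by apply: (@dretract_stalk _ _ _ (csum (stalk fgM) (stalk fgN)) _ idfun idfun).
Qed.

Lemma stalks_in_trivial (M : lmodType R) : (forall x : M, x = 0) -> stalks_in M.
Proof.
move=> M0 fg; apply: (tc_retract cP) (tc_zero cP).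
by apply: (@dretract_stalk _ _ _ (czero R) _ \0 \0) => // x; apply/esym/M0.
Qed.

Lemma stalks_in_power (T : lmodType R) r :
  fingen T -> stalks_in T -> stalks_in {ffun 'I_r -> T}.
Proof.
move=> fgT sT; elim: r => [|r IH].
  by apply: stalks_in_trivial => x; apply/ffunP => -[].
pose f (x : {ffun 'I_r.+1 -> T}) : (T * {ffun 'I_r -> T})%type :=
  (x ord0, [ffun i => x (lift ord0 i)]).
pose g (x : (T * {ffun 'I_r -> T})%type) : {ffun 'I_r.+1 -> T} :=
  [ffun i => if unlift ord0 i is Some j then x.2 j else x.1].
have fL : linear f.
  move=> a x y; congr pair; first by rewrite !ffunE.
  by apply/ffunP => i; rewrite !ffunE.
have gL : linear g.
  move=> a x y; apply/ffunP => i; rewrite !ffunE /=.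
  by case: unliftP => [j|] _; rewrite ?ffunE.
pose F := GRing.isLinear.Build R _ _ _ f fL.
pose G := GRing.isLinear.Build R _ _ _ g gL.
pose f' : {linear {ffun 'I_r.+1 -> T} -> (T * {ffun 'I_r -> T})%type} :=
  HB.pack f F.
pose g' : {linear (T * {ffun 'I_r -> T})%type -> {ffun 'I_r.+1 -> T}} :=
  HB.pack g G.
apply: (@stalks_in_retract _ _ f' g') => [x||].
- apply/ffunP => i; rewrite !ffunE /=.
  by case: unliftP => [j|] ->; rewrite ?ffunE.
- by apply: fingen_prod => //; apply: fingen_power.
- by apply: stalks_in_prod => //; apply: fingen_power.
Qed.
End ThickModule.

Section Cell.
Variables (k : fieldType) (R : comNzRingType) (iota : {rmorphism k -> R}).
Variable (W : scalar_complex k).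
Section Ob.
Variables (T : lmodType R) (fgT : fingen T).
Definition cell_ob (i : int) : lmodType R := {ffun 'I_(sc_rank W i) -> T}.
Definition cell_d i : {linear cell_ob i -> cell_ob (i + 1)} := mact iota (sc_mx W i).
Lemma cell_dd i (x : cell_ob i) : cell_d (i + 1) (cell_d i x) = 0.
Proof. by rewrite -[LHS]mactM sc_mxM mact0. Qed.
Lemma cell_fingen i : fingen (cell_ob i).
Proof. exact: fingen_power. Qed.
Lemma cell_bounded : exists N : nat,
  forall i : int, (N < `|i|)%N -> forall x : cell_ob i, x = 0.
Proof.
have [N NP] := sc_bounded W; exists N => i iN x; apply/ffunP => a.
by case: a => a alt; exfalso; move: alt; rewrite NP.
Qed.
(** The complex [T (x)_k W]. *)
Definition cell : bcomplex R := BComplex cell_dd cell_fingen cell_bounded.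

(** Over a field [W] splits: choose [h] with [D h D = D] in each degree. Then
    [p = 1 - h D - D h] is killed by the differential on both sides, hence it is a
    chain map to and from the complex [Z] with the same terms and zero
    differential, and [p p] is the identity up to boundaries on cycles. So the cell
    is a retract of [Z]. *)
Lemma thick_closed_cell (P : bcomplex R -> Prop) :
  thick_closed P -> stalks_in P T -> P cell.
Proof.
move=> cP sT.
pose Z := zcomplex cell_fingen cell_bounded.
have PZ : P Z.
  by apply: zdiff_closed => // i; apply: stalks_in_power.
apply: (tc_retract cP) PZ.
have [h hP] : exists h : forall i, 'M[k]_(sc_rank W (i + 1), sc_rank W i),
    forall i, sc_mx W i *m h i *m sc_mx W i = sc_mx W i.
  by exists (fun i => pinvmx (sc_mx W i)) => i; apply: mulmxKpV.
(* [e] is [h D] arriving in degree [i], where [h] starts from degree [i]; it is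
   given in degrees [j + 1] only. *)
pose e := fam_pred (F := fun i => 'M[k]_(sc_rank W i)) (fun j => h j *m sc_mx W j).
have eE j : e (j + 1) = h j *m sc_mx W j by apply: fam_predE.
pose p i : 'M[k]_(sc_rank W i) := 1%:M - e i - sc_mx W i *m h i.
have pD i : p i *m sc_mx W i = 0.
  rewrite /p !mulmxBl mul1mx hP addrAC subrr sub0r.
  apply/eqP; rewrite oppr_eq0; apply/eqP; elim/int_succ_ind: i => j.
  by rewrite eE -mulmxA sc_mxM mulmx0.
have Dp i : sc_mx W i *m p (i + 1) = 0.
  rewrite /p !mulmxBr mulmx1 eE !mulmxA. rewrite hP subrr sub0r sc_mxM mul0mx oppr0 //.
pose pm i : {linear cell_ob i -> cell_ob i} := mact iota (p i).
have pd1 i (x : cell i) : pm (i + 1) (cd cell i x) = cd Z i (pm i x).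
  by rewrite -[LHS]mactM Dp mact0.
have pd2 i (x : Z i) : pm (i + 1) (cd Z i x) = cd cell i (pm i x).
  by rewrite linear0 -[RHS]mactM pD mact0.
apply: (dretract_quasi_iso (i := @CMap R cell Z pm pd1) (r := @CMap R Z cell pm pd2)).
(* On cycles [p] differs from the identity by a boundary. *)
have ph i (x : cell (i + 1)) : cd cell (i + 1) x = 0 ->
    x = pm (i + 1) x + cd cell i (mact iota (h i) x).
  move=> dx; rewrite -[cd cell i _]mactM -eE.
  rewrite -[pm _ _]/(mact iota (p (i + 1)) x) /p !mactB mact1.
  by rewrite mactM [mact iota (sc_mx W _) x]dx linear0 subr0 subrK.
have pc i (x : cell (i + 1)) : cd cell (i + 1) (pm (i + 1) x) = 0.
  by rewrite -[LHS]mactM pD mact0.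
move=> i; split=> [x dx [y yE]|y dy].
  have {}yE : pm (i + 1) (pm (i + 1) x) = cd cell i y := yE.
  exists (y + mact iota (h i) (pm (i + 1) x) + mact iota (h i) x).
  by rewrite !linearD -yE -ph // -ph.
exists y; split=> //.
exists (mact iota (h i) (pm (i + 1) y) + mact iota (h i) y).
by rewrite linearD addrA -ph // -ph.
Qed.

End Ob.
End Cell.

(** * A length two resolution by cells bounds the thickness level *)

Record mses (R : comNzRingType) (A B C : lmodType R)
    (f : {linear A -> B}) (g : {linear B -> C}) : Prop := MSes {
  mses_inj : forall x, f x = 0 -> x = 0;
  mses_ex : forall x, g x = 0 -> exists y, x = f y;
  mses_zero : forall x, g (f x) = 0;
  mses_surj : forall x, exists y, x = g y
}.

Section FfunMap.
Variables (R : comNzRingType) (T T' : lmodType R) (f : {linear T -> T'}) (r : nat).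
Definition ffun_map (x : {ffun 'I_r -> T}) : {ffun 'I_r -> T'} := [ffun i => f (x i)].
Lemma ffun_map_linear : linear ffun_map.
Proof. by move=> a x y; apply/ffunP => i; rewrite !ffunE linearP. Qed.
HB.instance Definition _ :=
  GRing.isLinear.Build R {ffun 'I_r -> T} {ffun 'I_r -> T'} _ ffun_map ffun_map_linear.
End FfunMap.

Lemma mses_power (R : comNzRingType) (A B C : lmodType R)
    (f : {linear A -> B}) (g : {linear B -> C}) r :
  mses f g -> mses (ffun_map f (r := r)) (ffun_map g (r := r)).
Proof.
move=> s; split=> x.
- move=> x0; apply/ffunP => i; have := congr1 (fun h : {ffun _ -> _} => h i) x0.
  by rewrite !ffunE => /(mses_inj s).
- move=> x0; have xi i : exists y, x i = f y.
    apply: (mses_ex s); have := congr1 (fun h : {ffun _ -> _} => h i) x0.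
    by rewrite !ffunE.
  have [y yP] := choice xi; exists (finfun y).
  by apply/ffunP => i; rewrite !ffunE.
- by apply/ffunP => i; rewrite !ffunE (mses_zero s).
- have [y yP] := choice (fun i => mses_surj s (x i)); exists (finfun y).
  by apply/ffunP => i; rewrite !ffunE.
Qed.

Section CellMap.
Variables (k : fieldType) (R : comNzRingType) (iota : {rmorphism k -> R}).
Variables (W : scalar_complex k) (T T' : lmodType R) (f : {linear T -> T'}).
Variables (fgT : fingen T) (fgT' : fingen T').
Lemma cell_map_cd i (x : cell iota W fgT i) :
  ffun_map f (cd (cell iota W fgT) i x) = cd (cell iota W fgT') i (ffun_map f x).
Proof.
apply/ffunP => b; rewrite !ffunE linear_sum; apply: eq_bigr => a _.
by rewrite linearZ ffunE.
Qed.
Definition cell_map : cmap (cell iota W fgT) (cell iota W fgT') :=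
  @CMap R (cell iota W fgT) (cell iota W fgT') (fun i => ffun_map f (r := sc_rank W i))
    cell_map_cd.
End CellMap.

(** The module version of [resolved]; tensoring with a complex of vector spaces
    turns it into [resolved]. *)
Definition mresolved (R : comNzRingType) (P : bcomplex R -> Prop) (T : lmodType R) : Prop :=
  exists (A B : lmodType R) (f : {linear A -> B}) (g : {linear B -> T}),
    [/\ mses f g, fingen A /\ fingen B, stalks_in P A & stalks_in P B].

(** The functor [- (x)_k W] is exact. *)
Lemma resolved_cell (k : fieldType) (R : comNzRingType) (iota : {rmorphism k -> R})
    (W : scalar_complex k) (T : lmodType R) (fgT : fingen T) (G : bcomplex R) :
  mresolved (thick1 G) T -> resolved G (cell iota W fgT).
Proof.
move=> [A [B [f [g [s [fgA fgB] sA sB]]]]].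
exists (cell iota W fgA), (cell iota W fgB), (cell_map _ _ f _ _), (cell_map _ _ g _ _).
have tc := thick1_closed G.
split; [|exact: thick_closed_cell..].
by split=> i; have [] := mses_power (sc_rank W i) s.
Qed.

Lemma mresolved_prod (R : comNzRingType) (P : bcomplex R -> Prop) (T T' : lmodType R) :
  thick_closed P -> mresolved P T -> mresolved P T' -> mresolved P (T * T')%type.
Proof.
move=> cP [A [B [f [g [s [fgA fgB] sA sB]]]]] [A' [B' [f' [g' [s' [fgA' fgB'] sA' sB']]]]].
pose pm (X Y X' Y' : lmodType R) (h : {linear X -> Y}) (h' : {linear X' -> Y'})
  (x : (X * X')%type) : (Y * Y')%type := (h x.1, h' x.2).
have pmL X Y X' Y' h h' : linear (@pm X Y X' Y' h h').
  by move=> a x y; rewrite /pm /= !linearP.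
pose F : {linear (A * A')%type -> (B * B')%type} :=
  HB.pack (pm _ _ _ _ f f') (GRing.isLinear.Build R _ _ _ _ (pmL _ _ _ _ f f')).
pose G : {linear (B * B')%type -> (T * T')%type} :=
  HB.pack (pm _ _ _ _ g g') (GRing.isLinear.Build R _ _ _ _ (pmL _ _ _ _ g g')).
exists (A * A')%type, (B * B')%type, F, G; split; last 2 first.
- exact: stalks_in_prod.
- exact: stalks_in_prod.
- split.
  + by case=> x y [/(mses_inj s) -> /(mses_inj s') ->].
  + case=> x y [/(mses_ex s) [z ->] /(mses_ex s') [z' ->]].
    by exists (z, z').
  + by case=> x y; congr pair; rewrite ?(mses_zero s) ?(mses_zero s').
  + case=> x y; have [z ->] := mses_surj s x; have [z' ->] := mses_surj s' y.
    by exists (z, z').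
- by split; apply: fingen_prod.
Qed.

Lemma mresolved_iso (R : comNzRingType) (P : bcomplex R -> Prop) (T T' : lmodType R)
    (h : {linear T -> T'}) :
  (forall x, h x = 0 -> x = 0) -> (forall y, exists x, y = h x) ->
  mresolved P T -> mresolved P T'.
Proof.
move=> hI hS [A [B [f [g [s fg sA sB]]]]].
exists A, B, f, (h \o g); split=> //; split=> [x|x|x|y] /=.
- exact: (mses_inj s).
- by move/hI/(mses_ex s).
- by rewrite (mses_zero s) linear0.
- by have [x ->] := hS y; have [z ->] := mses_surj s x; exists z.
Qed.

(** Peel the resolution from the left. Each of the three terms is [resolved], hence
    costs two levels by [thick_resolved_quot], starting from the zero complex, which
    is at level 1. *)
Lemma thick_length2 (k : fieldType) (R : comNzRingType) (iota : {rmorphism k -> R})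
    (T : lmodType R) (fgT : fingen T) (G : bcomplex R) (Y : bcomplex R)
    (U V V' W : scalar_complex k)
    (c2 : cmap (cell iota U fgT) (csum (cell iota V fgT) (cell iota V' fgT)))
    (c1 : cmap (csum (cell iota V fgT) (cell iota V' fgT)) (cell iota W fgT))
    (c0 : cmap (cell iota W fgT) Y) :
  mresolved (thick1 G) T ->
  (forall i x, c2 i x = 0 -> x = 0) ->
  (forall i x, c1 i (c2 i x) = 0) -> (forall i x, c1 i x = 0 -> exists y, x = c2 i y) ->
  (forall i x, c0 i (c1 i x) = 0) -> (forall i x, c0 i x = 0 -> exists y, x = c1 i y) ->
  (forall i y, exists x, y = c0 i x) ->
  thick 7%N G Y.
Proof.
move=> rT i2 z1 e1 z0 e0 s0.
have rC Z : resolved G (cell iota Z fgT) by apply: resolved_cell.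
have t3 : thick 3%N G (cell iota U fgT).
  pose f i : {linear czero R i -> cell iota U fgT i} := \0.
  have fd i (x : czero R i) : f (i + 1) (cd (czero R) i x) = cd (cell iota U fgT) i (f i x).
    exact: (esym (linear0 (cd (cell iota U fgT) i))).
  refine (@thick_resolved_quot R G (czero R) (cell iota U fgT) (cell iota U fgT)
    (@CMap R (czero R) (cell iota U fgT) f fd) (Defs.cid (cell iota U fgT)) 0%N _ _ _).
  - exact: rC.
  - split=> [i x _|i x x0|i x|i x] //; last by exists x.
      by case: i x => [[|n]|n] x; apply/matrixP => ? [].
    by exists 0; exact: x0.
  - by apply: tc_zero; apply: thick_closed_thick.
have fgK i : fingen (ker (c0 i)).
  apply: (@fingen_surj _ (csum (cell iota V fgT) (cell iota V' fgT) i) _ (to_ker (@z0 i))).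
    move=> y; have [x xE] := e0 _ _ (kerE y); exists x; apply: val_inj; exact: xE.
  exact: cob_fingen.
have t5 : thick 5%N G (ker_complex fgK).
  apply: (@thick_resolved_quot _ _ _ _ _ c2 (to_ker_complex fgK z0) 2%N) t3.
    by apply: resolved_csum.
  split=> // [i x /(congr1 val) /= /e1 //|i x|i y].
    by apply: val_inj; rewrite /= z1.
  have [x xE] := e0 _ _ (kerE y); exists x; apply: val_inj; exact: xE.
exact: (@thick_resolved_quot _ _ _ _ _ (ker_incl fgK) c0 4%N (rC W) (ker_complex_ses fgK s0) t5).
Qed.

(** * Spans, bases and linear functionals *)

Section Span.
Variables (k : comNzRingType) (V : lmodType k).
(** The recursion on the list of generators makes the proofs by induction on the
    number of generators direct, both for bases and for chain conditions. *)
Fixpoint span (s : seq V) (z : V) : Prop :=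
  if s is v :: s' then exists c : k, span s' (z - c *: v) else z = 0.

Lemma span0 s : span s 0.
Proof. by elim: s => //= v s IH; exists 0; rewrite scale0r subr0. Qed.
Lemma spanP s a x y : span s x -> span s y -> span s (a *: x + y).
Proof.
elim: s x y => /= [x y -> ->|v s IH x y [c xs] [d ys]].
  by rewrite scaler0 addr0.
exists (a * c + d); have := IH _ _ xs ys.
by rewrite scalerBr scalerA addrACA -opprD -scalerDl.
Qed.
Lemma spanD s x y : span s x -> span s y -> span s (x + y).
Proof. by move=> xs ys; rewrite -[x]scale1r; apply: spanP. Qed.
Lemma spanZ s a x : span s x -> span s (a *: x).
Proof. by move=> xs; rewrite -[_ *: _]addr0; apply: spanP => //; apply: span0. Qed.
Lemma spanN s x : span s x -> span s (- x).
Proof. by rewrite -scaleN1r; apply: spanZ. Qed.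
Lemma spanB s x y : span s x -> span s y -> span s (x - y).
Proof. by move=> xs ys; apply: spanD => //; apply: spanN. Qed.
Lemma span_sum (I : Type) (r : seq I) (Q : pred I) (F : I -> V) s :
  (forall i, Q i -> span s (F i)) -> span s (\sum_(i <- r | Q i) F i).
Proof. by move=> FP; elim/big_ind: _ => //; [exact: span0|exact: spanD]. Qed.
Lemma span_catP s t z : span (s ++ t) z <-> exists u v, [/\ span s u, span t v & z = u + v].
Proof.
elim: s z => [z|v s IH z] /=.
  split=> [tz|[u [v [-> tv ->]]]]; last by rewrite add0r.
  by exists 0, z; rewrite add0r.
split=> [[c /IH [u [w [su tw zE]]]]|[u [w [[c su] tw ->]]]].
  exists (u + c *: v), w; split=> //; first by exists c; rewrite addrK.
  by rewrite addrAC -zE subrK.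
by exists c; apply/IH; exists (u - c *: v), w; rewrite addrAC.
Qed.
Lemma span_catl s t z : span s z -> span (s ++ t) z.
Proof. by move=> sz; apply/span_catP; exists z, 0; rewrite addr0; split=> //; exact: span0. Qed.
Lemma span_catr s t z : span t z -> span (s ++ t) z.
Proof. by move=> sz; apply/span_catP; exists 0, z; rewrite add0r; split=> //; exact: span0. Qed.
Lemma mem_span s z : z \in s -> span s z.
Proof.
elim: s => //= v s IH; rewrite inE => /orP [/eqP ->|/IH sz].
  by exists 1; rewrite scale1r subrr; apply: span0.
by exists 0; rewrite scale0r subr0.
Qed.
Lemma span_sub s t z : (forall v, v \in s -> span t v) -> span s z -> span t z.
Proof.
elim: s z => [z _ ->|v s IH z st [c sz]]; first exact: span0.
rewrite -(subrK (c *: v) z); apply: spanD.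
  by apply: IH sz => w ws; apply: st; rewrite inE ws orbT.
by apply/spanZ/st; rewrite inE eqxx.
Qed.

Lemma span_tupleP s z :
  span s z <-> exists c : 'I_(size s) -> k, z = \sum_i c i *: s`_i.
Proof.
split=> [|[c ->]]; last first.
  by apply: span_sum => i _; apply/spanZ/mem_span/mem_nth.
elim: s z => [|v s IH] z /=.
  by move=> ->; exists (fun=> 0); rewrite big_ord0.
move=> [c /IH [d dE]]; exists (fun i => if unlift ord0 i is Some j then d j else c).
rewrite big_ord_recl /= unlift_none -[LHS](subrK (c *: v)) dE addrC; congr (_ + _).
by apply: eq_bigr => i _; rewrite liftK.
Qed.
End Span.

Lemma span_map (k : comNzRingType) (V V' : lmodType k) (f : {linear V -> V'}) s z :
  span (map f s) z <-> exists2 u, span s u & z = f u.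
Proof.
elim: s z => [|v s IH] z /=.
  by split=> [->|[u -> ->]]; [exists 0|]; rewrite ?linear0.
split=> [[c /IH [u su zE]]|[u [c su] ->]].
  exists (u + c *: v); first by exists c; rewrite addrK.
  by rewrite linearD linearZ -zE subrK.
by exists c; apply/IH; exists (u - c *: v) => //; rewrite [RHS]linearB [in RHS]linearZ_LR.
Qed.

Section Free.
Variables (k : fieldType) (V : lmodType k).
Fixpoint free (s : seq V) : Prop :=
  if s is v :: s' then ~ span s' v /\ free s' else True.

Lemma exists_basis (s : seq V) :
  exists t, free t /\ (forall z, span t z <-> span s z).
Proof.
elim: s => [|v s [t [ft tE]]]; first by exists [::].
case: (pselect (span t v)) => [tv|tv].
  exists t; split=> // z; rewrite tE /=; split=> [sz|[c sz]].
    by exists 0; rewrite scale0r subr0.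
  rewrite -(subrK (c *: v) z); apply: spanD => //.
  by apply/spanZ/tE.
exists (v :: t); split=> //= z.
by split=> -[c sz]; exists c; apply/tE.
Qed.

Lemma free_inj s (c : 'I_(size s) -> k) :
  free s -> \sum_i c i *: s`_i = 0 -> forall i, c i = 0.
Proof.
elim: s c => [c _ _ []//|v s IH c [nv fs]] /=.
rewrite big_ord_recl /= => E.
have c0 : c ord0 = 0.
  apply: contra_notP nv => /eqP c0.
  have -> : v = - (c ord0)^-1 *: \sum_(i < size s) c (lift ord0 i) *: s`_i.
    apply: (scalerI c0); rewrite scalerA mulrN divff // scaleN1r.
    by apply/eqP; rewrite -addr_eq0 E.
  by apply/spanZ/span_tupleP; exists (fun i => c (lift ord0 i)).
move=> i; case: (unliftP ord0 i) => [j ->|->] //.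
apply: (IH (fun j => c (lift ord0 j))) => //.
by move: E; rewrite c0 scale0r add0r.
Qed.

Lemma free_eq s (c d : 'I_(size s) -> k) :
  free s -> \sum_i c i *: s`_i = \sum_i d i *: s`_i -> c =1 d.
Proof.
move=> fs E i; apply/eqP; rewrite -subr_eq0; apply/eqP.
apply: (free_inj (c := fun i => c i - d i) fs).
under eq_bigr => j _ do rewrite scalerBl.
by rewrite sumrB E subrr.
Qed.

Lemma free_trivial s : free s -> (forall v : V, v = 0) -> size s = 0%N.
Proof.
case: s => // v s [nv _] V0; case: nv; rewrite (V0 v); exact: span0.
Qed.

(** A coordinate function on which [v] does not vanish, rescaled. *)
Lemma exists_functional (v : V) :
  fingen V -> v <> 0 -> exists f : {linear V -> k^o}, f v = 1.
Proof.
move=> [n [e eP]] v0.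
have [t [ft tE]] := exists_basis (codom e).
have sT z : exists c : 'I_(size t) -> k, z = \sum_i c i *: t`_i.
  apply/span_tupleP/tE; have [c ->] := eP z.
  by apply: span_sum => i _; apply/spanZ/mem_span/codom_f.
have [crd crdE] := choice sT.
have [i ci0] : exists i, crd v i != 0.
  apply: contrapT => nc; apply: v0; rewrite (crdE v) big1 // => i _.
  case: (eqVneq (crd v i) 0) => [->|ci]; first by rewrite scale0r.
  by case: nc; exists i.
pose f z : k^o := (crd v i)^-1 * crd z i.
have fL : linear f.
  move=> a x y; rewrite /f; have -> : crd (a *: x + y) i = a * crd x i + crd y i.
    apply: (free_eq (c := crd _) (d := fun i => a * crd x i + crd y i) ft).
    rewrite -crdE [in LHS](crdE x) [in LHS](crdE y) scaler_sumr -big_split.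
    by apply: eq_bigr => j _; rewrite scalerDl scalerA.
  by rewrite mulrDr; congr (_ + _); rewrite mulrCA.
pose f' : {linear V -> k^o} := HB.pack f (GRing.isLinear.Build k V k^o _ f fL).
by exists f'; rewrite /= /f mulVf.
Qed.
End Free.

(** * The Veronese ring and the modules of fixed degree modulo l *)

(** Restriction of scalars along [phi]; the name of the type carries [phi], so that
    one additive group can be a module over several rings. *)
Definition restr (R S : comNzRingType) (phi : {rmorphism R -> S}) (N : lmodType S) : Type := N.

Section ResScalars.
Variables (R S : comNzRingType) (phi : {rmorphism R -> S}) (N : lmodType S).
HB.instance Definition _ := GRing.Zmodule.on (restr phi N).
Definition restr_scale (a : R) (x : restr phi N) : restr phi N := phi a *: (x : N).
Lemma restr_scaleA a b x : restr_scale a (restr_scale b x) = restr_scale (a * b) x.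
Proof. by rewrite /restr_scale rmorphM scalerA. Qed.
Lemma restr_scale1 : left_id 1 restr_scale.
Proof. by move=> x; rewrite /restr_scale rmorph1 scale1r. Qed.
Lemma restr_scaleDr : right_distributive restr_scale +%R.
Proof. by move=> a x y; rewrite /restr_scale scalerDr. Qed.
Lemma restr_scaleDl x : {morph restr_scale^~ x : a b / a + b}.
Proof. by move=> a b; rewrite /restr_scale rmorphD scalerDl. Qed.
HB.instance Definition _ :=
  GRing.Zmodule_isLmodule.Build R (restr phi N)
    restr_scaleA restr_scale1 restr_scaleDr restr_scaleDl.
Lemma restrE (a : R) (x : restr phi N) : a *: x = phi a *: (x : N) :> N.
Proof. by []. Qed.
End ResScalars.

(** The bound [d] plays the part of finite support. *)
Definition mpoly_of_coef (k : fieldType) (d : nat) (c : 'X_{1..2} -> k) : {mpoly k[2]} :=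
  \sum_(m : 'X_{1..2 < d}) c m *: 'X_[m].

Lemma mcoeff_of_coef (k : fieldType) d (c : 'X_{1..2} -> k) m :
  (forall m, (d <= mdeg m)%N -> c m = 0) -> (mpoly_of_coef d c)@_m = c m.
Proof.
move=> c0; case: (ltnP (mdeg m) d) => md; first exact: mcoeff_mpoly.
rewrite c0 // /mpoly_of_coef raddf_sum big1 // => -[i /= idl] _.
rewrite mcoeffZ mcoeffX; case: eqP => [im|_]; last by rewrite mulr0.
by move: md; rewrite -im leqNgt idl.
Qed.

Lemma mcoeff_ge (k : fieldType) (f : {mpoly k[2]}) m : (msize f <= mdeg m)%N -> f@_m = 0.
Proof. by move/msize_mdeg_ge/memN_msupp_eq0. Qed.

Lemma mcoeffMXE (k : fieldType) (f : {mpoly k[2]}) m n :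
  (f * 'X_[m])@_n = if (m <= n)%MM then f@_(n - m) else 0.
Proof.
case: ifP => mn; first by rewrite -{1}(submK mn) addmC mcoeffMX.
apply/memN_msupp_eq0; rewrite (perm_mem (msuppMX _ _)).
by apply/mapP => -[m' _ E]; move: mn; rewrite E lem_addr.
Qed.

Section Veronese.
Variables (k : fieldType) (l : nat).
Local Notation S := {mpoly k[2]}.
Local Notation R := (veronese k l).

Lemma vero_emb_zmod : zmod_morphism (@veronese_val k l).
Proof. exact: (@rmorphB R S val). Qed.
Lemma vero_emb_monoid : monoid_morphism (@veronese_val k l).
Proof. by split; [exact: (@rmorph1 R S val)|exact: (@rmorphM R S val)]. Qed.
HB.instance Definition _ := GRing.isZmodMorphism.Build R S (@veronese_val k l) vero_emb_zmod.
HB.instance Definition _ := GRing.isMonoidMorphism.Build R S (@veronese_val k l) vero_emb_monoid.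
Definition vero_emb : {rmorphism R -> S} := @veronese_val k l.
(** The polynomial ring k[x,y] as a module over its Veronese subring. *)
Definition polymod : lmodType R := restr vero_emb S^o.

Lemma veroneseP (a : R) m : (vero_emb a)@_m != 0 -> (l %| mdeg m)%N.
Proof.
rewrite -mcoeff_msupp => mf; exact: (allP (valP a) m mf).
Qed.

Definition deg_mod (C : pred nat) : {pred polymod} :=
  [pred f : polymod | all (fun m : 'X_{1..2} => C (mdeg m %% l)%N) (msupp (f : S))].

Lemma deg_modP (C : pred nat) (f : S) :
  reflect (forall m, f@_m != 0 -> C (mdeg m %% l)%N) ((f : polymod) \in deg_mod C).
Proof.
apply: (iffP allP) => H m; first by rewrite -mcoeff_msupp; apply: H.
by rewrite mcoeff_msupp; apply: H.
Qed.

(** The part of [f] in the degrees whose residue modulo [l] is in [C]. It is linear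
    over the Veronese ring because the elements of that ring have degrees divisible
    by [l]. *)
Definition deg_proj (C : pred nat) (f : S) : S :=
  mpoly_of_coef (msize f) (fun m => if C (mdeg m %% l)%N then f@_m else 0).
Lemma deg_projE C f m : (deg_proj C f)@_m = if C (mdeg m %% l)%N then f@_m else 0.
Proof. by apply: mcoeff_of_coef => n /mcoeff_ge ->; case: ifP. Qed.
Lemma deg_proj_mod C f : (deg_proj C f : polymod) \in deg_mod C.
Proof. by apply/deg_modP => m; rewrite deg_projE; case: ifP => //; rewrite eqxx. Qed.
Lemma deg_proj_id C f : (f : polymod) \in deg_mod C -> deg_proj C f = f.
Proof.
move/deg_modP => fC; apply/mpolyP => m; rewrite deg_projE; case: ifP => // nC.
by case: (eqVneq f@_m 0) => // /fC; rewrite nC.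
Qed.
Lemma deg_projM C (a : R) f : deg_proj C (vero_emb a * f) = vero_emb a * deg_proj C f.
Proof.
apply/mpolyP => m; rewrite deg_projE !mcoeffM.
have -> (Q : bool) (x : k) : (if Q then x else 0) = Q%:R * x.
  by case: Q; rewrite ?mul1r ?mul0r.
rewrite mulr_sumr; apply: eq_bigr => -[b1 b2] /= /eqP.
move: (bmnm b1) (bmnm b2) => m1 m2 ->.
case: (eqVneq (vero_emb a)@_m1 0) => [->|/veroneseP am1].
  by rewrite !mul0r mulr0.
rewrite deg_projE mdegD -modnDml (eqP am1) add0n.
by case: ifP; rewrite ?mul1r ?mul0r ?mulr0.
Qed.
Lemma deg_projD C f g : deg_proj C (f + g) = deg_proj C f + deg_proj C g.
Proof.
by apply/mpolyP => m; rewrite mcoeffD !deg_projE mcoeffD; case: ifP; rewrite ?addr0.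
Qed.

Section Mod.
Variable C : pred nat.
Lemma deg_mod_submod : submod_closed (deg_mod C).
Proof.
split=> [|a f g fC gC]; first by apply/deg_modP => m; rewrite mcoeff0 eqxx.
rewrite -(deg_proj_id fC) -(deg_proj_id gC).
have -> : a *: (deg_proj C f : polymod) + (deg_proj C g : polymod) = deg_proj C (vero_emb a * f + g).
  by rewrite deg_projD deg_projM.
exact: deg_proj_mod.
Qed.
HB.instance Definition _ := GRing.isSubmodClosed.Build R polymod (deg_mod C) deg_mod_submod.
(** For [C = pred1 j] this is the j-th summand [M_j] of k[x,y]; sets of residues are
    allowed in order to add the summands one at a time. *)
Record Mod := MkMod { mod_val :> polymod; _ : mod_val \in deg_mod C }.
HB.instance Definition _ := [isSub for mod_val].
HB.instance Definition _ := [Choice of Mod by <:].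
HB.instance Definition _ := [SubChoice_isSubLmodule of Mod by <:].
Lemma mod_val_linear : linear mod_val.
Proof. by move=> a x y; rewrite -[LHS]/(val _) linearP. Qed.
HB.instance Definition _ := GRing.isLinear.Build R Mod polymod _ mod_val mod_val_linear.
Definition toMod (f : polymod) : Mod := MkMod (deg_proj_mod C f).
Lemma toMod_linear : linear toMod.
Proof. by move=> a f g; apply: val_inj; rewrite /= deg_projD deg_projM. Qed.
HB.instance Definition _ := GRing.isLinear.Build R polymod Mod _ toMod toMod_linear.
Lemma toModK (f : Mod) : toMod f = f.
Proof. by apply: val_inj; apply: deg_proj_id; apply: valP. Qed.
End Mod.

End Veronese.

(** * Two of these modules are direct summands of the Frobenius push-forward *)

Section FrobRetract.
Variables (k : fieldType) (l p : nat) (chk : p \in [pchar k]).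
Local Notation S := {mpoly k[2]}.
Local Notation R := (veronese k l).
Local Notation G := (frob (veronese_pchar l chk)).

(** [k] is a finite-dimensional vector space over itself through the Frobenius, and
    [1] is a nonzero vector of it. *)
Lemma frob_functional : F_finite k p -> exists lam : k -> k,
  [/\ lam 1 = 1, forall x y, lam (x + y) = lam x + lam y &
      forall a x, lam (a ^+ p * x) = a * lam x].
Proof.
move=> [n [b bP]].
have fgk : fingen (frob chk).
  exists n, (b : 'I_n -> frob chk) => x; have [c ->] := bP x.
  by exists c.
have [f f1] := exists_functional fgk (v := (1 : k) : frob chk) (elimN eqP (oner_neq0 k)).
exists f; split=> // [x y|a x]; first exact: linearD.
exact: (linearZ_LR f a (x : frob chk)).
Qed.

Variable lam : k -> k.
Hypothesis lam1 : lam 1 = 1.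
Hypothesis lamD : forall x y, lam (x + y) = lam x + lam y.
Hypothesis lamZ : forall a x, lam (a ^+ p * x) = a * lam x.

Lemma p_gt0 : (0 < p)%N. Proof. by case/andP: chk => /prime_gt0. Qed.

Lemma lam0 : lam 0 = 0.
Proof. by have := lamZ 0 0; rewrite mulr0 mul0r. Qed.

Lemma mpoly_pchar : p \in [pchar S].
Proof. rewrite (pchar_lalg S). exact: chk. Qed.

Lemma frobD (f g : S) : (f + g) ^+ p = f ^+ p + g ^+ p.
Proof. exact: (pFrobenius_autD_comm mpoly_pchar (mulrC f g)). Qed.

Lemma frob_mpolyE (f : S) :
  f ^+ p = \sum_(m <- msupp f) (f@_m) ^+ p *: 'X_[m *+ p].
Proof.
rewrite {1}(mpolyE f) -(pFrobenius_autE mpoly_pchar) rmorph_sum.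
by apply: eq_bigr => m _ /=; rewrite pFrobenius_autE exprZn mpolyXn.
Qed.

Section Exponent.
Variable e : 'X_{1..2}.
Hypothesis e_lt : forall i, (e i < p)%N.

(** A Cartier operator: for a functional [lam] that is linear over k^p, it extracts the
    coefficients of the monomials with exponents congruent to [e] modulo [p] and
    takes p-th roots. *)
Definition cartier (g : S) : S := mpoly_of_coef (msize g) (fun n => lam g@_(n *+ p + e)).
Lemma cartierE g n : (cartier g)@_n = lam g@_(n *+ p + e).
Proof.
apply: (@mcoeff_of_coef _ _ (fun n => lam g@_(n *+ p + e))) => m gm.
rewrite mcoeff_ge ?lam0 //; apply: leq_trans gm _.
by rewrite mdegD mdegMn (leq_trans _ (leq_addr _ _)) // leq_pmulr // p_gt0.
Qed.
Lemma cartierD f g : cartier (f + g) = cartier f + cartier g.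
Proof. by apply/mpolyP => n; rewrite mcoeffD !cartierE mcoeffD lamD. Qed.
Lemma cartier0 : cartier 0 = 0.
Proof. by apply/mpolyP => n; rewrite cartierE !mcoeff0 lam0. Qed.
(** Both sides are additive in [f], so a monomial [f] suffices; then the formula
    compares coefficients, and [e < p] guarantees that [m p <= n p + e] only if
    [m <= n]. *)
Lemma cartierM f g : cartier (f ^+ p * g) = f * cartier g.
Proof.
elim/mpolyind: f => [|c m f _ _ IH].
  by rewrite expr0n gtn_eqF ?p_gt0 // !mul0r cartier0.
rewrite frobD !mulrDl cartierD IH; congr (_ + _).
rewrite exprZn mpolyXn -!scalerAl.
apply/mpolyP => n; rewrite cartierE !mcoeffZ lamZ; congr (_ * _).
rewrite !(mulrC 'X_[_]) !mcoeffMXE.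
have -> : (m *+ p <= n *+ p + e)%MM = (m <= n)%MM.
  apply/mnm_lepP/mnm_lepP => H i; move: (H i); rewrite !mnmDE !mulmnE; last first.
    by move=> mn; rewrite (leq_trans (leq_mul mn (leqnn p))) // leq_addr.
  by move=> H'; rewrite -ltnS -(ltn_pmul2r p_gt0); move: (e_lt i) H'; lia.
case: ifP => [/mnm_lepP mn|_]; last by rewrite lam0.
rewrite cartierE; congr (lam _@_ _); apply/mnmP => i.
rewrite !(mnmBE, mnmDE, mulmnE) mulnBl addnBAC //.
by rewrite leq_mul.
Qed.
Lemma cartierX : cartier 'X_[e] = 1.
Proof.
apply/mpolyP => n; rewrite cartierE mcoeffX mcoeff1.
have -> : (e == n *+ p + e)%MM = (n == 0%MM).
  apply/eqP/eqP => [/mnmP E|->]; last by apply/mnmP => i; rewrite mnmDE mulmnE mnm0E.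
  apply/mnmP => i; move: (E i); rewrite mnmDE mulmnE mnm0E => /eqP.
  by rewrite -{1}[e i]add0n eqn_add2r eq_sym muln_eq0 => /orP[/eqP //|]; rewrite gtn_eqF // p_gt0.
by case: eqP => _; rewrite ?lam1 ?lam0.
Qed.

Variables (c : nat).
Hypothesis ec : (l %| p * c + mdeg e)%N.

Lemma Mod_to_frob_mem (f : Mod k l (pred1 c)) :
  ((mod_val f : S) ^+ p * 'X_[e] : S) \in @veronese_pred k l.
Proof.
apply/veronese_span; exists [seq ((mod_val f : S)@_m ^+ p, (m *+ p + e)%MM) | m <- msupp (mod_val f : S)].
split; last first.
  rewrite big_map frob_mpolyE mulr_suml; apply: eq_bigr => m _ /=.
  by rewrite -scalerAl -mpolyXD.
apply/allP => cm /mapP [m ms ->] /=.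
have /eqP mc := (deg_modP _ _ _ (valP f)) m (etrans (esym (mcoeff_msupp _ _)) ms).
rewrite mdegD mdegMn (divn_eq (mdeg m) l) mc mulnDl -addnA dvdn_add //.
  by rewrite mulnAC dvdn_mull.
by rewrite mulnC.
Qed.
(** [f] goes to [f ^ p * x ^ e], whose degrees are divisible by [l] when
    [p * c + |e|] is. *)
Definition Mod_to_frob (f : Mod k l (pred1 c)) : G := Veronese (Mod_to_frob_mem f).
Lemma Mod_to_frob_linear : linear Mod_to_frob.
Proof.
move=> a f g; apply: val_inj; rewrite /= frobD mulrDl.
congr (_ + _); rewrite exprMn -mulrA; congr (_ * _).
exact: (esym (rmorphXn (vero_emb k l) p a)).
Qed.
Definition frob_to_Mod (g : G) : Mod k l (pred1 c) := toMod (pred1 c) (cartier (veronese_val g) : polymod k l).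
Lemma frob_to_Mod_linear : linear frob_to_Mod.
Proof.
move=> a f g; rewrite /frob_to_Mod -linearP; congr (toMod _ _).
rewrite -[RHS]/(vero_emb k l a * cartier (veronese_val f) + cartier (veronese_val g)).
rewrite -cartierM -cartierD; congr cartier.
by rewrite -(rmorphXn (vero_emb k l) p a).
Qed.
Lemma Mod_to_frobK f : frob_to_Mod (Mod_to_frob f) = f.
Proof. by rewrite /frob_to_Mod /= cartierM cartierX mulr1 toModK. Qed.
End Exponent.
End FrobRetract.

Section FrobStalks.
Variables (k : fieldType) (l p : nat) (chk : p \in [pchar k]).
Hypotheses (l_gt0 : (0 < l)%N) (kF : F_finite k p).
Local Notation R := (veronese k l).
Local Notation G := (frob (veronese_pchar l chk)).
Let fgG : fingen G := frob_veronese_fingen chk l_gt0 kF.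

(** For the residue 0 take the exponent 0, for the residue -1 take [x y^(p-1)]:
    the degree of [f ^ p x y ^ (p-1)] is then [p (deg f + 1)]. *)
Lemma frob_exponent c : c = 0%N \/ c = l.-1 ->
  exists e : 'X_{1..2}, (forall i, (e i < p)%N) /\ (l %| p * c + mdeg e)%N.
Proof.
have p1 : (1 < p)%N by case/andP: chk => /prime_gt1.
case=> ->.
  exists 0%MM; split=> [i|]; first by rewrite mnm0E ltnW.
  by rewrite muln0 mdeg0.
exists [multinom nth 0%N [:: 1%N; p.-1] i | i < 2]; split.
  by move=> i; rewrite mnmE; case: i => [[|[|i]] hi] //=; lia.
rewrite mdegE !big_ord_recl big_ord0 !mnmE /= addn0.
rewrite (_ : (_ + _)%N = (p * l)%N) ?dvdn_mull //.
by case: (l) l_gt0 => // l' _; rewrite mulnS /=; lia.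
Qed.

Lemma Mod_retract_frob c : c = 0%N \/ c = l.-1 ->
  exists (f : {linear Mod k l (pred1 c) -> G}) (g : {linear G -> Mod k l (pred1 c)}),
    forall x, g (f x) = x.
Proof.
move=> /frob_exponent [e [e_lt ec]].
have [lam [lam1 lamD lamZ]] := frob_functional chk kF.
pose f : {linear Mod k l (pred1 c) -> G} := HB.pack (Mod_to_frob chk ec)
  (GRing.isLinear.Build R (Mod k l (pred1 c)) G _ _ (Mod_to_frob_linear chk ec)).
pose g : {linear G -> Mod k l (pred1 c)} := HB.pack (frob_to_Mod (chk := chk) lam e c)
  (GRing.isLinear.Build R G (Mod k l (pred1 c)) _ _ (frob_to_Mod_linear (chk := chk) lamD lamZ e_lt c)).
by exists f, g; apply: Mod_to_frobK.
Qed.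

Lemma fingen_Mod c : c = 0%N \/ c = l.-1 -> fingen (Mod k l (pred1 c)).
Proof.
move=> /Mod_retract_frob [f [g fK]].
by apply: (fingen_surj (f := g)) fgG => x; exists (f x).
Qed.

Lemma stalks_in_Mod (P : bcomplex R -> Prop) c : thick_closed P -> P (stalk fgG) ->
  c = 0%N \/ c = l.-1 -> stalks_in P (Mod k l (pred1 c)).
Proof.
move=> cP PG /Mod_retract_frob [f [g fK]].
apply: (stalks_in_retract cP fK fgG) => fg.
by rewrite (Prop_irrelevance fg fgG).
Qed.
End FrobStalks.

(** * Resolving k[x,y] by the two summands *)

(** Multiplication by a variable, on the coefficient sequences of polynomials. *)
Definition delay (T : zmodType) (q : nat -> T) (j : nat) : T :=
  if j is j'.+1 then q j' else 0.

Section Syzygy.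
Variable k : fieldType.
Local Notation S := {mpoly k[2]}.
Definition varx : S := 'X_[U_(ord0)].
Definition vary : S := 'X_[U_(ord_max)].

Lemma vary_div (f : S) : (forall m : 'X_{1..2}, m ord_max = 0%N -> f@_m = 0) -> exists g, f = g * vary.
Proof.
move=> f0; exists (mpoly_of_coef (msize f) (fun m => f@_(m + U_(ord_max)))).
apply/mpolyP => n; rewrite mcoeffMXE; case: ifP => [le1|nle1].
  rewrite mcoeff_of_coef ?submK // => m fm; apply/mcoeff_ge/(leq_trans fm).
  by rewrite mdegD leq_addr.
apply: f0; apply/eqP; apply: contraFT nle1; rewrite -lt0n => n1.
apply/mnm_lepP => i; rewrite mnm1E; case: eqP => // <-; exact: n1.
Qed.

Lemma vary_divM j (c g : S) : c * varx ^+ j = g * vary -> exists u, c = u * vary.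
Proof.
move=> E; apply: vary_div => m m1.
rewrite -(mcoeffMX c (U_(ord0) *+ j)%MM m) -mpolyXn E mcoeffMXE.
case: ifP => // /mnm_lepP /(_ ord_max).
by rewrite mnmDE mulmnE !mnm1E m1 eqxx.
Qed.

Lemma vary_neq0 : vary != 0.
Proof. by rewrite -msupp_eq0 msuppX. Qed.

(** Modulo [y] only the term [b = 0] survives, so [c 0] is divisible by [y], say
    [c 0 = u y]; moving [u x] to the next coefficient and dividing by [y] gives a
    relation of length one less. *)
Lemma koszul_ex j (c : nat -> S) :
  \sum_(b < j.+1) c b * (varx ^+ (j - b) * vary ^+ b) = 0 ->
  exists u : nat -> S, forall b, (b <= j)%N ->
    c b = (if (b < j)%N then u b else 0) * vary - delay u b * varx.
Proof.
elim: j c => [|j IH] c.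
  rewrite big_ord_recl big_ord0 addr0 !expr0 !mulr1 => c0.
  by exists (fun=> 0) => -[|b] //= _; rewrite c0 !mul0r subr0.
rewrite big_ord_recl subn0 expr0 mulr1 => E.
have E1 : c 0%N * varx ^+ j.+1 =
    (- \sum_(b < j.+1) c b.+1 * (varx ^+ (j - b) * vary ^+ b)) * vary.
  apply/eqP; rewrite mulNr -addr_eq0 mulr_suml; apply/eqP; rewrite -[RHS]E.
  congr (_ + _); apply: eq_bigr => b _ /=.
  by rewrite /bump /= add1n subSS exprSr !mulrA.
have [u0 u0E] := vary_divM E1.
pose c' b := c b.+1 + (if b == 0%N then u0 * varx else 0).
have [|u' u'P] := IH c'.
  apply: (mulIf vary_neq0); rewrite mul0r.
  have -> : \sum_(b < j.+1) c' b * (varx ^+ (j - b) * vary ^+ b) =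
    \sum_(b < j.+1) c b.+1 * (varx ^+ (j - b) * vary ^+ b) + u0 * varx ^+ j.+1.
    rewrite [in RHS]big_ord_recl big_ord_recl /c' /= mulrDl -!addrA; congr (_ + _).
    rewrite addrC; congr (_ + _); first by apply: eq_bigr => b _; rewrite addr0.
    by rewrite subn0 expr0 mulr1 exprS mulrA.
  rewrite mulrDl -[X in X * vary + _]opprK mulNr -E1 u0E.
  by rewrite mulrAC addNr.
exists (fun b => if b is b'.+1 then u' b' else u0) => -[|b] bj /=.
  by rewrite mul0r subr0.
have := u'P b bj; rewrite /c' => /(canRL (addrK _)) ->; rewrite ltnS.
case: b bj => [|b] bj /=; last by rewrite subr0.
by rewrite mul0r subr0.
Qed.
End Syzygy.

Section ModSes.
Variables (k : fieldType) (l : nat).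
Hypothesis l_gt0 : (0 < l)%N.
Local Notation S := {mpoly k[2]}.
Local Notation R := (veronese k l).
Local Notation x0 := (varx k).
Local Notation y0 := (vary k).
Local Notation dm := (@deg_mod k l).

Lemma deg_modMX (f : S) c m d : (f : polymod k l) \in dm (pred1 c) ->
  ((c + mdeg m) %% l)%N = d -> ((f * 'X_[m]) : polymod k l) \in dm (pred1 d).
Proof.
move=> /deg_modP fc <-; apply/deg_modP => n; rewrite mcoeffMXE.
case: ifP => [mn /fc /eqP <-|_]; last by rewrite eqxx.
by apply/eqP; rewrite modnDml -mdegD submK.
Qed.

Lemma deg_modMXV (f : S) m : mdeg m = 1%N -> ((f * 'X_[m]) : polymod k l) \in dm (pred1 0%N) ->
  (f : polymod k l) \in dm (pred1 l.-1).
Proof.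
move=> m1 /deg_modP fm; apply/deg_modP => n; rewrite -(mcoeffMX f m) => /fm /=.
rewrite mdegD m1 -modnDmr add1n; have := ltn_pmod (mdeg n) l_gt0.
rewrite leq_eqVlt => /orP [/eqP E _|H]; last by rewrite modn_small.
by apply/eqP; rewrite -[in RHS]E.
Qed.

Lemma mod_eq (c : pred nat) (f g : Mod k l c) : mod_val f = mod_val g -> f = g.
Proof. exact: val_inj. Qed.

Lemma modl1 : ((l.-1 + 1) %% l)%N = 0%N.
Proof. by rewrite addn1 prednK // modnn. Qed.

Section J.
Variable j : nat.
Hypothesis jl : (j < l)%N.
Local Notation A := {ffun 'I_j -> Mod k l (pred1 l.-1)}.
Local Notation B := {ffun 'I_j.+1 -> Mod k l (pred1 0%N)}.
Local Notation C := (Mod k l (pred1 j)).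

(** Extension by zero, which removes the boundary cases from the Koszul formula. *)
Definition extend0 (u : A) (b : nat) : S :=
  if insub b is Some i then mod_val (u i) : S else 0.
Lemma extend0E (u : A) (i : 'I_j) : extend0 u i = mod_val (u i).
Proof. by rewrite /extend0 valK. Qed.
Lemma extend0_ge (u : A) b : (j <= b)%N -> extend0 u b = 0.
Proof. by move=> jb; rewrite /extend0 insubF // ltnNge jb. Qed.
Lemma extend0_mod (u : A) b : (extend0 u b : polymod k l) \in dm (pred1 l.-1).
Proof. rewrite /extend0; case: insub => [i|]; [exact: valP|exact: rpred0]. Qed.
Lemma delay_mod (u : A) b : (delay (extend0 u) b : polymod k l) \in dm (pred1 l.-1).
Proof. by case: b => [|b]; [exact: rpred0|exact: extend0_mod]. Qed.
Lemma extend0L a (u v : A) b : extend0 (a *: u + v) b = vero_emb k l a * extend0 u b + extend0 v b.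
Proof.
by rewrite /extend0; case: insub => [i|]; rewrite ?mulr0 ?addr0 // !ffunE.
Qed.
Lemma delayL a (u v : A) b :
  delay (extend0 (a *: u + v)) b = vero_emb k l a * delay (extend0 u) b + delay (extend0 v) b.
Proof. by case: b => [|b] /=; rewrite ?extend0L // mulr0 addr0. Qed.

(** The relations between the monomials of degree [j] are generated by
    [y * (x^(j-b) y^b) = x * (x^(j-b-1) y^(b+1))]. *)
Definition koszul_coord (u : A) (b : nat) : S := extend0 u b * y0 - delay (extend0 u) b * x0.
Lemma koszul_coord_mod u b : (koszul_coord u b : polymod k l) \in dm (pred1 0%N).
Proof.
rewrite /koszul_coord; apply: rpredB.
  by apply: deg_modMX (extend0_mod u b) _; rewrite mdeg1 modl1.
by apply: deg_modMX (delay_mod u b) _; rewrite mdeg1 modl1.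
Qed.
Definition koszul_map (u : A) : B := [ffun b : 'I_j.+1 => toMod (pred1 0%N) (koszul_coord u b : polymod k l)].
Lemma koszul_map_linear : linear koszul_map.
Proof.
move=> a u v; apply/ffunP => b; rewrite !ffunE -linearP; congr (toMod _ _).
rewrite /koszul_coord extend0L delayL -[RHS]/(vero_emb k l a * (_ - _) + (_ - _)).
by rewrite !mulrDl opprD addrACA mulrBr !mulrA.
Qed.
HB.instance Definition _ := GRing.isLinear.Build R A B _ koszul_map koszul_map_linear.
Lemma koszul_mapE u (b : 'I_j.+1) : mod_val (koszul_map u b) = koszul_coord u b.
Proof. by rewrite ffunE /=; apply/deg_proj_id/koszul_coord_mod. Qed.

Definition monomial_sum (c : B) : S :=
  \sum_(b < j.+1) (mod_val (c b) : S) * (x0 ^+ (j - b) * y0 ^+ b).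
Lemma monomial_sum_mod c : (monomial_sum c : polymod k l) \in dm (pred1 j).
Proof.
apply: rpred_sum => b _; rewrite /varx /vary !mpolyXn -mpolyXD.
apply: deg_modMX (valP (c b)) _.
by rewrite add0n mdegD !mdegMn !mdeg1 !mul1n subnK ?modn_small // -ltnS.
Qed.
Definition monomial_map (c : B) : C := toMod (pred1 j) (monomial_sum c : polymod k l).
Lemma monomial_map_linear : linear monomial_map.
Proof.
move=> a u v; rewrite /monomial_map -linearP; congr (toMod _ _).
rewrite -[RHS]/(vero_emb k l a * monomial_sum u + monomial_sum v) /monomial_sum mulr_sumr -big_split.
apply: eq_bigr => b _; rewrite !ffunE.
rewrite -[mod_val (_ + _)]/(vero_emb k l a * (mod_val (u b) : S) + mod_val (v b)) mulrDl.
by congr (_ + _); rewrite -mulrA.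
Qed.
HB.instance Definition _ := GRing.isLinear.Build R B C _ monomial_map monomial_map_linear.
Lemma monomial_mapE c : mod_val (monomial_map c) = monomial_sum c.
Proof. exact/deg_proj_id/monomial_sum_mod. Qed.

(** The sequence [M_(l-1)^j -> M_0^(j+1) -> M_j]: the monomials of degree [j] generate
    [M_j] because [j < l], and their syzygies are given by [koszul_ex]. *)
Lemma mses_Mod : mses koszul_map monomial_map.
Proof.
split.
- move=> u u0.
  have kos0 b : (b < j.+1)%N -> koszul_coord u b = 0.
    by move=> bj; rewrite -(koszul_mapE u (Ordinal bj)) u0 ffunE.
  have extend00 b : extend0 u b = 0.
    elim: b => [|b IH].
      case: (ltnP 0 j) => [j0|]; last exact: extend0_ge.
      have := kos0 0%N isT; rewrite /koszul_coord mul0r subr0.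
      by move=> /eqP; rewrite mulf_eq0 (negPf (vary_neq0 k)) orbF => /eqP.
    case: (ltnP b.+1 j) => [bj|]; last exact: extend0_ge.
    have := kos0 b.+1 (ltnW bj); rewrite /koszul_coord /= IH mul0r subr0.
    by move=> /eqP; rewrite mulf_eq0 (negPf (vary_neq0 k)) orbF => /eqP.
  by apply/ffunP => i; apply: mod_eq; rewrite -extend0E extend00 ffunE.
- move=> c /(congr1 (@mod_val _ _ _)); rewrite monomial_mapE /monomial_sum.
  pose cn (b : nat) : S := if insub b is Some i then mod_val (c i) else 0.
  have cnE (i : 'I_j.+1) : cn i = mod_val (c i) by rewrite /cn valK.
  under eq_bigr => b _ do rewrite -cnE.
  move=> /koszul_ex [u uP].
  have cn_mod b : (cn b : polymod k l) \in dm (pred1 0%N).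
    by rewrite /cn; case: insub => [i|]; [exact: valP|exact: rpred0].
  (* The coefficients of the relation have degrees divisible by [l], so those of [u] have
   residue -1. *)
  have u_mod b : (b < j)%N -> (u b : polymod k l) \in dm (pred1 l.-1).
    have step b' : (b' < j)%N -> (delay u b' : polymod k l) \in dm (pred1 l.-1) ->
        (u b' : polymod k l) \in dm (pred1 l.-1).
      move=> bj pb; have := uP _ (ltnW bj); rewrite bj => /esym /(canRL (subrK _)) E.
      apply: (@deg_modMXV _ U_(ord_max)); first exact: mdeg1.
      rewrite -[X in X \in _]/(u b' * y0) E; apply: rpredD; first exact: cn_mod.
      by apply: (deg_modMX pb); rewrite mdeg1 modl1.
    elim: b => [|b IH] bj; apply: step => //; first exact: rpred0.
    exact: IH (ltnW bj).
  pose v : A := [ffun i : 'I_j => toMod (pred1 l.-1) (u i : polymod k l)].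
  have vE b : extend0 v b = if (b < j)%N then u b else 0.
    case: ltnP => bj; last exact: extend0_ge.
    by rewrite -[b]/(val (Ordinal bj)) extend0E ffunE /= deg_proj_id // u_mod.
  exists v; apply/ffunP => b; apply: mod_eq; rewrite koszul_mapE -cnE uP; last by rewrite -ltnS.
  rewrite /koszul_coord vE; congr (_ - _ * _).
  by case: b => -[|b] //= bj; rewrite vE -ltnS bj.
- move=> u; apply: mod_eq; rewrite monomial_mapE /monomial_sum.
  under eq_bigr => b _ do rewrite koszul_mapE.
  rewrite /koszul_coord; under eq_bigr => b _ do rewrite mulrBl.
  rewrite sumrB big_ord_recr [X in _ - X]big_ord_recl /=.
  rewrite extend0_ge // !mul0r addr0 add0r; apply/eqP; rewrite subr_eq0; apply/eqP.
  apply: eq_bigr => b _; rewrite /bump /= add1n -!mulrA; congr (_ * _).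
  by rewrite -(subnSK (ltn_ord b)) !exprS; ring.
- move=> f.
  suff [c cE] : exists c : B, mod_val f = monomial_sum c.
    by exists c; apply: mod_eq; rewrite monomial_mapE.
  have fm := deg_modP _ _ _ (valP f); rewrite (mpolyE (mod_val f : S)) big_seq.
  elim/big_ind: _ => [|_ _ [c1 ->] [c2 ->]|m].
  - exists 0; rewrite /monomial_sum big1 // => b _.
    by rewrite ffunE mul0r.
  - exists (c1 + c2); rewrite /monomial_sum -big_split; apply: eq_bigr => b _.
    rewrite !ffunE.
    by rewrite -[mod_val (_ + _)]/((mod_val (c1 b) : S) + mod_val (c2 b)) mulrDl.
  rewrite mcoeff_msupp => /fm /eqP mj.
  (* A monomial [m] of residue [j] is a multiple of [x^(j-b) y^b] for [b] the smaller of
   [j] and its exponent in [y]. *)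
  have jm : (j <= mdeg m)%N by rewrite -mj leq_mod.
  have bj : (minn j (m ord_max) < j.+1)%N by rewrite ltnS geq_minl.
  pose b0 := Ordinal bj.
  pose d : 'X_{1..2} := (U_(ord0) *+ (j - b0) + U_(ord_max) *+ b0)%MM.
  have dm' : (d <= m)%MM.
    apply/mnm_lepP => i; rewrite mnmDE !mulmnE !mnm1E.
    have e1 : lift ord0 ord0 = ord_max :> 'I_2 by apply: val_inj.
    move: jm; rewrite mdegE !big_ord_recl big_ord0 /b0 e1 /=.
    case: i => -[|[|i]] hi //=.
      rewrite (_ : Ordinal hi = ord0); [lia|exact: val_inj].
    rewrite (_ : Ordinal hi = ord_max); [lia|exact: val_inj].
  pose c : B := [ffun b => if b == b0 then
     toMod (pred1 0%N) ((mod_val f : S)@_m *: 'X_[m - d] : polymod k l) else 0].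
  exists c; rewrite /monomial_sum (bigD1 b0) //= big1 ?addr0 => [|b /negPf bb]; last first.
    by rewrite ffunE bb mul0r.
  rewrite ffunE eqxx /= deg_proj_id; last first.
    apply/deg_modP => n; rewrite mcoeffZ mcoeffX.
    case: ((m - d)%MM =P n) => [<- _|_]; last by rewrite mulr0 eqxx.
    have dj : mdeg d = j.
      by rewrite /d mdegD !mdegMn !mdeg1 !mul1n subnK // geq_minl.
    have : mdeg m = (mdeg (m - d)%MM + j)%N by rewrite -dj -mdegD submK.
    move=> E; have /eqP : (mdeg (m - d)%MM + j)%N = (0 + j)%N %[mod l].
      by rewrite -E mj add0n modn_small.
    by rewrite eqn_modDr mod0n.
  by rewrite /varx /vary !mpolyXn -mpolyXD -scalerAl -mpolyXD submK.
Qed.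
End J.

Variables (P : bcomplex R -> Prop).
Hypotheses (cP : thick_closed P).
Hypotheses (s0 : stalks_in P (Mod k l (pred1 0%N))) (fg0 : fingen (Mod k l (pred1 0%N))).
Hypotheses (s1 : stalks_in P (Mod k l (pred1 l.-1))) (fg1 : fingen (Mod k l (pred1 l.-1))).

Lemma mresolved_Mod j : (j < l)%N -> mresolved P (Mod k l (pred1 j)).
Proof.
move=> jl; exists _, _, (@koszul_map j), (@monomial_map j).
split; [exact: mses_Mod|by split; apply: fingen_power|exact: stalks_in_power..].
Qed.

Lemma mresolved_Mod_lt j : (j <= l)%N -> mresolved P (Mod k l (fun c => c < j)%N).
Proof.
elim: j => [_|j IH jl].
  have z (f : Mod k l (fun c => c < 0)%N) : f = 0.
    apply: mod_eq; apply/mpolyP => m; rewrite mcoeff0; apply/eqP.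
    by apply: contraT => /(deg_modP _ _ _ (valP f)).
  exists (Mod k l (fun c => c < 0)%N), (Mod k l (fun c => c < 0)%N), idfun, \0.
  split; [|by split; apply: fingen0|exact: stalks_in_trivial..].
  by split=> // x; [exists x|exists 0; rewrite (z x)].
pose h (z : (Mod k l (fun c => c < j)%N * Mod k l (pred1 j))%type) :
  Mod k l (fun c => c < j.+1)%N := toMod _ ((mod_val z.1 : polymod k l) + mod_val z.2).
have hL : linear h.
  by move=> a x y; rewrite /h -linearP /= scalerDr addrACA.
pose h' : {linear (Mod k l (fun c => c < j)%N * Mod k l (pred1 j))%type ->
    Mod k l (fun c => c < j.+1)%N} := HB.pack h (GRing.isLinear.Build R _ _ _ h hL).
have hE z : mod_val (h z) = mod_val z.1 + mod_val z.2.
  apply: deg_proj_id; apply: rpredD; apply/deg_modP => m.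
    by move/(deg_modP _ _ _ (valP z.1)) => /= H; rewrite ltnS ltnW.
  by move/(deg_modP _ _ _ (valP z.2)) => /= /eqP ->.
apply: (@mresolved_iso _ _ _ _ h') (mresolved_prod cP (IH (ltnW jl)) (mresolved_Mod jl)).
  move=> [f g] /(congr1 (@mod_val _ _ _)); rewrite hE /= => /mpolyP fg.
  have fE m : (mod_val f : S)@_m = - (mod_val g : S)@_m.
    by apply/eqP; rewrite -addr_eq0 -mcoeffD fg mcoeff0.
  have f0 m : (mod_val f : S)@_m = 0.
    apply/eqP; apply: contraT => fm.
    have /= := deg_modP _ _ _ (valP f) m fm.
    rewrite fE oppr_eq0 in fm.
    by have /= /eqP -> := deg_modP _ _ _ (valP g) m fm; rewrite ltnn.
  congr pair; apply: mod_eq; apply/mpolyP => m; rewrite mcoeff0 ?f0 //.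
  by apply/eqP; rewrite -oppr_eq0 -fE f0.
move=> f; exists (toMod _ (mod_val f), toMod _ (mod_val f)); apply: mod_eq.
rewrite hE /=; apply/mpolyP => m; rewrite mcoeffD !deg_projE /=.
case: ltngtP => H; rewrite ?addr0 ?add0r //.
apply/eqP; apply: contraT => /(deg_modP _ _ _ (valP f)) /=.
by rewrite ltnS leqNgt H.
Qed.

(** k[x,y] is the sum of the [M_j] for [j < l]. *)
Lemma mresolved_polymod : mresolved P (polymod k l).
Proof.
apply: (@mresolved_iso _ _ _ _ (@mod_val _ _ _)) (mresolved_Mod_lt (leqnn l)).
  by move=> x x0; apply: mod_eq.
move=> f; exists (toMod _ f) => /=; apply/esym/deg_proj_id/deg_modP => m _.
by rewrite ltn_pmod.
Qed.
End ModSes.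

(** * Ascending chains and division in one variable *)

Definition acc_ideals (A : comNzRingType) : Prop := forall I : nat -> A -> Prop,
  (forall j, I j 0) -> (forall j a x y, I j x -> I j y -> I j (a * x + y)) ->
  (forall j x, I j x -> I j.+1 x) ->
  exists n, forall j x, (n <= j)%N -> I j x -> I n x.

Lemma chain_le (T : Type) (I : nat -> T -> Prop) :
  (forall j x, I j x -> I j.+1 x) -> forall i j x, (i <= j)%N -> I i x -> I j x.
Proof.
move=> IS i j x /subnK <-; elim: (j - i)%N => //= d IH /IH; exact: IS.
Qed.

Lemma acc_ideals_field (k : fieldType) : acc_ideals k.
Proof.
move=> I I0 IL IS.
case: (pselect (exists j x, I j x /\ x != 0)) => [[n [x [Ix x0]]]|nI].
  exists n => j y _ _; rewrite -[y]addr0 -(mulfVK x0 y); exact: IL.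
exists 0%N => j x _ Ix; case: (eqVneq x 0) => [->|x0]; first exact: I0.
by case: nI; exists j, x.
Qed.

Lemma acc_ideals_poly (k : fieldType) : acc_ideals {poly k}.
Proof.
move=> I I0 IL IS.
case: (pselect (exists j x, I j x /\ x != 0)) => [ex|nI]; last first.
  exists 0%N => j x _ Ix; case: (eqVneq x 0) => [->|x0]; first exact: I0.
  by case: nI; exists j, x.
have [n [g [[Ig g0] gmin]]] : exists n g, (I n g /\ g != 0) /\
    forall j x, I j x -> x != 0 -> (size g <= size x)%N.
  pose Q d := `[< exists j x, [/\ I j x, x != 0 & size x = d] >].
  have exQ : exists d, Q d.
    by case: ex => j [x [Ix x0]]; exists (size x); apply/asboolP; exists j, x.
  case: (ex_minnP exQ) => d /asboolP [j [g [Ig g0 gd]]] dmin.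
  exists j, g; split=> // i x Ix x0; rewrite gd; apply: dmin.
  by apply/asboolP; exists i, x.
exists n => j x nj Ix.
have Ijg : I j g by apply: (chain_le IS nj).
have Ir : I j (x %% g).
  have -> : x %% g = - (x %/ g) * g + x by rewrite {3}(divp_eq x g) mulNr addKr.
  exact: IL.
have : x %% g = 0.
  apply/eqP; apply: contraT => r0; have := gmin _ _ Ir r0.
  by rewrite leqNgt ltn_modp g0.
move=> r0; rewrite (divp_eq x g) r0; exact: IL.
Qed.

(** The usual proof that finitely generated modules over a Noetherian ring are
    Noetherian: a chain is controlled by its intersection with the span of the
    other generators and by the ideals of the coefficients of [v]. *)
Lemma acc_span (A : comNzRingType) (V : lmodType A) (s : seq V) (K : nat -> V -> Prop) :
  acc_ideals A ->
  (forall j, K j 0) -> (forall j a x y, K j x -> K j y -> K j (a *: x + y)) ->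
  (forall j x, K j x -> K j.+1 x) ->
  exists n, forall j x, (n <= j)%N -> span s x -> K j x -> K n x.
Proof.
move=> accA K0 KL KS; elim: s => [|v s [n1 n1P]].
  by exists 0%N => j x _ /= -> _.
pose I j c := exists u, span s u /\ K j (c *: v + u).
have [||| n2 n2P] := accA I.
- by move=> j; exists 0; rewrite scale0r addr0; split=> //; apply: span0.
- move=> j a x y [u [su Ku]] [w [sw Kw]]; exists (a *: u + w).
  split; first exact: spanP.
  have -> : (a * x + y) *: v + (a *: u + w) = a *: (x *: v + u) + (y *: v + w).
    by rewrite scalerDl scalerDr scalerA addrACA.
  exact: KL.
- by move=> j c [u [su Ku]]; exists u; split=> //; apply: KS.
exists (maxn n1 n2) => j z; rewrite geq_max => /andP [n1j n2j] [c su] Kz.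
have [|u' [su' Ku']] := n2P j c n2j.
  by exists (z - c *: v); split=> //; rewrite addrC subrK.
have Kj : K (maxn n1 n2) (c *: v + u') by apply: (chain_le KS _ Ku'); rewrite leq_maxr.
have : K n1 (z - (c *: v + u')).
  apply: (n1P j) => //.
    by rewrite opprD addrA; apply: spanB.
  rewrite -scaleN1r addrC; apply: KL => //.
  by apply: (chain_le KS _ Ku').
move/(chain_le KS (leq_maxl n1 n2)) => K1.
rewrite -(subrK (c *: v + u') z) -[X in X + _]scale1r; exact: KL.
Qed.

Section OneVariable.
Variables (A : comNzRingType) (V : lmodType A) (e : {linear V -> V}).

Definition step (s : seq V) : seq V := s ++ map e s.

Section Filt.
Variable s : seq V.
(** [filt n] is [L + e L + ... + e^n L] for the span [L] of [s]. *)
Definition filt n := span (iter n step s).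

Lemma filtS n z : filt n z -> filt n.+1 z.
Proof. by move=> fz; apply: span_catl. Qed.
Lemma filt_le m n z : (m <= n)%N -> filt m z -> filt n z.
Proof. exact: (chain_le filtS). Qed.
Lemma filt_e n z : filt n z -> filt n.+1 (e z).
Proof. by move=> fz; apply/span_catr/span_map; exists z. Qed.
Lemma filt_iter n t z : filt n z -> filt (n + t) (iter t e z).
Proof.
move=> fz; elim: t => [|t IH]; first by rewrite addn0.
by rewrite addnS; apply: filt_e.
Qed.
Lemma iter_linear t a x y : iter t e (a *: x + y) = a *: iter t e x + iter t e y.
Proof. by elim: t => //= t ->; rewrite linearP. Qed.
Lemma iter0 t : iter t e 0 = 0.
Proof. by elim: t => //= t ->; rewrite linear0. Qed.

Lemma filt_lead n z : filt n.+1 z ->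
  exists v u, [/\ span s v, filt n u & z = iter n.+1 e v + u].
Proof.
elim: n z => [|n IH] z /span_catP [u [w [su /span_map [v fv ->] ->]]].
  by exists v, u; split=> //; rewrite addrC.
have [v' [u' [sv fu ->]]] := IH _ fv.
exists v', (u + e u'); split=> //.
  by apply: spanD => //; apply: filt_e.
by rewrite linearD addrCA.
Qed.

(** Multiplication by [e] is injective on the graded piece of degree [n + 1]. *)
Definition stable n := forall z, filt n.+1 z -> filt n.+1 (e z) -> filt n z.

(** The graded piece in degree [j + 1] is the quotient of [L] by the submodule of the
    [v] such that [e^(j+1) v] is in [filt j]. These submodules increase with [j], so
    they are eventually constant. *)
Lemma eventually_stable : acc_ideals A -> exists n0, forall n, (n0 <= n)%N -> stable n.
Proof.
move=> accA.
have [||| n0 n0P] := acc_span s (K := fun j v => filt j (iter j.+1 e v)) accA.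
- by move=> j; rewrite iter0; apply: span0.
- by move=> j a x y fx fy; rewrite iter_linear; apply: spanP.
- by move=> j x fx; apply: filt_e.
exists n0 => n n0n z /filt_lead [v [u [sv fu ->]]] fe.
have fn0 : filt n0 (iter n0.+1 e v).
  apply: (n0P n.+1) => //; first exact: leqW.
  have -> : iter n.+2 e v = e (iter n.+1 e v + u) - e u by rewrite linearD addrK.
  by apply: spanB => //; apply: filt_e.
apply: spanD => //.
have := filt_iter (n - n0) fn0.
by rewrite -iterD addnS subnK // subnKC.
Qed.

(** This says that the kernel of [L_(n+1)[t] -> V], [t |-> e], is the image of
    [t - e] on [L_n[t]], where [L_n] is [filt n]. Division by [t - e] is possible over
    [V]; its quotient [q] has coefficients in some large [L_N], and stability lowers
    [N] one step at a time because [e q_0 = - p_0] and [e q_(j+1) = q_j - p_(j+1)]. *)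
Lemma one_variable_division n B (p : nat -> V) :
  (forall n', (n <= n')%N -> stable n') ->
  (forall j, filt n.+1 (p j)) -> (forall j, (B <= j)%N -> p j = 0) ->
  \sum_(j < B) iter j e (p j) = 0 ->
  exists q, [/\ forall j, filt n (q j), forall j, (B <= j)%N -> q j = 0 &
    forall j, p j = delay q j - e (q j)].
Proof.
move=> st fp p0 sp.
pose q j := \sum_(t < B) iter t e (p (j + t).+1).
have eq0 j : e (q j) = \sum_(t < B) iter t.+1 e (p (j + t.+1)%N).
  by rewrite linear_sum; apply: eq_bigr => t _; rewrite addnS.
have qS j : q j = p j.+1 + e (q j.+1).
  rewrite eq0 /q; case: (B) p0 => [|B'] p0.
    by rewrite !big_ord0 p0 ?addr0.
  rewrite big_ord_recl big_ord_recr /= addn0; congr (_ + _).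
  rewrite p0 ?iter0 ?linear0 ?addr0; last by rewrite addnS ltnS leqW // leq_addl.
  by apply: eq_bigr => t _; rewrite /bump /= add1n addSn.
have q0 : e (q 0%N) = - p 0%N.
  apply/eqP; rewrite -addr_eq0 eq0 -[X in _ == X]sp; apply/eqP.
  case: (B) p0 => [|B'] p0.
    by rewrite !big_ord0 add0r p0.
  rewrite [RHS]big_ord_recl big_ord_recr /= [LHS]addrC; congr (_ + _).
  by rewrite p0 ?iter0 ?linear0 ?addr0 //; apply: eq_bigr => t _.
have qB j : (B <= j)%N -> q j = 0.
  by move=> Bj; apply: big1 => t _; rewrite p0 ?iter0 // leqW // (leq_trans Bj) ?leq_addr.
exists q; split=> //; last first.
  by case=> [|j] /=; [rewrite q0 sub0r opprK|rewrite qS addrK].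
have start j : filt (n + B.+1) (q j).
  apply: span_sum => t _; apply: (@filt_le (n.+1 + t)); last exact: filt_iter.
  by rewrite addSnnS leq_add2l ltnS ltnW.
move: (B.+1) start => d; elim: d => [|d IH]; first by rewrite addn0.
rewrite addnS => Hd; apply: IH => j.
apply: (st (n + d)%N (leq_addr _ _)) => //.
have pd i : filt (n + d).+1 (p i) by apply: filt_le (fp i); rewrite ltnS leq_addr.
case: j => [|j]; first by rewrite q0; exact: (spanN (pd 0%N)).
have -> : e (q j.+1) = q j - p j.+1 by rewrite [q j]qS addrC addKr.
exact: (spanB (Hd j) (pd j.+1)).
Qed.
End Filt.
End OneVariable.

Lemma delay_inj (V : zmodType) (e : V -> V) B (q : nat -> V) :
  e 0 = 0 -> (forall j, (B <= j)%N -> q j = 0) ->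
  (forall j, delay q j - e (q j) = 0) -> forall j, q j = 0.
Proof.
move=> e0 qB qE j.
have : forall d j, (B <= j + d)%N -> q j = 0.
  elim=> [|d IH] i Bi; first by apply: qB; rewrite -(addn0 i).
  have /eqP := qE i.+1; rewrite /= subr_eq0 => /eqP ->.
  by rewrite (IH i.+1) ?e0 // addSnnS.
by apply; apply: leq_addl.
Qed.

(** * Exactness of the truncated Koszul resolution *)

Section BiFiltration.
Variables (k : fieldType) (N : lmodType {mpoly k[2]}).
Local Notation S := {mpoly k[2]}.
Local Notation x := (varx k).
Local Notation y := (vary k).

Definition const_emb : {rmorphism k -> S} := @mpolyC 2 k.
Definition polyx_emb : {rmorphism {poly k} -> S} := horner_alg x.
Local Notation Vk := (restr const_emb N).
Local Notation Vx := (restr polyx_emb N).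

Section Act.
Variables (A : comNzRingType) (phi : {rmorphism A -> S}) (s : S).
(** Multiplication by an element of k[x,y], seen as a linear map over a smaller ring. *)
Definition scale_by (z : restr phi N) : restr phi N := s *: (z : N).
Lemma scale_by_linear : linear scale_by.
Proof.
move=> a u v; rewrite /scale_by -[LHS]/(s *: (phi a *: (u : N) + (v : N))).
by rewrite scalerDr scalerA mulrC -scalerA.
Qed.
HB.instance Definition _ := GRing.isLinear.Build A (restr phi N) (restr phi N) _ scale_by scale_by_linear.
Lemma iter_scale_by i (z : restr phi N) : iter i scale_by z = s ^+ i *: (z : N).
Proof. by elim: i => [|i IH] /=; rewrite ?scale1r // IH /scale_by scalerA exprS. Qed.
End Act.

Definition stepl (s : S) (t : seq N) : seq N := t ++ [seq s *: z | z <- t].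

Variable V0 : seq N.
Definition ylist n : seq N := iter n (stepl y) V0.
(** The vectors [x^a y^b v] with [a <= m], [b <= n] and [v] in [V0]. Over k they span the
    finite-dimensional space [boxspan n m]; over k[x] the ones with [a = 0] span
    [stripspan n], the union of the [boxspan n m]. *)
Definition box n m : seq N := iter m (stepl x) (ylist n).
Definition boxspan n m (z : N) : Prop := span (box n m : seq Vk) (z : Vk).
Definition stripspan n (z : N) : Prop := span (ylist n : seq Vx) (z : Vx).

Lemma stepl_sub s t t' : {subset t <= t'} -> {subset stepl s t <= stepl s t'}.
Proof.
move=> tt z; rewrite !mem_cat => /orP [/tt -> //|/mapP [u /tt ut ->]].
by rewrite map_f ?orbT.
Qed.
Lemma box_sub t t' m : {subset t <= t'} ->
  {subset iter m (stepl x) t <= iter m (stepl x) t'}.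
Proof. by move=> tt; elim: m => //= m; apply: stepl_sub. Qed.
Lemma map_box t m : [seq y *: z | z <- iter m (stepl x) t] =
  iter m (stepl x) [seq y *: z | z <- t].
Proof.
elim: m => //= m <-; rewrite /stepl map_cat -!map_comp; congr (_ ++ _).
by apply: eq_map => z /=; rewrite !scalerA mulrC.
Qed.

Lemma boxspan0 n m : boxspan n m 0. Proof. exact: span0. Qed.
Lemma boxspanB n m u v : boxspan n m u -> boxspan n m v -> boxspan n m (u - v). Proof. exact: spanB. Qed.
Lemma boxspan_mS n m z : boxspan n m z -> boxspan n m.+1 z.
Proof. exact: (@filtS _ Vk (scale_by (phi:=const_emb) x) (ylist n) m z). Qed.
Lemma boxspan_x n m z : boxspan n m z -> boxspan n m.+1 (x *: z).
Proof. exact: (@filt_e _ Vk (scale_by (phi:=const_emb) x) (ylist n) m z). Qed.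
Lemma boxspan_nS n m z : boxspan n m z -> boxspan n.+1 m z.
Proof.
apply: span_sub => v vs; apply: (@mem_span _ Vk); apply: box_sub vs => u us.
by rewrite /ylist /= mem_cat us.
Qed.
Lemma boxspan_y n m z : boxspan n m z -> boxspan n.+1 m (y *: z).
Proof.
move=> Wz; have H : span (map (scale_by (phi:=const_emb) y) (box n m : seq Vk)) (scale_by (phi:=const_emb) y z).
  by apply/span_map; exists z.
apply: span_sub H => v; rewrite map_box => vs; apply: (@mem_span _ Vk).
by apply: box_sub vs => u us; rewrite /ylist /= mem_cat us orbT.
Qed.

Lemma strip_x n z : stripspan n z -> stripspan n (x *: z).
Proof.
move=> Mz; have -> : x *: z = 'X *: (z : Vx) by rewrite restrE /= horner_algX.
exact: spanZ.
Qed.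
Lemma strip_k n (c : k) z : stripspan n z -> stripspan n (const_emb c *: z).
Proof.
move=> Mz; have -> : const_emb c *: z = c%:P *: (z : Vx).
  by rewrite restrE /= horner_algC alg_mpolyC.
exact: spanZ.
Qed.
Lemma strip_xn n i z : stripspan n z -> stripspan n (x ^+ i *: z).
Proof. by move=> Mz; elim: i => [|i IH]; rewrite ?scale1r // exprS -scalerA; apply: strip_x. Qed.
Lemma boxspan_strip n m z : boxspan n m z -> stripspan n z.
Proof.
have : forall v, v \in box n m -> stripspan n v.
  elim: m => [|m IH] v; first exact: (@mem_span _ Vx).
  by rewrite mem_cat => /orP [/IH //|/mapP [u /IH Mu ->]]; apply: strip_x.
rewrite /boxspan; elim: (box n m) z => [z _ ->|v s IH z sM [c]]; first exact: span0.
move=> /IH H; rewrite -(subrK (const_emb c *: (v : N)) z); apply: (@spanD _ Vx).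
  by apply: H => u us; apply: sM; rewrite inE us orbT.
by apply/strip_k/sM; rewrite inE eqxx.
Qed.

Lemma sum_extend (T : zmodType) (f : nat -> T) b B : (b <= B)%N ->
  (forall i, (b <= i)%N -> f i = 0) -> \sum_(i < B) f i = \sum_(i < b) f i.
Proof.
move=> bB f0; rewrite -(subnKC bB) big_split_ord /= [X in _ + X]big1 ?addr0 //.
by move=> i _; rewrite f0 // leq_addr.
Qed.

Lemma polyx_embE (c : {poly k}) : polyx_emb c = \sum_(i < size c) const_emb c`_i * x ^+ i.
Proof.
rewrite -[in LHS](coefK c) poly_def rmorph_sum; apply: eq_bigr => i _.
rewrite -mul_polyC rmorphM rmorphXn /= horner_algX horner_algC.
by rewrite alg_mpolyC.
Qed.

Lemma strip_coef n z : stripspan n z -> exists (f : nat -> N) (b : nat),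
  [/\ forall i, boxspan n 0 (f i), forall i, (b <= i)%N -> f i = 0 &
      z = \sum_(i < b) x ^+ i *: f i].
Proof.
rewrite /stripspan /boxspan /box /=; elim: (ylist n) z => [|v s IH] z /=.
  by move=> ->; exists (fun=> 0), 0%N; rewrite big_ord0.
move=> [c /IH [f [b [sf f0 zE]]]].
exists (fun i => const_emb c`_i *: v + f i), (maxn b (size c)); split=> [i|i|].
- exists c`_i.
  have E : const_emb c`_i *: v + f i - const_emb c`_i *: v = f i by rewrite addrC addKr.
  have := sf i; rewrite -{1}E; exact.
- by rewrite geq_max => /andP [bi ci]; rewrite f0 // nth_default // rmorph0 scale0r addr0.
have -> : z = (z - polyx_emb c *: v) + polyx_emb c *: v by rewrite subrK.
under eq_bigr => i _ do rewrite scalerDr.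
rewrite big_split /= addrC; congr (_ + _); last first.
  have Es : \sum_(i < maxn b (size c)) x ^+ i *: (const_emb c`_i *: (v : N)) =
      \sum_(i < size c) x ^+ i *: (const_emb c`_i *: v).
    apply: (@sum_extend _ (fun i => x ^+ i *: (const_emb c`_i *: v))); first exact: leq_maxr.
    by move=> i ci; rewrite nth_default // rmorph0 scale0r scaler0.
  apply: etrans (esym Es); rewrite polyx_embE scaler_suml; apply: eq_bigr => i _.
  by rewrite scalerA mulrC.
rewrite [LHS]zE; apply/esym/(@sum_extend _ (fun i => x ^+ i *: f i)).
  exact: leq_maxl.
by move=> i bi; rewrite f0 // scaler0.
Qed.

(** The bounds on [n] and [m] under which division in [y] and then in [x] keeps the
    expected ranges; two values of [n] occur in the Koszul complex. *)
Definition regular n m : Prop :=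
  [/\ forall n', (n <= n')%N -> stable (scale_by (phi:=polyx_emb) y) (V0 : seq Vx) n',
      forall m', (m <= m')%N -> stable (scale_by (phi:=const_emb) x) (ylist n : seq Vk) m' &
      forall m', (m <= m')%N -> stable (scale_by (phi:=const_emb) x) (ylist n.+1 : seq Vk) m'].

Lemma eventually_regular : exists n0, forall n, (n0 <= n)%N ->
  exists m0, forall m, (m0 <= m)%N -> regular n m.
Proof.
have [n0 n0P] := eventually_stable (scale_by (phi:=polyx_emb) y) (V0 : seq Vx) (@acc_ideals_poly k).
exists n0 => n n0n.
have [a aP] := eventually_stable (scale_by (phi:=const_emb) x) (ylist n : seq Vk) (@acc_ideals_field k).
have [b bP] := eventually_stable (scale_by (phi:=const_emb) x) (ylist n.+1 : seq Vk) (@acc_ideals_field k).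
exists (maxn a b) => m; rewrite geq_max => /andP [am bm].
split=> [n' nn'|m' mm'|m' mm']; first exact/n0P/(leq_trans n0n).
- exact/aP/(leq_trans am).
- exact/bP/(leq_trans bm).
Qed.

Lemma stripspan_division n B (p : nat -> N) :
  (forall n', (n <= n')%N -> stable (scale_by (phi:=polyx_emb) y) (V0 : seq Vx) n') ->
  (forall j, stripspan n.+1 (p j)) -> (forall j, (B <= j)%N -> p j = 0) ->
  \sum_(j < B) y ^+ j *: p j = 0 ->
  exists q : nat -> N, [/\ forall j, stripspan n (q j), forall j, (B <= j)%N -> q j = 0 &
    forall j, p j = delay q j - y *: q j].
Proof.
move=> st Mp pB sp; apply: (one_variable_division st Mp pB).
by under eq_bigr => j _ do rewrite iter_scale_by.
Qed.

Lemma boxspan_division n m B (p : nat -> N) :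
  (forall m', (m <= m')%N -> stable (scale_by (phi:=const_emb) x) (ylist n : seq Vk) m') ->
  (forall j, boxspan n m.+1 (p j)) -> (forall j, (B <= j)%N -> p j = 0) ->
  \sum_(j < B) x ^+ j *: p j = 0 ->
  exists q : nat -> N, [/\ forall j, boxspan n m (q j), forall j, (B <= j)%N -> q j = 0 &
    forall j, p j = delay q j - x *: q j].
Proof.
move=> st Mp pB sp; apply: (one_variable_division st Mp pB).
by under eq_bigr => j _ do rewrite iter_scale_by.
Qed.

Implicit Types p q r u : nat -> nat -> N.
(** The functions [nat -> nat -> N] with bounded support stand for polynomials in two
    variables [s], [t] with coefficients in [N], and [dx], [dy] for the multiplications
    by [s - x] and [t - y]. *)
Definition dx r i j : N := delay (fun i => r i j) i - x *: r i j.
Definition dy q i j : N := delay (q i) j - y *: q i j.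
Definition bounded B p : Prop := forall i j, (B <= i)%N || (B <= j)%N -> p i j = 0.
Definition valued n m p : Prop := forall i j, boxspan n m (p i j).

Lemma delayB (s : S) (f g : nat -> N) i :
  delay (fun i => f i - s *: g i) i = delay f i - s *: delay g i.
Proof. by case: i => [|i] //=; rewrite scaler0 subr0. Qed.

Lemma dxdy p i j : dx (dy p) i j = dy (dx p) i j.
Proof.
rewrite /dx /dy !delayB !scalerBr !scalerA [y * x]mulrC !opprB !addrA.
have -> : delay (fun i => delay (p i) j) i = delay (fun j => delay (p^~ j) i) j.
  by case: i j => [|i] [|j].
by rewrite addrAC [RHS]addrAC; congr (_ + _); rewrite addrAC.
Qed.

Lemma dx_inj B p : bounded B p -> (forall i j, dx p i j = 0) -> forall i j, p i j = 0.
Proof.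
move=> pB p0 i j; apply: (@delay_inj _ ( *:%R x) B (fun i => p i j)) => [|i' Bi|i'].
- exact: scaler0.
- by rewrite pB // Bi.
- exact: p0.
Qed.

Lemma sum_dx B r j : bounded B r -> \sum_(i < B.+1) x ^+ i *: dx r i j = 0.
Proof.
move=> rB; rewrite /dx; under eq_bigr => i _ do rewrite scalerBr scalerA -exprSr.
rewrite sumrB big_ord_recl [X in _ - X]big_ord_recr /= scaler0 add0r.
by rewrite (rB B j) ?leqnn // scaler0 addr0 subrr.
Qed.

Lemma valued_dy n m q : valued n m q -> valued n.+1 m (dy q).
Proof.
move=> Wq i j; apply: boxspanB; last exact: boxspan_y.
by case: j => [|j]; [exact: boxspan0|exact: boxspan_nS (Wq i j)].
Qed.

(** Evaluate [s] at [x] first. The resulting polynomial in [t] has coefficients in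
    [stripspan (n + 1)] and vanishes at [t = y], so it is divisible by [t - y] over
    [stripspan n]. Lifting the quotient to [q], the difference of [p] and [dy q]
    vanishes at [s = x] for each power of [t], so it is divisible by [s - x]. *)
Lemma exact_middle n m B p : regular n m -> valued n.+1 m.+1 p -> bounded B p ->
  \sum_(i < B) \sum_(j < B) (x ^+ i * y ^+ j) *: p i j = 0 ->
  exists q r B', [/\ valued n m.+1 q, valued n.+1 m r, bounded B' q, bounded B' r &
    forall i j, p i j = dy q i j + dx r i j].
Proof.
move=> [stM stW stW1] Wp pB sp.
pose P j := \sum_(i < B) x ^+ i *: p i j.
have MP j : stripspan n.+1 (P j).
  by apply: (@span_sum _ Vx) => i _; apply/strip_xn/boxspan_strip/Wp.
have PB j : (B <= j)%N -> P j = 0.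
  by move=> Bj; apply: big1 => i _; rewrite pB ?Bj ?orbT // scaler0.
have sP : \sum_(j < B) y ^+ j *: P j = 0.
  rewrite -[RHS]sp exchange_big; apply: eq_bigr => j _; rewrite scaler_sumr.
  by apply: eq_bigr => i _; rewrite scalerA mulrC.
have [Q [MQ QB PE]] := stripspan_division stM MP PB sP.
have Hq j : exists fb : (nat -> N) * nat, [/\ forall i, boxspan n 0 (fb.1 i),
    forall i, (fb.2 <= i)%N -> fb.1 i = 0, Q j = \sum_(i < fb.2) x ^+ i *: fb.1 i &
    (B <= j)%N -> fb = (fun=> 0, 0%N)].
  case: (leqP B j) => Bj.
    exists (fun=> 0, 0%N); split=> //= [i|]; first exact: boxspan0.
    by rewrite big_ord0 QB.
  have [f [b [Wf fb QE]]] := strip_coef (MQ j).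
  by exists (f, b).
have [F FP] := choice Hq.
pose q i j := (F j).1 i.
pose B1 := maxn B (\max_(j < B) (F j).2).
have FB j : ((F j).2 <= B1)%N.
  case: (FP j) => _ _ _ F0; case: (leqP B j) => [/F0 -> //|jB].
  by apply: leq_trans (leq_maxr _ _); apply: (leq_bigmax (Ordinal jB)).
have qB1 : bounded B1 q.
  move=> i j; case: (FP j) => _ fb _ F0 /orP [Bi|Bj].
    by apply: fb; apply: leq_trans Bi.
  by rewrite /q F0 // (leq_trans (leq_maxl _ _) Bj).
have Wq : valued n m.+1 q.
  move=> i j; case: (FP j) => /(_ i) W0z _ _ _.
  by elim: (m.+1) => [|m' IH]; [exact: W0z|exact: boxspan_mS IH].
have QE j B' : (B1 <= B')%N -> Q j = \sum_(i < B') x ^+ i *: q i j.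
  move=> BB; case: (FP j) => _ fb -> _; apply/esym.
  apply: (@sum_extend _ (fun i => x ^+ i *: q i j)); first exact: leq_trans BB.
  by move=> i bi; rewrite /q fb // scaler0.
pose p' i j := p i j - dy q i j.
have Wp' : valued n.+1 m.+1 p' by move=> i j; apply: boxspanB => //; apply: valued_dy.
have p'B : bounded B1.+1 p'.
  move=> i j H; rewrite /p' /dy pB ?qB1 ?scaler0 ?subr0.
  - by case: j H => [|j] H /=; rewrite ?subr0 // qB1 ?subr0 //; move: H; rewrite ltnS; lia.
  - by move: H; lia.
  - by move: H (leq_maxl B (\max_(j < B) (F j).2)); rewrite -/B1; lia.
have sp' j : \sum_(i < B1.+1) x ^+ i *: p' i j = 0.
  have -> : \sum_(i < B1.+1) x ^+ i *: p' i j = P j - (delay Q j - y *: Q j).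
    have pp : P j = \sum_(i < B1.+1) x ^+ i *: p i j.
      apply/esym/(@sum_extend _ (fun i => x ^+ i *: p i j)); first by rewrite leqW ?leq_maxl.
      by move=> i Bi; rewrite pB ?Bi // scaler0.
    have -> : delay Q j = \sum_(i < B1.+1) x ^+ i *: delay (q i) j.
      case: j {pp} => [|j] /=; last exact: QE.
      by rewrite big1 // => i _; rewrite scaler0.
    rewrite pp (QE j B1.+1) // scaler_sumr -!sumrB; apply: eq_bigr => i _.
    by rewrite /p' /dy !scalerBr !scalerA [y * _]mulrC.
  by rewrite -PE subrr.
have Hr j : exists f : nat -> N, [/\ forall i, boxspan n.+1 m (f i),
    forall i, (B1.+1 <= i)%N -> f i = 0, forall i, p' i j = delay f i - x *: f i &
    (B1.+1 <= j)%N -> f = fun=> 0].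
  case: (leqP B1.+1 j) => Bj.
    exists (fun=> 0); split=> // i; first exact: boxspan0.
    by rewrite p'B ?Bj ?orbT // scaler0 subr0; case: i.
  have [|f [Wf fB fE]] := boxspan_division stW1 (fun i => Wp' i j) _ (sp' j).
    by move=> i Bi; rewrite p'B // Bi.
  by exists f.
have [Rf RP] := choice Hr.
exists q, (fun i j => Rf j i), B1.+1; split=> //.
- by move=> i j; case: (RP j).
- by move=> i j H; apply: qB1; move: H; lia.
- by move=> i j /orP [Bi|Bj]; case: (RP j) => _ + _ +; [move=> + _; apply|move=> _ ->].
- by move=> i j; case: (RP j) => _ _ + _ => /(_ i); rewrite /p' /dx => <-; rewrite addrC subrK.
Qed.

(** At [s = x] the relation says that [t - y] kills the value of [q], which is therefore
    zero; so [q] is a multiple [dx u]. Then [dx (r + dy u) = 0] and [dx] is injective. *)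
Lemma exact_left n m B q r : regular n m -> valued n m.+1 q -> valued n.+1 m r ->
  bounded B q -> bounded B r -> (forall i j, dy q i j + dx r i j = 0) ->
  exists u, [/\ valued n m u, bounded B u,
    forall i j, q i j = dx u i j & forall i j, r i j = - dy u i j].
Proof.
move=> [stM stW stW1] Wq Wr qB rB E.
pose Q j := \sum_(i < B.+1) x ^+ i *: q i j.
have Q0 : forall j, Q j = 0.
  apply: (@delay_inj _ ( *:%R y) B) => [|j Bj|j]; first exact: scaler0.
    by rewrite /Q big1 // => i _; rewrite qB ?Bj ?orbT // scaler0.
  have -> : delay Q j = \sum_(i < B.+1) x ^+ i *: delay (q i) j.
    by case: j => [|j] //=; rewrite big1 // => i _; rewrite scaler0.
  rewrite scaler_sumr -sumrB -[RHS](subrr (\sum_(i < B.+1) x ^+ i *: dx r i j)).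
  rewrite [in X in _ = X - _]sum_dx // sub0r -sumrN; apply: eq_bigr => i _.
  have /eqP := E i j; rewrite addr_eq0 => /eqP dE.
  by rewrite -[RHS]scalerN -dE /dy scalerBr !scalerA mulrC.
have Hu j : exists f : nat -> N, [/\ forall i, boxspan n m (f i),
    forall i, (B <= i)%N -> f i = 0, forall i, q i j = delay f i - x *: f i &
    (B <= j)%N -> f = fun=> 0].
  case: (leqP B j) => Bj.
    exists (fun=> 0); split=> // i; first exact: boxspan0.
    by rewrite qB ?Bj ?orbT // scaler0 subr0; case: i.
  have [| |f [Wf fB fE]] := @boxspan_division n m B (q^~ j) stW (fun i => Wq i j).
  - by move=> i Bi; rewrite qB // Bi.
  - rewrite -[RHS](Q0 j); apply/esym/(@sum_extend _ (fun i => x ^+ i *: q i j)) => // i Bi.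
    by rewrite qB ?Bi // scaler0.
  by exists f.
have [F FP] := choice Hu.
pose u i j := F j i.
have uB : bounded B u.
  by move=> i j /orP [Bi|Bj]; case: (FP j) => _ + _ +; [move=> H _; exact: H Bi|move=> _ F0; rewrite /u F0].
have qE i j : q i j = dx u i j by case: (FP j) => _ _ + _; apply.
exists u; split=> // [i j|i j]; first by case: (FP j) => H _ _ _; exact: H.
apply/eqP; rewrite -addr_eq0; apply/eqP.
apply: (@dx_inj B.+1 (fun i j => r i j + dy u i j)).
  move=> i' j' H; rewrite /dy rB ?uB ?scaler0 ?subr0 ?add0r; first last.
  - by move: H; lia.
  - by move: H; lia.
  by case: j' H => [|j'] H //=; rewrite uB //; move: H; lia.
move=> i' j'; rewrite -[RHS](E i' j').
have -> : dy q i' j' = dx (dy u) i' j'.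
  rewrite dxdy /dy qE; congr (_ - _).
  by case: j' => [|j'] //=; rewrite qE.
rewrite addrC /dx scalerDr opprD addrACA; congr (_ + _).
by case: i' => [|i'] //=; rewrite ?addr0 ?subr0.
Qed.

End BiFiltration.

(** * Vectors over k[x,y] as coefficient functions *)

Section Monomials.
Variable k : fieldType.
Local Notation S := {mpoly k[2]}.
Definition mon (i j : nat) : 'X_{1..2} := (U_(ord0) *+ i + U_(ord_max) *+ j)%MM.
Lemma mon0 i j : mon i j ord0 = i.
Proof. by rewrite mnmDE !mulmnE !mnm1E /= mul1n mul0n addn0. Qed.
Lemma mon1 i j : mon i j ord_max = j.
Proof. by rewrite mnmDE !mulmnE !mnm1E /= mul1n mul0n. Qed.
Lemma ord2P (Q : 'I_2 -> Prop) : Q ord0 -> Q ord_max -> forall i, Q i.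
Proof.
move=> Q0 Q1 [[|[|i]] hi] //.
  by rewrite (_ : Ordinal hi = ord0) //; apply: val_inj.
by rewrite (_ : Ordinal hi = ord_max) //; apply: val_inj.
Qed.
Lemma monE (m : 'X_{1..2}) : m = mon (m ord0) (m ord_max).
Proof. by apply/mnmP; apply: ord2P; rewrite ?mon0 ?mon1. Qed.
Lemma mon_eq i j (m : 'X_{1..2}) : (mon i j == m) = (i == m ord0) && (j == m ord_max).
Proof.
apply/eqP/andP => [<-|[/eqP -> /eqP ->]]; first by rewrite mon0 mon1.
by rewrite -monE.
Qed.
Lemma mdeg_mon i j : mdeg (mon i j) = (i + j)%N.
Proof. by rewrite mdegD !mdegMn !mdeg1 !mul1n. Qed.

Lemma mpoly2E (f : S) B : (msize f <= B)%N ->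
  f = \sum_(i < B) \sum_(j < B) f@_(mon i j) *: (varx k ^+ i * vary k ^+ j).
Proof.
move=> fB; apply/mpolyP => m.
have E i j : (f@_(mon i j) *: (varx k ^+ i * vary k ^+ j))@_m =
    f@_(mon i j) * (mon i j == m)%:R.
  by rewrite mcoeffZ /varx /vary !mpolyXn -mpolyXD mcoeffX.
rewrite raddf_sum /=; under eq_bigr => i _ do rewrite raddf_sum /=.
under eq_bigr => i _ do under eq_bigr => j _ do rewrite E mon_eq.
case: (ltnP (m ord0) B) => m0; last first.
  rewrite mcoeff_ge; last first.
    by apply: leq_trans fB _; rewrite (monE m) mdeg_mon (leq_trans m0) // leq_addr.
  rewrite big1 // => i _; rewrite big1 // => j _.
  by rewrite ltn_eqF ?mulr0 // (leq_trans _ m0).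
case: (ltnP (m ord_max) B) => m1; last first.
  rewrite mcoeff_ge; last first.
    by apply: leq_trans fB _; rewrite (monE m) mdeg_mon (leq_trans m1) // leq_addl.
  rewrite big1 // => i _; rewrite big1 // => j _.
  by rewrite [j == _ :> nat]ltn_eqF ?andbF ?mulr0 // (leq_trans _ m1).
rewrite (bigD1 (Ordinal m0)) //= [X in _ + X]big1 ?addr0 => [|i]; last first.
  rewrite -val_eqE /= => /negPf im; rewrite big1 // => j _.
  by rewrite im mulr0.
rewrite (bigD1 (Ordinal m1)) //= [X in _ + X]big1 ?addr0 => [|j]; last first.
  by rewrite -val_eqE /= => /negPf jm; rewrite jm andbF mulr0.
by rewrite !eqxx mulr1 -monE.
Qed.

Lemma mcoeff_mulx (f : S) i j :
  (varx k * f)@_(mon i j) = if i is i'.+1 then f@_(mon i' j) else 0.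
Proof.
rewrite mulrC mcoeffMXE; case: i => [|i].
  by case: ifP => // /mnm_lepP /(_ ord0); rewrite mnm1E mon0.
have E : mon i.+1 j = (mon i j + U_(ord0))%MM.
  by apply/mnmP; apply: ord2P; rewrite mnmDE mnm1E ?mon0 ?mon1 /= ?addn1 ?addn0.
by rewrite E addmK ifT // addmC lem_addr.
Qed.
Lemma mcoeff_muly (f : S) i j :
  (vary k * f)@_(mon i j) = if j is j'.+1 then f@_(mon i j') else 0.
Proof.
rewrite mulrC mcoeffMXE; case: j => [|j].
  by case: ifP => // /mnm_lepP /(_ ord_max); rewrite mnm1E mon1.
have E : mon i j.+1 = (mon i j + U_(ord_max))%MM.
  by apply/mnmP; apply: ord2P; rewrite mnmDE mnm1E ?mon0 ?mon1 /= ?addn1 ?addn0.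
by rewrite E addmK ifT // addmC lem_addr.
Qed.
End Monomials.

Section Iota.
Variables (k : fieldType) (l : nat).
Local Notation R := (veronese k l).
Local Notation S := {mpoly k[2]}.
Lemma iota_mem (c : k) : c%:MP_[2] \in @veronese_pred k l.
Proof.
apply/allP => m; rewrite mcoeff_msupp mcoeffC.
by case: (m =P 0%MM) => [->|_]; rewrite ?mdeg0 ?dvdn0 // mulr0 eqxx.
Qed.
Definition iota_fun (c : k) : R := Veronese (iota_mem c).
Lemma iota_zmod : zmod_morphism iota_fun.
Proof. by move=> a b; apply: val_inj; rewrite /= mpolyCB. Qed.
Lemma iota_monoid : monoid_morphism iota_fun.
Proof. by split=> [|a b]; apply: val_inj; rewrite /= ?mpolyC1 ?mpolyCM. Qed.
HB.instance Definition _ := GRing.isZmodMorphism.Build k R iota_fun iota_zmod.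
HB.instance Definition _ := GRing.isMonoidMorphism.Build k R iota_fun iota_monoid.
Definition vero_const : {rmorphism k -> R} := iota_fun.

Definition smul (s : S) (f : polymod k l) : polymod k l := s * (f : S).
Lemma smul_linear s : linear (smul s).
Proof.
move=> a f g; rewrite /smul -[LHS]/(s * (vero_emb k l a * (f : S) + (g : S))).
by rewrite mulrDr mulrCA.
Qed.
HB.instance Definition _ s := GRing.isLinear.Build R (polymod k l) (polymod k l) _ (smul s) (smul_linear s).
End Iota.

Section Theta.
Variables (k : fieldType) (l : nat).
Local Notation R := (veronese k l).
Local Notation S := {mpoly k[2]}.
Local Notation Vk N := (restr (const_emb k) N).
Local Notation Fr r := {ffun 'I_r -> polymod k l}.

Section One.
Variables (N : lmodType S) (t : seq (Vk N)).
(** With [t] a basis of a space [W], a row vector over k[x,y] is an element of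
    [k[x,y] (x) W]; this is the coefficient in [W] of its monomial [x^i y^j]. *)
Definition ncoef (f : Fr (size t)) (i j : nat) : Vk N :=
  \sum_a (f a : S)@_(mon i j) *: t`_a.

Lemma ncoefD f g i j : ncoef (f + g) i j = ncoef f i j + ncoef g i j.
Proof.
by rewrite -big_split; apply: eq_bigr => a _; rewrite !ffunE mcoeffD scalerDl.
Qed.
Lemma ncoefN f i j : ncoef (- f) i j = - ncoef f i j.
Proof.
by rewrite -sumrN; apply: eq_bigr => a _; rewrite !ffunE mcoeffN scaleNr.
Qed.
Lemma ncoef0 i j : ncoef 0 i j = 0.
Proof. by apply: big1 => a _; rewrite ffunE mcoeff0 scale0r. Qed.
Lemma ncoefB f g i j : ncoef (f - g) i j = ncoef f i j - ncoef g i j.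
Proof. by rewrite ncoefD ncoefN. Qed.
Lemma ncoef_inj f : free t -> (forall i j, ncoef f i j = 0) -> f = 0.
Proof.
move=> ft f0; apply/ffunP => a; rewrite ffunE; apply/mpolyP => m.
rewrite (monE m) mcoeff0.
exact: (free_inj (c := fun a => (f a : S)@_(mon (m ord0) (m ord_max))) ft (f0 _ _)).
Qed.
Lemma ncoef_eq f g : free t -> (forall i j, ncoef f i j = ncoef g i j) -> f = g.
Proof.
move=> ft E; apply/eqP; rewrite -subr_eq0; apply/eqP; apply: ncoef_inj => // i j.
by rewrite ncoefB E subrr.
Qed.
Lemma ncoef_span f i j : span t (ncoef f i j).
Proof. by apply: span_sum => a _; apply/spanZ/mem_span/mem_nth. Qed.
Lemma ncoef_bounded f : exists B, bounded B (ncoef f : nat -> nat -> N).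
Proof.
exists (\max_a msize (f a : S)) => i j H; apply: big1 => a _.
rewrite mcoeff_ge ?scale0r // mdeg_mon.
have := leq_bigmax (F := fun a => msize (f a : S)) a.
by move: H; lia.
Qed.
Lemma ncoef_surj (p : nat -> nat -> N) B : bounded B p ->
  (forall i j, span t (p i j : Vk N)) -> exists f, forall i j, ncoef f i j = p i j.
Proof.
move=> pB pt.
have [c cE] := choice (fun ij : nat * nat => (span_tupleP t (p ij.1 ij.2 : Vk N)).1 (pt ij.1 ij.2)).
pose cc a (m : 'X_{1..2}) := if ((m ord0 < B) && (m ord_max < B))%N then c (m ord0, m ord_max) a else 0.
exists [ffun a => mpoly_of_coef (B + B) (cc a) : polymod k l] => i j.
have ccE a : (mpoly_of_coef (B + B) (cc a))@_(mon i j) = cc a (mon i j).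
  apply: (mcoeff_of_coef (c := cc a)) => m; rewrite {1}(monE m) mdeg_mon /cc => H.
  by rewrite ifF //; move: H; lia.
rewrite /ncoef; under eq_bigr => a _ do rewrite ffunE ccE /cc mon0 mon1.
case: (boolP ((i < B) && (j < B))%N) => ijB; first by rewrite -(cE (i, j)).
rewrite big1 => [|a _]; last by rewrite scale0r.
by rewrite pB //; move: ijB; lia.
Qed.
Lemma ncoef_combine (f : Fr (size t)) B : (forall a, (msize (f a : S) <= B)%N) ->
  \sum_a (f a : S) *: (t`_a : N) =
  \sum_(i < B) \sum_(j < B) (varx k ^+ i * vary k ^+ j) *: (ncoef f i j : N).
Proof.
move=> fB.
under [RHS]eq_bigr => i _ do under eq_bigr => j _ do rewrite scaler_sumr.
under [RHS]eq_bigr => i _ do rewrite exchange_big.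
rewrite exchange_big; apply: eq_bigr => a _.
rewrite {1}(mpoly2E (fB a)) scaler_suml; apply: eq_bigr => i _.
rewrite scaler_suml; apply: eq_bigr => j _.
by rewrite restrE scalerA -mul_mpolyC; congr (_ *: _); exact: mulrC.
Qed.
Lemma ncoef_x f i j :
  ncoef (ffun_map (smul (l:=l) (varx k)) f) i j = delay (fun i => ncoef f i j) i.
Proof.
rewrite /ncoef; under eq_bigr => a _ do rewrite ffunE mcoeff_mulx.
by case: i => [|i] //=; apply: big1 => a _; rewrite scale0r.
Qed.
Lemma ncoef_y f i j :
  ncoef (ffun_map (smul (l:=l) (vary k)) f) i j = delay (ncoef f i) j.
Proof.
rewrite /ncoef; under eq_bigr => a _ do rewrite ffunE mcoeff_muly.
by case: j => [|j] //=; apply: big1 => a _; rewrite scale0r.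
Qed.
End One.

(** A matrix over k that represents [g] acts on coefficients through [g]; hence
    identities between such matrices can be checked in the modules, where they are
    evident. *)
Lemma ncoef_mact (N N' : lmodType S) (t : seq (Vk N)) (t' : seq (Vk N'))
    (g : {linear Vk N -> Vk N'}) (D : 'M[k]_(size t, size t')) (f : Fr (size t)) i j :
  (forall a : 'I_(size t), g t`_a = \sum_(b < size t') D a b *: t'`_b) ->
  ncoef (mact (vero_const k l) D f) i j = g (ncoef f i j).
Proof.
move=> gD; rewrite /ncoef linear_sum.
under [RHS]eq_bigr => a _ do rewrite linearZ_LR gD scaler_sumr.
rewrite exchange_big; apply: eq_bigr => b _; rewrite ffunE raddf_sum scaler_suml.
apply: eq_bigr => a _; rewrite scalerA; congr (_ *: _).
by rewrite -[X in X = _]/((const_emb k (D a b) * (f a : S))@_(mon i j)) mcoeffCM mulrC.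
Qed.

Lemma exists_matrix (N N' : lmodType S) (t : seq (Vk N)) (t' : seq (Vk N'))
    (g : Vk N -> Vk N') : (forall v, v \in t -> span t' (g v)) ->
  exists D : 'M[k]_(size t, size t'),
    forall a : 'I_(size t), g t`_a = \sum_(b < size t') D a b *: t'`_b.
Proof.
move=> gt.
have [c cE] := choice (fun a : 'I_(size t) => (span_tupleP _ _).1 (gt _ (mem_nth 0 (ltn_ord a)))).
by exists (\matrix_(a, b) c a b) => a; rewrite cE; apply: eq_bigr => b _; rewrite mxE.
Qed.
End Theta.

(** * Complexes of finitely generated modules over k[x,y] *)

Section CMapOps.
Variables (R : comNzRingType) (A B C : bcomplex R).
Section In.
Variables (f : cmap A C) (g : cmap B C).
Definition csum_in_fun i (z : csum A B i) : C i := f i z.1 + g i z.2.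
Lemma csum_in_linear i : linear (@csum_in_fun i).
Proof. by move=> a x y; rewrite /csum_in_fun /= !linearP scalerDr addrACA. Qed.
HB.instance Definition _ i := GRing.isLinear.Build R (csum A B i) (C i) _ (@csum_in_fun i) (@csum_in_linear i).
Lemma csum_in_cd i (z : csum A B i) : csum_in_fun (cd (csum A B) i z) = cd C i (csum_in_fun z).
Proof. by rewrite /csum_in_fun /= !cfun_cd linearD. Qed.
Definition csum_in : cmap (csum A B) C := @CMap R (csum A B) C (fun i => @csum_in_fun i) csum_in_cd.
End In.
Section Out.
Variables (f : cmap C A) (g : cmap C B).
Definition csum_out_fun i (z : C i) : csum A B i := (f i z, - g i z).
Lemma csum_out_linear i : linear (@csum_out_fun i).
Proof.
by move=> a x y; congr pair; rewrite !linearP //= opprD scalerN.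
Qed.
HB.instance Definition _ i := GRing.isLinear.Build R (C i) (csum A B i) _ (@csum_out_fun i) (@csum_out_linear i).
Lemma csum_out_cd i (z : C i) : csum_out_fun (cd C i z) = cd (csum A B) i (csum_out_fun z).
Proof. by congr pair; rewrite !cfun_cd //= linearN. Qed.
Definition csum_out : cmap C (csum A B) := @CMap R C (csum A B) (fun i => @csum_out_fun i) csum_out_cd.
End Out.
End CMapOps.

Section ResMap.
Variables (R S : comNzRingType) (phi : {rmorphism R -> S}) (N N' : lmodType S).
Variable f : {linear N -> N'}.
Definition restr_map (x : restr phi N) : restr phi N' := f x.
Lemma restr_map_linear : linear restr_map.
Proof. by move=> a x y; apply: (linearP f). Qed.
HB.instance Definition _ :=
  GRing.isLinear.Build R (restr phi N) (restr phi N') _ restr_map restr_map_linear.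
End ResMap.

Section Evaluation.
Variables (k : fieldType) (l : nat).
Local Notation R := (veronese k l).
Local Notation S := {mpoly k[2]}.
Local Notation Vk N := (restr (const_emb k) N).
Variables (N : lmodType S) (t : seq (Vk N)).
(** The evaluation map [k[x,y] (x) W -> N] for the span [W] of [t]. *)
Definition combine (f : {ffun 'I_(size t) -> polymod k l}) : restr (vero_emb k l) N :=
  \sum_(a < size t) (f a : S) *: (t`_a : N).
Lemma combine_linear : linear combine.
Proof.
move=> c f g; rewrite /combine -[RHS]/(vero_emb k l c *: (_ : N) + (_ : N)).
rewrite scaler_sumr -big_split; apply: eq_bigr => a _; rewrite !ffunE.
by rewrite -[_ + g a]/(vero_emb k l c * (f a : S) + (g a : S)) scalerDl scalerA.
Qed.
HB.instance Definition _ := GRing.isLinear.Build R {ffun 'I_(size t) -> polymod k l}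
  (restr (vero_emb k l) N) _ combine combine_linear.
Lemma combine_smul s f : combine (ffun_map (smul s) f) = s *: (combine f : N).
Proof.
rewrite /combine scaler_sumr; apply: eq_bigr => a _; rewrite ffunE.
by rewrite -[X in X *: _]/(s * (f a : S)) scalerA.
Qed.
Lemma combine_span (z : Vk N) : span t z -> exists f, (z : N) = combine f.
Proof.
move/span_tupleP => [c ->]; exists [ffun a => const_emb k (c a) : polymod k l].
by apply: eq_bigr => a _; rewrite ffunE.
Qed.
End Evaluation.

Lemma combine_mact (k : fieldType) (l : nat) (N N' : lmodType {mpoly k[2]})
    (t : seq (restr (const_emb k) N)) (t' : seq (restr (const_emb k) N'))
    (g : N -> N') (D : 'M[k]_(size t, size t')) (f : {ffun 'I_(size t) -> polymod k l}) :
  (forall a : 'I_(size t), g t`_a = \sum_(b < size t') D a b *: t'`_b) ->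
  combine (mact (vero_const k l) D f) = \sum_(a < size t) (f a : {mpoly k[2]}) *: g t`_a :> N'.
Proof.
move=> gD; under [RHS]eq_bigr => a _ do rewrite gD scaler_sumr.
rewrite exchange_big; apply: eq_bigr => b _; rewrite ffunE scaler_suml.
apply: eq_bigr => a _; rewrite restrE scalerA; congr (_ *: _).
exact: mulrC.
Qed.

(** [V i] is a finite generating set of [N i], and the differential is assumed to map
    it into [V (i + 1)], so that it preserves the box filtrations. *)
Section SComplex.
Variables (k : fieldType) (l : nat).
Local Notation R := (veronese k l).
Local Notation S := {mpoly k[2]}.
Local Notation Vk N := (restr (const_emb k) N).
Hypothesis fgS : fingen (polymod k l).
Variable N : int -> lmodType S.
Variable dN : forall i, {linear N i -> N (i + 1)}.
Hypothesis dNN : forall i x, dN (i + 1) (dN i x) = 0.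
Variable bd : nat.
Hypothesis bdN : forall i : int, (bd < `|i|)%N -> forall x : N i, x = 0.
Variable V : forall i, seq (N i).
Arguments V : clear implicits.
Hypothesis genV : forall i z, span (V i) z.
Hypothesis dV : forall i v, v \in V i -> dN i v \in V (i + 1).

Lemma restr_fingen (M : lmodType S) (s : seq M) :
  (forall z, span s z) -> fingen (restr (vero_emb k l) M).
Proof.
move=> gs.
apply: (@fingen_surj _ _ _ (@combine k l M (s : seq (Vk M)))) (fingen_power (size s) fgS) => z.
by have /span_tupleP [c ->] := gs z; exists [ffun a => c a : polymod k l];
   apply: eq_bigr => a _; rewrite ffunE.
Qed.

Lemma scomplex_dd i (x : restr (vero_emb k l) (N i)) :
  restr_map (phi := vero_emb k l) (dN (i + 1)) (restr_map (phi := vero_emb k l) (dN i) x) = 0.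
Proof. exact: dNN. Qed.
Lemma scomplex_bd : exists B : nat,
  forall i : int, (B < `|i|)%N -> forall x : restr (vero_emb k l) (N i), x = 0.
Proof. by exists bd => i /bdN. Qed.
Definition scomplex : bcomplex R :=
  BComplex scomplex_dd (fun i => restr_fingen (@genV i)) scomplex_bd.

Lemma boxspan_dN i n m z : boxspan (V i) n m z -> boxspan (V (i + 1)) n m (dN i z).
Proof.
have mapiter s r (q : seq (N i)) : map (dN i) (iter r (stepl s) q) = iter r (stepl s) (map (dN i) q).
  elim: r => //= r <-; rewrite /stepl map_cat -!map_comp; congr (_ ++ _).
  by apply: eq_map => v /=; rewrite linearZ.
move=> Wz.
have H : span (map (restr_map (phi := const_emb k) (dN i)) (box (V i) n m : seq (Vk (N i))))
     (restr_map (phi := const_emb k) (dN i) z) by apply/span_map; exists z.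
apply: span_sub H => v vs; apply: (@mem_span _ (Vk (N (i + 1)))).
have {}vs : v \in map (dN i) (box (V i) n m) by [].
move: vs; rewrite /box /ylist !mapiter; apply: box_sub.
have : {subset [seq dN i j | j <- V i] <= V (i + 1)}.
  by move=> u /mapP [w wV ->]; apply: dV.
by elim: n {Wz} => // n IH sub; apply: stepl_sub; apply: IH.
Qed.

Record basis n m := Basis {
  bs : forall i, seq (Vk (N i));
  bs_free : forall i, free (bs i);
  bs_span : forall i z, span (bs i) z <-> boxspan (V i) n m z;
  bs_D : forall i, 'M[k]_(size (bs i), size (bs (i + 1)));
  bs_DE : forall i (a : 'I_(size (bs i))),
    dN i (bs i)`_a = \sum_(b < size (bs (i + 1))) bs_D i a b *: (bs (i + 1))`_b
}.

Lemma exists_basis_of n m : exists b : basis n m, True.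
Proof.
pose Q (i : int) (t : seq (Vk (N i))) := free t /\ (forall z, span t z <-> boxspan (V i) n m z).
have exQ i : exists t, Q i t by exact: exists_basis (box (V i) n m : seq (Vk (N i))).
have [t tP] : exists t : forall i, seq (Vk (N i)), forall i, Q i (t i).
  by exists (fun i => sval (cid (exQ i))) => i; exact: (svalP (cid (exQ i))).
have exD i : exists D : 'M[k]_(size (t i), size (t (i + 1))),
   forall a : 'I_(size (t i)), dN i (t i)`_a = \sum_(b < size (t (i + 1))) D a b *: (t (i + 1))`_b.
  apply: (@exists_matrix _ _ _ _ _ (dN i)) => v vt.
  by apply/(tP _).2/boxspan_dN/(tP _).2/mem_span.
exists (@Basis n m t (fun i => (tP i).1) (fun i => (tP i).2)
  (fun i => sval (cid (exD i))) (fun i => svalP (cid (exD i)))) => //.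
Qed.

Section BasisCell.
Variables (n m : nat) (b : basis n m).

Lemma bs_DD i : bs_D b i *m bs_D b (i + 1) = 0.
Proof.
apply/matrixP => a c; rewrite [RHS]mxE.
apply: (free_inj (c := fun c => (bs_D b i *m bs_D b (i + 1)) a c) (bs_free b (i + 1 + 1))).
rewrite -[RHS](dNN (bs b i)`_a) bs_DE.
have dL (e : 'I_(size (bs b (i + 1))) -> k) :
    dN (i + 1) (\sum_(j < size (bs b (i + 1))) e j *: (bs b (i + 1))`_j : Vk (N (i + 1))) =
    \sum_(j < size (bs b (i + 1))) e j *: (dN (i + 1) (bs b (i + 1))`_j : Vk (N (i + 1 + 1))).
  by rewrite linear_sum; apply: eq_bigr => j _; rewrite linearZ.
rewrite dL; under [RHS]eq_bigr => j _ do rewrite bs_DE scaler_sumr.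
rewrite exchange_big; apply: eq_bigr => c' _; rewrite mxE scaler_suml.
by apply: eq_bigr => j _; rewrite scalerA.
Qed.

Lemma bs_bd : exists B : nat, forall i : int, (B < `|i|)%N -> size (bs b i) = 0%N.
Proof.
exists bd => i iB; apply: (free_trivial (bs_free b i)); exact: bdN.
Qed.

Definition basis_complex : scalar_complex k :=
  @ScalarComplex k (fun i => size (bs b i)) (bs_D b) bs_DD bs_bd.
Definition basis_cell : bcomplex R := cell (vero_const k l) basis_complex fgS.

Lemma combine_cd i (f : basis_cell i) :
  combine (cd basis_cell i f : {ffun 'I_(size (bs b (i + 1))) -> polymod k l}) = restr_map (phi := vero_emb k l) (dN i) (combine f).
Proof.
rewrite [LHS](combine_mact _ (@bs_DE _ _ b i)) /restr_map /combine linear_sum.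
by apply: eq_bigr => a _; rewrite linearZ.
Qed.
Definition combine_map : cmap basis_cell scomplex :=
  @CMap R basis_cell scomplex (fun i => @combine k l (N i) (bs b i)) combine_cd.

Lemma ncoef_cd i (f : basis_cell i) i' j' :
  ncoef (cd basis_cell i f : {ffun 'I_(size (bs b (i + 1))) -> polymod k l}) i' j' =
  dN i (ncoef (f : {ffun 'I_(size (bs b i)) -> polymod k l}) i' j').
Proof. exact: (ncoef_mact (g := restr_map (phi := const_emb k) (dN i)) _ _ _ (@bs_DE _ _ b i)). Qed.

Lemma combine_map_surj i z : (forall v, v \in V i -> boxspan (V i) n m v) -> exists f, z = combine_map i f.
Proof.
move=> VW.
have : forall s : seq (N i), {subset s <= V i} -> forall z, span s z -> exists f, z = combine_map i f.
  elim=> [_ _ ->|v s IH sV w [c]].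
    by exists 0; rewrite linear0.
  have ss : {subset s <= V i} by move=> u us; apply: sV; rewrite inE us orbT.
  move=> /(IH ss) [f fE].
  have [|g gE] := @combine_span k l (N i) (bs b i) v.
    by apply/bs_span/VW/sV; rewrite inE eqxx.
  exists (f + ffun_map (smul c) g).
  by rewrite linearD -fE [X in _ + X]combine_smul -gE subrK.
by apply; [|exact: (@genV i z)].
Qed.
End BasisCell.

Definition dvar (dir : bool) : S := if dir then varx k else vary k.
Definition delay_dir (T : zmodType) (dir : bool) (p : nat -> nat -> T) i j : T :=
  if dir then delay (fun i => p i j) i else delay (p i) j.
(** A common notation for [dx] and [dy], selected by the direction [dir]. *)
Definition ddir (T : lmodType S) dir (p : nat -> nat -> T) i j : T :=
  delay_dir dir p i j - dvar dir *: p i j.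

Lemma ncoef_dir dir (M : lmodType S) (t : seq (Vk M)) (f : {ffun 'I_(size t) -> polymod k l}) i j :
  ncoef (ffun_map (smul (l:=l) (dvar dir)) f) i j = delay_dir dir (ncoef f) i j.
Proof. by case: dir; rewrite /dvar /delay_dir ?ncoef_x ?ncoef_y. Qed.

Lemma delay_dir_map (T T' : zmodType) (g : T -> T') dir p i j :
  g 0 = 0 -> g (delay_dir dir p i j) = delay_dir dir (fun i j => g (p i j)) i j.
Proof. by move=> g0; case: dir i j => -[|i] [|j] /=. Qed.
Lemma delay_dir_ext (T : zmodType) dir (p p' : nat -> nat -> T) i j :
  (forall i j, p i j = p' i j) -> delay_dir dir p i j = delay_dir dir p' i j.
Proof. by move=> pp; case: dir i j => -[|i] [|j] /=. Qed.

Lemma ddir_ext (T : lmodType S) dir (p p' : nat -> nat -> T) i j :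
  (forall i j, p i j = p' i j) -> ddir dir p i j = ddir dir p' i j.
Proof. by move=> pp; rewrite /ddir (delay_dir_ext _ _ _ pp) pp. Qed.
Lemma ddirN (T : lmodType S) dir (p : nat -> nat -> T) i j :
  ddir dir (fun i j => - p i j) i j = - ddir dir p i j.
Proof.
rewrite /ddir scalerN opprB addrC; congr (_ + _); rewrite ?opprK //.
by rewrite (delay_dir_map (g := -%R)) ?oppr0.
Qed.

Section Shifted.
Variables (n m n' m' : nat) (b : basis n m) (b' : basis n' m') (dir : bool).
Let s := dvar dir.
Hypothesis Wi : forall i z, boxspan (V i) n m z -> boxspan (V i) n' m' z.
Hypothesis Ws : forall i z, boxspan (V i) n m z -> boxspan (V i) n' m' (s *: z).

(** The map [s (x) 1 - 1 (x) s] between two cells, for [s] one of the variables. On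
    coefficients it is [dx] or [dy], and it is killed by the evaluation to [N]. *)
Lemma exists_shift : exists F : cmap (basis_cell b) (basis_cell b'),
  (forall i (f : basis_cell b i) i' j',
    ncoef (F i f : {ffun 'I_(size (bs b' i)) -> polymod k l}) i' j' =
    ddir dir (ncoef (f : {ffun 'I_(size (bs b i)) -> polymod k l})) i' j') /\
  (forall i f, combine_map b' i (F i f) = 0).
Proof.
have exJ i : exists D : 'M[k]_(size (bs b i), size (bs b' i)),
   forall a : 'I_(size (bs b i)), idfun (bs b i)`_a = \sum_(c < size (bs b' i)) D a c *: (bs b' i)`_c.
  apply: (@exists_matrix _ _ _ _ _ idfun) => v vt.
  by apply/(bs_span b'); apply: Wi; apply/(bs_span b); apply: mem_span.
have exY i : exists D : 'M[k]_(size (bs b i), size (bs b' i)),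
   forall a : 'I_(size (bs b i)), scale_by (phi := const_emb k) s (bs b i)`_a = \sum_(c < size (bs b' i)) D a c *: (bs b' i)`_c.
  apply: (@exists_matrix _ _ _ _ _ (scale_by (phi := const_emb k) s)) => v vt.
  by apply/(bs_span b'); apply: Ws; apply/(bs_span b); apply: mem_span.
pose J i := sval (cid (exJ i)); pose Y i := sval (cid (exY i)).
have JP i := svalP (cid (exJ i)); have YP i := svalP (cid (exY i)).
pose F i : {linear basis_cell b i -> basis_cell b' i} :=
  (ffun_map (smul (l:=l) s) (r := size (bs b' i)) \o mact (vero_const k l) (J i)) \- mact (vero_const k l) (Y i).
have thF i (f : basis_cell b i) i' j' :
    ncoef (F i f : {ffun 'I_(size (bs b' i)) -> polymod k l}) i' j' =
    ddir dir (ncoef (f : {ffun 'I_(size (bs b i)) -> polymod k l}) : nat -> nat -> N i) i' j'.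
  rewrite /F /= ncoefB /ddir; congr (_ - _).
    rewrite ncoef_dir; apply: delay_dir_ext => i1 j1.
    exact: (ncoef_mact (g := idfun) _ _ _ (JP i)).
  exact: (ncoef_mact (g := scale_by (phi := const_emb k) s) _ _ _ (YP i)).
have Fcd i (x : basis_cell b i) : F (i + 1) (cd (basis_cell b) i x) = cd (basis_cell b') i (F i x).
  apply: (ncoef_eq (bs_free b' (i + 1))) => i' j'.
  rewrite thF [RHS](ncoef_cd (b := b')) thF /ddir linearB; congr (_ - _).
    rewrite (delay_dir_map (g := dN i)) ?linear0 //.
    by apply: delay_dir_ext => i1 j1; rewrite (ncoef_cd (b := b)).
  by rewrite (ncoef_cd (b := b)) [RHS]linearZ.
exists (@CMap R (basis_cell b) (basis_cell b') F Fcd); split=> // i f.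
rewrite /= linearB; apply/eqP; rewrite subr_eq0; apply/eqP.
rewrite [LHS]combine_smul [in LHS](combine_mact f (JP i)) [RHS](combine_mact f (YP i)) scaler_sumr.
by apply: eq_bigr => a _; rewrite !scalerA mulrC.
Qed.
End Shifted.

(** Only finitely many degrees matter, so bounds for each degree have a common
    bound. *)
Lemma uniform_bound (Q : int -> nat -> Prop) :
  (forall i, exists n0, forall n, (n0 <= n)%N -> Q i n) ->
  (forall i, (bd < `|i|)%N -> forall n, Q i n) ->
  exists n, forall n', (n <= n')%N -> forall i, Q i n'.
Proof.
move=> exQ bQ; have [f fP] := choice exQ.
exists (\max_(j < bd.+1) maxn (f (Posz j)) (f (- Posz j))) => n fn i.
case: (ltnP bd `|i|) => iB; first exact: bQ.
apply: fP; apply: leq_trans fn.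
have ib : (`|i| < bd.+1)%N by [].
apply: leq_trans (leq_bigmax (F := fun j : 'I_bd.+1 => maxn (f (Posz j)) (f (- Posz j))) (Ordinal ib)).
rewrite leq_max /=; apply/orP; case: (i) => a; [left|right] => /=; exact: leqnn.
Qed.

Lemma regular_trivial i n m : (forall x : N i, x = 0) -> regular (V i) n m.
Proof.
by move=> N0; split=> ? _ z _ _; rewrite (N0 z); apply: span0.
Qed.

Lemma exists_regular : exists n m, forall i, regular (V i) n m.
Proof.
have [n nP] := @uniform_bound
  (fun i n => exists m0, forall m, (m0 <= m)%N -> regular (V i) n m)
  (fun i => eventually_regular (V i))
  (fun i iB n => ex_intro _ 0%N (fun m _ => regular_trivial n m (bdN iB))).
have [m mP] := @uniform_bound (fun i m => regular (V i) n m) (nP n (leqnn n))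
  (fun i iB m => regular_trivial n m (bdN iB)).
by exists n, m; apply: mP.
Qed.

Variable G : bcomplex R.
Hypothesis mrS : mresolved (thick1 G) (polymod k l).

(** For [n] and [m] large the evaluation of [k[x,y] (x) W_(n+1,m+1)] has the Koszul
    resolution by the cells of [W_(n+1,m)], [W_(n,m+1)] and [W_(n,m)], where [W_(n,m)] is
    the complex of the spaces [boxspan (V i) n m]. *)
Lemma thick_scomplex : thick 7%N G scomplex.
Proof.
have [n [m reg]] := exists_regular.
have [b00 _] := exists_basis_of n m.
have [b01 _] := exists_basis_of n m.+1.
have [b10 _] := exists_basis_of n.+1 m.
have [b11 _] := exists_basis_of n.+1 m.+1.
have [Fy [Fy_th Fy_ev]] := exists_shift b01 b11 (dir := false)
  (fun i z => @boxspan_nS k (N i) (V i) n m.+1 z) (fun i z => @boxspan_y k (N i) (V i) n m.+1 z).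
have [Fx [Fx_th Fx_ev]] := exists_shift b10 b11 (dir := true)
  (fun i z => @boxspan_mS k (N i) (V i) n.+1 m z) (fun i z => @boxspan_x k (N i) (V i) n.+1 m z).
have [Gx [Gx_th Gx_ev]] := exists_shift b00 b01 (dir := true)
  (fun i z => @boxspan_mS k (N i) (V i) n m z) (fun i z => @boxspan_x k (N i) (V i) n m z).
have [Gy [Gy_th Gy_ev]] := exists_shift b00 b10 (dir := false)
  (fun i z => @boxspan_nS k (N i) (V i) n m z) (fun i z => @boxspan_y k (N i) (V i) n m z).
pose th n m (b : basis n m) i (f : basis_cell b i) : nat -> nat -> N i :=
  ncoef (f : {ffun 'I_(size (bs b i)) -> polymod k l}).
have thW n' m' (b : basis n' m') i f : valued (V i) n' m' (@th n' m' b i f).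
  by move=> i' j'; apply/(bs_span b)/ncoef_span.
have thB n' m' (b : basis n' m') i f : exists B, bounded B (@th n' m' b i f).
  exact: ncoef_bounded.
have thS n' m' (b : basis n' m') i p B : valued (V i) n' m' p -> bounded B p ->
    exists f, forall i' j', @th n' m' b i f i' j' = p i' j'.
  move=> Wp pB.
  have [f fE] := @ncoef_surj k l (N i) (bs b i) p B pB (fun i' j' => (bs_span b _).2 (Wp i' j')).
  by exists f.
have thI n' m' (b : basis n' m') i f g :
    (forall i' j', @th n' m' b i f i' j' = @th n' m' b i g i' j') -> f = g.
  exact: ncoef_eq (bs_free b i).
have thI0 n' m' (b : basis n' m') i f :
    (forall i' j', @th n' m' b i f i' j' = 0) -> f = 0.
  exact: ncoef_inj (bs_free b i).
have bW B B' i (p : nat -> nat -> N i) : (B <= B')%N -> bounded B p -> bounded B' p.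
  by move=> BB pB i' j' H; apply: pB; move: H; lia.
have dxE i (p : nat -> nat -> N i) i' j' : ddir true p i' j' = dx p i' j' by [].
have dyE i (p : nat -> nat -> N i) i' j' : ddir false p i' j' = dy p i' j' by [].
have Fyx i (f : basis_cell b01 i) (g : basis_cell b10 i) i' j' :
    th _ _ b11 i (Fy i f + Fx i g) i' j' =
    dy (th _ _ b01 i f) i' j' + dx (th _ _ b10 i g) i' j'.
  by rewrite /th [LHS]ncoefD Fy_th Fx_th.
have Gx_dx i (f : basis_cell b00 i) i' j' : th _ _ b01 i (Gx i f) i' j' = dx (th _ _ b00 i f) i' j'.
  exact: Gx_th.
have Gy_dy i (f : basis_cell b00 i) i' j' : th _ _ b10 i (Gy i f) i' j' = dy (th _ _ b00 i f) i' j'.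
  exact: Gy_th.
have thN n' m' (b : basis n' m') i (f : basis_cell b i) i' j' :
    th n' m' b i (- f) i' j' = - th n' m' b i f i' j'.
  exact: ncoefN.
apply: (@thick_length2 _ _ (vero_const k l) (polymod k l) fgS G scomplex
  (basis_complex b00) (basis_complex b01) (basis_complex b10) (basis_complex b11) (csum_out Gx Gy) (csum_in Fy Fx) (combine_map b11)) => //.
- move=> i f [Gf _]; apply: thI0.
  have [B fB] := thB _ _ _ i f.
  by apply: (dx_inj fB) => i' j'; rewrite -Gx_dx Gf; exact: ncoef0.
- move=> i f; apply: thI0 => i' j'; rewrite [LHS]Fyx -dyE -dxE.
  have -> : ddir false (th _ _ b01 i (Gx i f)) i' j' = dy (dx (th _ _ b00 i f)) i' j'.
    by apply: (@ddir_ext _ false) => i1 j1; rewrite Gx_dx.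
  have -> : ddir true (th _ _ b10 i (- Gy i f)) i' j' = - dx (dy (th _ _ b00 i f)) i' j'.
    by rewrite -dxE -ddirN; apply: (@ddir_ext _ true) => i1 j1; rewrite thN Gy_dy.
  by rewrite dxdy subrr.
- move=> i [f g] fg0.
  have [B fB] := thB _ _ _ i f; have [B' gB] := thB _ _ _ i g.
  have [|u [Wu uB uf ug]] := exact_left (reg i) (thW _ _ _ i f) (thW _ _ _ i g)
    (bW _ _ _ _ (leq_maxl B B') fB) (bW _ _ _ _ (leq_maxr B B') gB).
    by move=> i' j'; rewrite -Fyx [X in th _ _ _ _ X]fg0; exact: ncoef0.
  have [h hE] := thS _ _ b00 i u _ Wu uB.
  exists h; congr pair; apply: thI => i' j'.
    by rewrite uf Gx_dx; apply: (@ddir_ext _ true) => i1 j1; rewrite hE.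
  rewrite ug thN Gy_dy; congr (- _).
  by apply: (@ddir_ext _ false) => i1 j1; rewrite hE.
- move=> i [f g]; rewrite [X in combine_map _ _ X](_ : _ = Fy i f + Fx i g) // linearD.
  by rewrite (Fy_ev i f) (Fx_ev i g) addr0.
- move=> i f f0.
  have [B fB] := thB _ _ _ i f.
  pose D := maxn B (\max_(a < size (bs b11 i)) msize ((f : {ffun 'I_(size (bs b11 i)) -> polymod k l}) a : S)).
  have fD : bounded D (th _ _ b11 i f) by apply: bW fB; apply: leq_maxl.
  have [|q [r [B' [Wq Wr qB rB E]]]] := exact_middle (reg i) (thW _ _ _ i f) fD.
    rewrite -[RHS]f0; apply/esym/ncoef_combine => a.
    apply: leq_trans (leq_maxr _ _).
    exact: (leq_bigmax (F := fun a => msize ((f : {ffun 'I_(size (bs b11 i)) -> polymod k l}) a : S))).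
  have [f1 f1E] := thS _ _ b01 i q _ Wq qB.
  have [g1 g1E] := thS _ _ b10 i r _ Wr rB.
  exists (f1, g1); apply: thI => i' j'; rewrite [RHS]Fyx E.
  congr (_ + _); first by apply: (@ddir_ext _ false) => i1 j1; rewrite f1E.
  by apply: (@ddir_ext _ true) => i1 j1; rewrite g1E.
- move=> i z; apply: combine_map_surj => v vV.
  have Wv n' m' : boxspan (V i) n' m' v.
    elim: n' => [|n' IH]; last exact: boxspan_nS.
    elim: m' => [|m' IH]; last exact: boxspan_mS.
    exact: (@mem_span _ (Vk (N i))).
  exact: Wv.
Qed.
End SComplex.

(** * Every complex is a retract of a complex over k[x,y] *)

(** The predicates are bundled with their closure properties so that the module
    structure of the quotient can be inferred from the predicate. *)
Record submodule (S : comNzRingType) (M : lmodType S) := Submodule {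
  smem :> M -> Prop;
  smem0 : smem 0;
  smemL : forall a x y, smem x -> smem y -> smem (a *: x + y)
}.

Section Quotient.
Variables (S : comNzRingType) (M : lmodType S) (Q : submodule M).
Let Q0 := smem0 Q.
Let QL := @smemL _ _ Q.

Lemma smemD x y : Q x -> Q y -> Q (x + y).
Proof. by move=> Qx Qy; rewrite -[x]scale1r; apply: QL. Qed.
Lemma smemZ a x : Q x -> Q (a *: x).
Proof. by move=> Qx; rewrite -[_ *: _]addr0; apply: QL. Qed.
Lemma smemN x : Q x -> Q (- x).
Proof. by move=> Qx; rewrite -scaleN1r; apply: smemZ. Qed.
Lemma smem_sym x y : Q (x - y) -> Q (y - x).
Proof. by move=> /smemN; rewrite opprB. Qed.

Definition rep (v : M) : M := choose (fun w => `[< Q (v - w) >]) v.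
Lemma repP v : Q (v - rep v).
Proof.
by apply/asboolP/(@chooseP _ (fun w => `[< Q (v - w) >])); apply/asboolP; rewrite subrr.
Qed.
Lemma rep_eq v w : Q (v - w) -> rep v = rep w.
Proof.
move=> Qvw; have E : (fun u => `[< Q (v - u) >]) =1 (fun u => `[< Q (w - u) >]).
  move=> u; apply/asboolP/asboolP => H.
    by rewrite -[w - u](subrKA v) addrC; apply: smemD => //; apply: smem_sym.
  by rewrite -[v - u](subrKA w); apply: smemD.
rewrite /rep (eq_choose E); apply: choose_id; apply/asboolP; rewrite ?subrr //.
exact: smem_sym.
Qed.
Lemma rep_id v : rep (rep v) = rep v.
Proof. by apply/esym/rep_eq/repP. Qed.

(** The quotient consists of the chosen representatives of the cosets. *)
Record quot := Quot { qv :> M; _ : rep qv == qv }.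
HB.instance Definition _ := [isSub for qv].
HB.instance Definition _ := [Choice of quot by <:].
Lemma qpi_proof v : rep (rep v) == rep v. Proof. by rewrite rep_id. Qed.
Definition qpi (v : M) : quot := Quot (qpi_proof v).
Lemma qpi_eq v w : Q (v - w) -> qpi v = qpi w.
Proof. by move=> H; apply: val_inj; apply: rep_eq. Qed.
Lemma qpiK (x : quot) : qpi (qv x) = x.
Proof. by apply: val_inj; apply/eqP; exact: (valP x). Qed.
Lemma qvK v : Q (qv (qpi v) - v). Proof. exact/smem_sym/repP. Qed.

Definition qadd (x y : quot) : quot := qpi (qv x + qv y).
Definition qopp (x : quot) : quot := qpi (- qv x).
Lemma qaddE v w : qadd (qpi v) (qpi w) = qpi (v + w).
Proof. by apply: qpi_eq; rewrite opprD addrACA; apply: smemD; apply: qvK. Qed.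
Lemma qaddA : associative qadd.
Proof.
move=> x y z; rewrite -[x]qpiK -[y]qpiK -[z]qpiK !qaddE; congr qpi; exact: addrA.
Qed.
Lemma qaddC : commutative qadd.
Proof. by move=> x y; rewrite /qadd addrC. Qed.
Lemma qadd0 : left_id (qpi 0) qadd.
Proof. by move=> x; rewrite -[x]qpiK qaddE add0r. Qed.
Lemma qaddN : left_inverse (qpi 0) qopp qadd.
Proof. by move=> x; rewrite -{2}[x]qpiK qaddE addNr. Qed.
HB.instance Definition _ := GRing.isZmodule.Build quot qaddA qaddC qadd0 qaddN.

Definition qscale a (x : quot) : quot := qpi (a *: qv x).
Lemma qscaleE a v : qscale a (qpi v) = qpi (a *: v).
Proof. by apply: qpi_eq; rewrite -scalerBr; apply/smemZ/qvK. Qed.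
Lemma qpiD v w : qpi (v + w) = qpi v + qpi w. Proof. exact: (esym (qaddE v w)). Qed.
Lemma qscaleA a b x : qscale a (qscale b x) = qscale (a * b) x.
Proof. by rewrite -[x]qpiK !qscaleE scalerA. Qed.
Lemma qscale1 : left_id 1 qscale.
Proof. by move=> x; rewrite -[x]qpiK qscaleE scale1r. Qed.
Lemma qscaleDr : right_distributive qscale +%R.
Proof. by move=> a x y; rewrite -[x]qpiK -[y]qpiK -qpiD !qscaleE scalerDr qpiD. Qed.
Lemma qscaleDl x : {morph qscale^~ x : a b / a + b}.
Proof. by move=> a b; rewrite -[x]qpiK !qscaleE scalerDl qpiD. Qed.
HB.instance Definition _ :=
  GRing.Zmodule_isLmodule.Build S quot qscaleA qscale1 qscaleDr qscaleDl.
Lemma qpi_linear : linear qpi.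
Proof. by move=> a x y; rewrite qpiD; congr (_ + _); exact: (esym (qscaleE a x)). Qed.
HB.instance Definition _ := GRing.isLinear.Build S M quot _ qpi qpi_linear.
Lemma qpi0 v : Q v -> qpi v = 0.
Proof. by move=> Qv; rewrite -[RHS](linear0 qpi); apply: qpi_eq; rewrite subr0. Qed.
Lemma qvL a (x y : quot) : Q (qv (a *: x + y) - (a *: qv x + qv y)).
Proof. by rewrite -{1}[x]qpiK -{1}[y]qpiK -linearP; apply: qvK. Qed.
End Quotient.

Section ToR.
Variables (k : fieldType) (l : nat).
Local Notation R := (veronese k l).
Local Notation S := {mpoly k[2]}.
Lemma toR_mem (s : S) : deg_proj l (pred1 0%N) s \in @veronese_pred k l.
Proof.
apply/allP => m; rewrite mcoeff_msupp deg_projE /= /dvdn.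
by case: ifP => // _; rewrite eqxx.
Qed.
(** The retraction of k[x,y] onto the Veronese ring, linear over that ring. *)
Definition toR (s : S) : R := Veronese (toR_mem s).
Lemma toRD s t : toR (s + t) = toR s + toR t.
Proof. by apply: val_inj; exact: deg_projD. Qed.
Lemma toRM (r : R) s : toR (vero_emb k l r * s) = r * toR s.
Proof. by apply: val_inj; exact: deg_projM. Qed.
Lemma toRK (r : R) : toR (vero_emb k l r) = r.
Proof.
apply: val_inj; apply: deg_proj_id; apply/deg_modP => m; rewrite -mcoeff_msupp => mr.
exact: (allP (valP r) m mr).
Qed.
Lemma toR0 : toR 0 = 0.
Proof. by rewrite -(rmorph0 (vero_emb k l)) toRK. Qed.
End ToR.

Section Tensor.
Variables (k : fieldType) (l : nat).
Local Notation R := (veronese k l).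
Local Notation S := {mpoly k[2]}.
Local Notation phi := (vero_emb k l).

Section Module.
Variables (M : lmodType R) (r : nat) (e : 'I_r -> M).
Definition comb (c : 'I_r -> R) : M := \sum_a c a *: e a.
Definition ebase (c : 'I_r -> R) : {ffun 'I_r -> S^o} := [ffun a => phi (c a)].
(** If [e] generates [M] then [M (x)_R S] is the free S-module on the generators modulo
    the S-span of the relations of [M]. *)
Inductive trel : {ffun 'I_r -> S^o} -> Prop :=
| trel0 : trel 0
| trelD s c f : comb c = 0 -> trel f -> trel (s *: ebase c + f).
Lemma trel_add f g : trel f -> trel g -> trel (f + g).
Proof.
elim=> [|s c f' c0 _ IH] Tg; first by rewrite add0r.
by rewrite -addrA; apply: trelD => //; apply: IH.
Qed.
Lemma trelL a f g : trel f -> trel g -> trel (a *: f + g).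
Proof.
move=> Tf Tg; apply: trel_add Tg; elim: Tf => [|s c f' c0 _ IH].
  by rewrite scaler0; apply: trel0.
by rewrite scalerDr scalerA; apply: trelD.
Qed.
Lemma trel_sum (I : finType) (F : I -> {ffun 'I_r -> S^o}) :
  (forall i, trel (F i)) -> trel (\sum_i F i).
Proof. by move=> TF; elim/big_ind: _ => //; [exact: trel0|exact: trel_add]. Qed.
Lemma trel_ebase s c : comb c = 0 -> trel (s *: ebase c).
Proof. by move=> c0; rewrite -[_ *: _]addr0; apply: trelD => //; apply: trel0. Qed.
Definition trels : submodule {ffun 'I_r -> S^o} := Submodule trel0 trelL.
Definition tens : lmodType S := quot trels.
(** The map [M (x)_R S -> M] induced by [toR]; it splits [M -> M (x)_R S]. *)
Definition tproj (f : {ffun 'I_r -> S^o}) : M := comb (fun a => toR l (f a)).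
Lemma tprojD f g : tproj (f + g) = tproj f + tproj g.
Proof.
by rewrite /tproj /comb -big_split; apply: eq_bigr => a _; rewrite ffunE toRD scalerDl.
Qed.
Lemma tprojZ (c : R) f : tproj (phi c *: f) = c *: tproj f.
Proof.
rewrite /tproj /comb scaler_sumr; apply: eq_bigr => a _.
by rewrite ffunE -[X in toR _ X]/(phi c * (f a : S)) toRM scalerA.
Qed.
Lemma tproj_rel f : trel f -> tproj f = 0.
Proof.
elim=> [|s c f' c0 _ IH].
  by rewrite /tproj /comb big1 // => a _; rewrite ffunE toR0 scale0r.
rewrite tprojD IH addr0 /tproj -[RHS](scaler0 _ (toR l s)) -c0 /comb scaler_sumr.
apply: eq_bigr => a _; rewrite !ffunE -[X in toR _ X]/(s * phi (c a)) mulrC toRM.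
by rewrite mulrC scalerA.
Qed.
Lemma tproj_ebase c : tproj (ebase c) = comb c.
Proof. by rewrite /tproj /comb; apply: eq_bigr => a _; rewrite ffunE toRK. Qed.
Lemma tproj_eq f g : trel (f - g) -> tproj f = tproj g.
Proof.
move/tproj_rel => E; rewrite -[f](subrK g) tprojD E add0r //.
Qed.
Lemma tens_delta (f : {ffun 'I_r -> S^o}) : f = \sum_a f a *: ebase (fun b => (b == a)%:R).
Proof.
apply/ffunP => b; rewrite sum_ffunE (bigD1 b) //= big1 => [|a /negPf ab].
  by rewrite !ffunE eqxx rmorph1 addr0 -[RHS]/(f b * 1) mulr1.
rewrite !ffunE eq_sym ab rmorph0; exact: scaler0.
Qed.

Lemma tens_gen (z : tens) :
  span (codom (fun a => qpi trels (ebase (fun b => (b == a)%:R : R)))) z.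
Proof.
rewrite -[z]qpiK [qv z]tens_delta linear_sum.
by apply: span_sum => a _; rewrite linearZ; apply/spanZ/mem_span/codom_f.
Qed.
End Module.

Section TensorMap.
Variables (M M' : lmodType R) (r r' : nat) (e : 'I_r -> M) (e' : 'I_r' -> M').
Variables (d : {linear M -> M'}) (D : 'I_r -> 'I_r' -> R).
Hypothesis dD : forall a, d (e a) = comb e' (D a).
(** The map of free modules that lifts [d (x) 1], given by coordinates [D] of the
    images of the generators. *)
Definition hmap (f : {ffun 'I_r -> S^o}) : {ffun 'I_r' -> S^o} :=
  \sum_a f a *: ebase (D a).
Lemma hmap_linear : linear hmap.
Proof.
move=> c f g; rewrite /hmap scaler_sumr -big_split; apply: eq_bigr => a _.
by rewrite !ffunE scalerDl scalerA.
Qed.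
HB.instance Definition _ := GRing.isLinear.Build S {ffun 'I_r -> S^o} {ffun 'I_r' -> S^o} _
  hmap hmap_linear.
Lemma comb_map c : d (comb e c) = comb e' (fun b => \sum_a c a * D a b).
Proof.
rewrite /comb linear_sum; under [RHS]eq_bigr => b _ do rewrite scaler_suml.
rewrite exchange_big; apply: eq_bigr => a _; rewrite linearZ_LR dD /comb scaler_sumr.
by apply: eq_bigr => b _; rewrite scalerA.
Qed.
Lemma hmap_ebase c : hmap (ebase c) = ebase (fun b => \sum_a c a * D a b).
Proof.
apply/ffunP => b; rewrite sum_ffunE !ffunE rmorph_sum; apply: eq_bigr => a _.
by rewrite !ffunE rmorphM.
Qed.
Lemma hmap_rel f : trel e f -> trel e' (hmap f).
Proof.
elim=> [|s c g c0 _ IH]; first by rewrite linear0; apply: trel0.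
rewrite hmap_linear hmap_ebase; apply: trelD => //.
by rewrite -comb_map c0 linear0.
Qed.
Definition tmap (x : tens e) : tens e' := qpi (trels e') (hmap (qv x)).
Lemma tmapE f : tmap (qpi (trels e) f) = qpi (trels e') (hmap f).
Proof.
apply: qpi_eq; rewrite -linearB; apply: hmap_rel.
exact: (qvK (trels e) f).
Qed.
Lemma tmap_linear : linear tmap.
Proof. by move=> c x y; rewrite -[x]qpiK -[y]qpiK -linearP !tmapE !linearP. Qed.
Definition tmapl : {linear tens e -> tens e'} :=
  HB.pack tmap (GRing.isLinear.Build S (tens e) (tens e') _ tmap tmap_linear).
Lemma tmaplE f : tmapl (qpi (trels e) f) = qpi (trels e') (hmap f).
Proof. exact: tmapE. Qed.
Lemma tmapl_qv x : tmapl x = qpi (trels e') (hmap (qv x)).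
Proof. by []. Qed.
Lemma tproj_hmap f : tproj e' (hmap f) = d (tproj e f).
Proof.
rewrite {1}/hmap.
have -> : tproj e' (\sum_a f a *: ebase (D a)) = \sum_a tproj e' (f a *: ebase (D a)).
  apply: (big_morph (tproj e')); last by apply: tproj_rel; apply: trel0.
  by move=> f1 f2; apply: tprojD.
rewrite /tproj /comb linear_sum; apply: eq_bigr => a _; rewrite linearZ_LR dD /comb scaler_sumr.
apply: eq_bigr => b _; rewrite !ffunE -[X in toR _ X]/((f a : S) * phi (D a b)).
by rewrite mulrC toRM mulrC scalerA.
Qed.
End TensorMap.
End Tensor.

Section TensorComplex.
Variables (k : fieldType) (l : nat).
Local Notation R := (veronese k l).
Local Notation S := {mpoly k[2]}.
Local Notation phi := (vero_emb k l).
Hypothesis fgS : fingen (polymod k l).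
Variable A : bcomplex R.

Lemma exists_gens : exists (r : int -> nat) (e : forall i, 'I_(r i) -> A i),
  forall i x, exists c, x = comb (e i) c.
Proof.
exists (fun i => sval (cid (cob_fingen A i))).
exists (fun i => sval (cid (svalP (cid (cob_fingen A i))))).
by move=> i; exact: (svalP (cid (svalP (cid (cob_fingen A i))))).
Qed.

(** [A (x)_R S] is a bounded complex of finitely generated S-modules with [A] as a
    retract. *)
Lemma thick_bcomplex (G : bcomplex R) : mresolved (thick1 G) (polymod k l) -> thick 7%N G A.
Proof.
move=> mrS.
have [r [e eP]] := exists_gens.
pose N i : lmodType S := tens (e i).
have [c cP] : exists c : forall i, A i -> 'I_(r i) -> R, forall i x, x = comb (e i) (c i x).
  by exists (fun i x => sval (cid (eP i x))) => i x; exact: (svalP (cid (eP i x))).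
pose D i a := c (i + 1) (cd A i (e i a)).
have dD i a : cd A i (e i a) = comb (e (i + 1)) (D i a) by apply: cP.
pose dN i : {linear N i -> N (i + 1)} := tmapl (dD i).
have dNN i x : dN (i + 1) (dN i x) = 0.
  rewrite /dN (tmapl_qv (dD i)) tmaplE; apply: qpi0.
  rewrite (@tens_delta k l (r i) (qv x)) !linear_sum; apply: trel_sum => a.
  rewrite !linearZ_LR /= !hmap_ebase; apply: trel_ebase.
  transitivity (cd A (i + 1) (cd A i (e i a))); last exact: cdd.
  by rewrite dD (comb_map (dD (i + 1))).
have [bd bdA] := cob_bounded A.
have bdN i : (bd < `|i|)%N -> forall x : N i, x = 0.
  move=> ib x; rewrite -[x]qpiK (@tens_delta k l (r i) (qv x)); apply: qpi0.
  by apply: trel_sum => a; apply: trel_ebase; apply: bdA.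
pose gens i : seq (N i) := codom (fun a => qpi (trels (e i)) (@ebase k l (r i) (fun b => (b == a)%:R))).
(* Adding the images of the generators one degree below, and 0, makes the generating
   sets compatible with the differential. *)
pose V i : seq (N i) := 0 :: gens i ++
  fam_pred (F := fun i => seq (N i)) (fun j => map (dN j) (gens j)) i.
have genV i z : span (V i) z.
  apply: span_sub (tens_gen z) => v vg; apply: mem_span.
  by rewrite inE mem_cat vg orbT.
have dV i v : v \in V i -> dN i v \in V (i + 1).
  rewrite inE mem_cat => /or3P [/eqP ->|vg|].
  - by rewrite linear0 inE eqxx.
  - by rewrite inE mem_cat fam_predE map_f ?orbT.
  elim/int_succ_ind: i v => j v; rewrite fam_predE => /mapP [w _ ->].
  by rewrite dNN inE eqxx.
pose X := scomplex fgS dNN bdN genV.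
have tX : thick 7%N G X by apply: thick_scomplex.
apply: (tc_retract (thick_closed_thick _ G)) tX.
pose al i (x : A i) : X i := qpi (trels (e i)) (ebase (c i x)).
have ebE i (u v : 'I_(r i) -> R) : comb (e i) u = comb (e i) v ->
    qpi (trels (e i)) (ebase u) = qpi (trels (e i)) (ebase v).
  move=> E; apply: qpi_eq.
  have -> : ebase u - ebase v = 1 *: ebase (fun a => u a - v a).
    by rewrite scale1r; apply/ffunP => a; rewrite !ffunE rmorphB.
  apply: trel_ebase; rewrite /comb; under eq_bigr => a _ do rewrite scalerBl.
  by rewrite sumrB; apply/eqP; rewrite subr_eq0; apply/eqP.
have alL i : linear (@al i).
  move=> a x y; rewrite /al.
  rewrite (ebE _ _ (fun b => a * c i x b + c i y b)); last first.
    rewrite -cP {1}(cP i x) {1}(cP i y) /comb scaler_sumr -big_split.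
    by apply: eq_bigr => b _; rewrite scalerDl scalerA.
  rewrite -[RHS]/(phi a *: (qpi _ _ : N i) + (qpi _ _ : N i)) -linearP; congr qpi.
  by apply/ffunP => b; rewrite !ffunE rmorphD rmorphM.
pose be i (x : X i) : A i := tproj (e i) (qv (x : N i)).
have beL i : linear (@be i).
  move=> a x y; rewrite /be -tprojZ -tprojD; apply: tproj_eq.
  exact: (@qvL _ _ (trels (e i)) (phi a) x y).
pose al' i : {linear A i -> X i} := HB.pack (@al i) (GRing.isLinear.Build R (A i) (X i) _ (@al i) (alL i)).
pose be' i : {linear X i -> A i} := HB.pack (@be i) (GRing.isLinear.Build R (X i) (A i) _ (@be i) (beL i)).
have alcd i x : al' (i + 1) (cd A i x) = cd X i (al' i x).
  rewrite -[RHS]/(tmapl (dD i) (qpi (trels (e i)) (ebase (c i x)))) tmaplE hmap_ebase; apply: ebE.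
  by rewrite -cP -(comb_map (dD i)) -cP.
have becd i x : be' (i + 1) (cd X i x) = cd A i (be' i x).
  rewrite -[LHS]/(tproj (e (i + 1)) (qv (tmapl (dD i) x))) -[RHS]/(cd A i (tproj (e i) (qv x))).
  rewrite -(tproj_hmap (dD i)); apply: tproj_eq.
  exact: (qvK (trels (e (i + 1)))).
apply: (dretract_id (i := @CMap R A X al' alcd) (r := @CMap R X A be' becd)) => i x.
rewrite /= /be /al (tproj_eq (g := ebase (c i x))) ?tproj_ebase -?cP //.
exact: (qvK (trels (e i))). Qed.
End TensorComplex.

(** * The theorem *)

Theorem proposition6p8 (k : fieldType) (p l : nat)
    (chk : p \in [pchar k]) (kF : F_finite k p) (l_gt0 : (0 < l)%N) :
  strong_generator (stalk (frob_veronese_fingen chk l_gt0 kF)).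
Proof.
exists 7%N; split=> // A.
set G := stalk _.
have tc := thick1_closed G; have tG : thick1 G G by move=> P _.
have s0 := stalks_in_Mod tc tG (or_introl (erefl 0%N)).
have s1 := stalks_in_Mod tc tG (or_intror (erefl l.-1)).
have f0 := fingen_Mod chk l_gt0 kF (or_introl (erefl 0%N)).
have f1 := fingen_Mod chk l_gt0 kF (or_intror (erefl l.-1)).
have mrS : mresolved (thick1 G) (polymod k l) by apply: mresolved_polymod.
apply: thick_bcomplex (mrS) => //.
have [B [C [f [g [s [_ fgC] _ _]]]]] := mrS.
exact: (fingen_surj (mses_surj s) fgC).
Qed.
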